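(* Let $(F,s)$ be a primitive, recognisable mixed substitution system on a finite alphabet $\mathcal{A}$. For $i\ge 0$ let $K_i=K_{F,\sigma^i(s)}$ be the Barge–Diamond complex of $(F,\sigma^i(s))$ and let $g_i\colon K_{i+1}\to K_i$ be the cellular map induced by $\phi_{s_i}$. Then there is an isomorphism of groups $$\check{H}^1(\Omega_{F,s})\cong\varinjlim(H^1(K_i),g_i^* ).$$
   Context: Let $\mathcal{A}$ be a finite alphabet, $\mathcal{A}^*=\bigcup_{n\ge 1}\mathcal{A}^n$. A substitution is a map $\phi\colon\mathcal{A}\to\mathcal{A}^*$, extended to words and to bi-infinite sequences by concatenation: $\phi(\dots a_{-1}\cdot a_0a_1\dots)=\dots\phi(a_{-1})\cdot\phi(a_0)\phi(a_1)\dots$, the dot marking the boundary between positions $-1$ and $0$. Its matrix $M_\phi$ has $(i,j)$ entry the number of occurrences of the $i$th letter in the image under $\phi$ of the $j$th letter. A mixed substitution system is a pair $(F,s)$ with $F=\{\phi_0,\dots,\phi_k\}$ a finite set of substitutions on $\mathcal{A}$ and $s=(s_0,s_1,\dots)\in\{0,\dots,k\}^{\mathbb{N}}$; $\sigma$ denotes the left shift, on $s$ and on $\mathcal{A}^{\mathbb{Z}}$. Write $\phi_{s[m,n]}=\phi_{s_m}\circ\cdots\circ\phi_{s_n}$, with matrix $M_{s[m,n]}$. The system is (weakly) primitive if for every $n\ge 0$ there is $k\ge 1$ such that $M_{s[n,n+k]}$ has strictly positive entries. A bi-infinite sequence is admitted by $(F,s)$ if each of its finite subwords is a subword of $\phi_{s[0,n]}(a)$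 for some $n\ge 0$, $a\in\mathcal{A}$. $\Sigma_{F,s}\subset\mathcal{A}^{\mathbb{Z}}$ is the space of admitted sequences, and $\mathcal{L}^2_{F,s}$ is the set of two-letter words occurring in elements of $\Sigma_{F,s}$. The tiling space is $\Omega_{F,s}=(\Sigma_{F,s}\times[0,1])/{\sim}$ with $(\mathcal{T},1)\sim(\sigma(\mathcal{T}),0)$. The continuous map $\phi_{s_i}\colon\Omega_{F,\sigma^{i+1}(s)}\to\Omega_{F,\sigma^i(s)}$ sends $(\mathcal{T},t)$, with $t\in[0,1)$ and $\mathcal{T}=\dots a_{-1}\cdot a_0a_1\dots$, to $(\sigma^{\lfloor\tilde t\rfloor}(\phi_{s_i}(\mathcal{T})),\tilde t-\lfloor\tilde t\rfloor)$, where $\tilde t=|\phi_{s_i}(a_0)|\,t$. The system is recognisable if all these maps, $i\ge 0$, are injective. Barge–Diamond complex: let $\epsilon=\min_{a\in\mathcal{A},\phi\in F}\frac{1}{2|\phi(a)|}$, $e_a=[\epsilon,1-\epsilon]\times\{a\}$ for $a\in\mathcal{A}$, and $e_{ab}=[-\epsilon,\epsilon]\times\{ab\}$ for $ab\in\mathcal{L}^2_{F,s}$. Then $K_{F,s}=\left(\bigcup_{a\in\mathcal{A}}e_a\cup\bigcup_{ab\in\mathcal{L}^2_{F,s}}e_{ab}\right)/{\sim}$, where $(1-\epsilon,a)\sim(-\epsilon,ab)\sim(-\epsilon,ac)$ and $(\epsilon,a)\sim(\epsilon,ba)\sim(\epsilon,ca)$ for all $a,b,c\in\mathcal{A}$ for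 which these edges exist. The cellular map $g_i\colon K_{i+1}\to K_i$: if $\phi_{s_i}(a)=a_1a_2\cdots a_k$, then $g_i$ maps $e_a$ onto the edge path $e_{a_1}\cup e_{a_1a_2}\cup e_{a_2}\cup\cdots\cup e_{a_{k-1}a_k}\cup e_{a_k}$ in an orientation-preserving and uniformly expanding way. On $e_{ab}$ it is the orientation-preserving identification with $e_{cd}$, where $c$ is the rightmost letter of $\phi_{s_i}(a)$ and $d$ is the leftmost letter of $\phi_{s_i}(b)$. Cohomology has integer coefficients. *)

(* Defs.v *)
From HB Require Import structures.
From mathcomp Require Import all_boot all_order all_algebra generic_quotient ring_quotient.
From mathcomp Require Import all_classical all_reals all_analysis.
From Stdlib Require Import Relation_Operators.
From mathcomp Require Import ring lra zify.

Set Implicit Arguments.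
Unset Strict Implicit.
Unset Printing Implicit Defensive.

Import Order.TTheory GRing.Theory Num.Theory.
Import numFieldNormedType.Exports.
Import Quotient.Exports.

Local Open Scope classical_set_scope.
Local Open Scope ring_scope.
Local Open Scope quotient_scope.

(** * First cohomology of a semisimplicial set, integer coefficients *)

Record sset2 := SSet2 {
  splx0 : Type;
  splx1 : Type;
  splx2 : Type;
  d1_0 : splx1 -> splx0;
  d1_1 : splx1 -> splx0;
  d2_0 : splx2 -> splx1;
  d2_1 : splx2 -> splx1;
  d2_2 : splx2 -> splx1;
  d0d1 : forall t, d1_0 (d2_1 t) = d1_0 (d2_0 t);
  d0d2 : forall t, d1_0 (d2_2 t) = d1_1 (d2_0 t);
  d1d2 : forall t, d1_1 (d2_2 t) = d1_1 (d2_1 t)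
}.

Section H1.
Context (S : sset2).

Definition cobd0 (h : splx0 S -> int) : splx1 S -> int :=
  fun e => h (d1_0 e) - h (d1_1 e).

Definition cobd1 (c : splx1 S -> int) : splx2 S -> int :=
  fun t => c (d2_0 t) - c (d2_1 t) + c (d2_2 t).

Lemma cobd1_cobd0 h t : cobd1 (cobd0 h) t = 0.
Proof. by rewrite /cobd1 /cobd0 d0d1 d0d2 d1d2; ring. Qed.

Definition cocycle1 : {pred splx1 S -> int} :=
  fun c => `[< forall t, cobd1 c t = 0 >].

Lemma cocycle1_zmod_closed : zmod_closed cocycle1.
Proof.
split=> [|x y /asboolP hx /asboolP hy]; apply/asboolP => t.
  by rewrite -[LHS]/(0 - 0 + 0 : int).
have -> : cobd1 (x - y) t = cobd1 x t - cobd1 y t by rewrite /cobd1 !fctE; ring.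
by rewrite hx hy subrr.
Qed.
HB.instance Definition _ :=
  GRing.isZmodClosed.Build (splx1 S -> int) cocycle1 cocycle1_zmod_closed.

Definition Z1 := {c : splx1 S -> int | c \in cocycle1}.
HB.instance Definition _ := Choice.on Z1.
HB.instance Definition _ := SubChoice.on Z1.
HB.instance Definition _ := [SubChoice_isSubZmodule of Z1 by <:].

Definition coboundary1 : {pred Z1} := fun c => `[< exists h, val c = cobd0 h >].

Lemma coboundary1_zmod_closed : zmod_closed coboundary1.
Proof.
split=> [|x y /asboolP [h hx] /asboolP [k ky]]; apply/asboolP.
  by exists 0; apply/funext.
exists (h - k); rewrite raddfB /= hx ky; apply/funext => t.
by rewrite /cobd0 !fctE; ring.
Qed.
HB.instance Definition _ :=
  GRing.isZmodClosed.Build Z1 coboundary1 coboundary1_zmod_closed.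

Definition H1 : zmodType := Quotient.quot (coboundary1 : zmodClosed Z1).

End H1.
Arguments cocycle1 : clear implicits.
Arguments coboundary1 : clear implicits.

Record sset2_map (S T : sset2) := SSet2Map {
  smap0 : splx0 S -> splx0 T;
  smap1 : splx1 S -> splx1 T;
  smap2 : splx2 S -> splx2 T;
  smap_d1_0 : forall e, d1_0 (smap1 e) = smap0 (d1_0 e);
  smap_d1_1 : forall e, d1_1 (smap1 e) = smap0 (d1_1 e);
  smap_d2_0 : forall t, d2_0 (smap2 t) = smap1 (d2_0 t);
  smap_d2_1 : forall t, d2_1 (smap2 t) = smap1 (d2_1 t);
  smap_d2_2 : forall t, d2_2 (smap2 t) = smap1 (d2_2 t)
}.

Section H1_pullback.
Context (S T : sset2) (f : sset2_map S T).

Lemma Z1_pullback_subproof (c : Z1 T) : val c \o smap1 f \in cocycle1 S.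
Proof.
case: c => c /= /asboolP hc; apply/asboolP => t; rewrite -[RHS](hc (smap2 f t)).
by rewrite /cobd1 /= smap_d2_0 smap_d2_1 smap_d2_2.
Qed.

Definition Z1_pullback (c : Z1 T) : Z1 S := exist (fun c => c \in cocycle1 S) _ (Z1_pullback_subproof c).

Definition H1_pullback (x : H1 T) : H1 S :=
  \pi_(H1 S) (Z1_pullback (repr x)).

Lemma H1_pullbackE (c : Z1 T) :
  H1_pullback (\pi_(H1 T) c) = \pi_(H1 S) (Z1_pullback c).
Proof.
apply/eqP; rewrite -Quotient.idealrBE.
have : \pi_(H1 T) (repr (\pi_(H1 T) c)) == \pi_(H1 T) c by rewrite reprK.
rewrite -Quotient.idealrBE => /asboolP [h hh]; apply/asboolP.
exists (h \o smap0 f); apply/funext => e.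
rewrite /= /cobd0 /= -smap_d1_0 -smap_d1_1.
by rewrite -[RHS]/(cobd0 h (smap1 f e)) -hh.
Qed.

Lemma H1_pullback_is_zmod_morphism : zmod_morphism H1_pullback.
Proof.
move=> x y; rewrite -[x]reprK -[y]reprK -raddfB !H1_pullbackE -raddfB.
by congr (\pi _); apply/val_inj.
Qed.
HB.instance Definition _ :=
  GRing.isZmodMorphism.Build _ _ H1_pullback H1_pullback_is_zmod_morphism.

End H1_pullback.

(** * Direct limits of abelian groups *)

Record dirsys := DirSys {
  ds_idx : Type;
  ds_idx0 : ds_idx;
  ds_le : ds_idx -> ds_idx -> Prop;
  ds_le_refl : forall i, ds_le i i;
  ds_le_trans : forall i j k, ds_le i j -> ds_le j k -> ds_le i k;
  ds_directed : forall i j, exists k, ds_le i k /\ ds_le j k;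
  ds_grp : ds_idx -> zmodType;
  ds_map : forall i j, ds_le i j -> {additive ds_grp i -> ds_grp j};
  ds_map_id : forall i (h : ds_le i i) x, ds_map h x = x;
  ds_map_comp : forall i j k (hij : ds_le i j) (hjk : ds_le j k)
    (hik : ds_le i k) x, ds_map hjk (ds_map hij x) = ds_map hik x
}.

Section dirlim.
Context (D : dirsys).

Let pair := {classic {i : ds_idx D & ds_grp i : Type}}.

Definition dirlim_rel : rel pair := fun x y =>
  `[< exists k (hx : ds_le (tag x) k) (hy : ds_le (tag y) k),
      ds_map hx (tagged x) = ds_map hy (tagged y) >].

Lemma dirlim_rel_class : equiv_class_of dirlim_rel.
Proof.
split=> [x|x y|y x z].
- by apply/asboolP; exists (tag x), (ds_le_refl _), (ds_le_refl _).
- by apply/asboolP/asboolP => -[k [hx [hy e]]]; exists k, hy, hx.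
- move=> /asboolP[k [hx [hy e]]] /asboolP[l [hy' [hz e']]]; apply/asboolP.
  have [m [km lm]] := ds_directed k l.
  have hxm := ds_le_trans hx km; have hzm := ds_le_trans hz lm.
  have hym := ds_le_trans hy km.
  exists m, hxm, hzm.
  rewrite -(ds_map_comp hx km hxm) e (ds_map_comp hy km hym).
  by rewrite -(ds_map_comp hy' lm hym) e' (ds_map_comp hz lm hzm).
Qed.
Canonical dirlim_equiv := EquivRelPack dirlim_rel_class.

Definition dirlim := {eq_quot dirlim_equiv}.
HB.instance Definition _ := Choice.on dirlim.

Definition dirlim_in (i : ds_idx D) (x : ds_grp i) : dirlim :=
  \pi_dirlim (existT _ i x : pair).

Lemma dirlim_inP i j (x : ds_grp i) (y : ds_grp j) :
  dirlim_in x = dirlim_in y <->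
  exists k (hi : ds_le i k) (hj : ds_le j k), ds_map hi x = ds_map hj y.
Proof.
rewrite /dirlim_in; split=> [/eqP|h]; first by rewrite piE => /asboolP.
by apply/eqP; rewrite piE; apply/asboolP.
Qed.

Lemma dirlim_in_map i j (h : ds_le i j) x :
  dirlim_in (ds_map h x) = dirlim_in x.
Proof.
by apply/dirlim_inP; exists j, (ds_le_refl j), h; rewrite ds_map_id.
Qed.

Lemma dirlim_in_surj (u : dirlim) : exists i (x : ds_grp i), u = dirlim_in x.
Proof.
exists (tag (repr u : pair)), (tagged (repr u : pair)).
by rewrite /dirlim_in -[LHS]reprK; case: (repr u).
Qed.

Definition dirlim_add (u v : dirlim) : dirlim :=
  let x := repr u : pair in let y := repr v : pair in
  let k := cid (ds_directed (tag x) (tag y)) in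
  dirlim_in (ds_map (projT2 k).1 (tagged x) + ds_map (projT2 k).2 (tagged y)).

Definition dirlim_opp (u : dirlim) : dirlim := dirlim_in (- tagged (repr u : pair)).

Definition dirlim_zero : dirlim := dirlim_in (0 : ds_grp (ds_idx0 D)).

Lemma dirlim_addE i (x y : ds_grp i) :
  dirlim_add (dirlim_in x) (dirlim_in y) = dirlim_in (x + y).
Proof.
rewrite /dirlim_add; case: cid => k [/= h h'].
have : dirlim_in (tagged (repr (dirlim_in x) : pair)) = dirlim_in x.
  by rewrite -[RHS]reprK /dirlim_in; case: (repr _).
have : dirlim_in (tagged (repr (dirlim_in y) : pair)) = dirlim_in y.
  by rewrite -[RHS]reprK /dirlim_in; case: (repr _).
move: h h'; set a := (repr _ : pair); set b := (repr _ : pair).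
case: a b => [a x'] [b y'] /= h h'.
move=> /dirlim_inP[m [bm [im ey]]] /dirlim_inP[n [an [iN ex]]].
have [p [mp np]] := ds_directed m n.
have [q [pq kq]] := ds_directed p k.
have mq := ds_le_trans mp pq; have nq := ds_le_trans np pq.
have iq := ds_le_trans im mq.
apply/dirlim_inP; exists q, kq, iq; rewrite !raddfD.
rewrite (ds_map_comp _ _ (ds_le_trans an nq)).
rewrite (ds_map_comp _ _ (ds_le_trans bm mq)).
rewrite -(ds_map_comp an nq) ex -(ds_map_comp bm mq) ey.
by rewrite (ds_map_comp _ _ iq) (ds_map_comp _ _ iq).
Qed.

Lemma dirlim_in2 (u v : dirlim) :
  exists i (x y : ds_grp i), u = dirlim_in x /\ v = dirlim_in y.
Proof.
have [i [x ->]] := dirlim_in_surj u; have [j [y ->]] := dirlim_in_surj v.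
have [k [ik jk]] := ds_directed i j.
by exists k, (ds_map ik x), (ds_map jk y); rewrite !dirlim_in_map.
Qed.

Lemma dirlim_oppE i (x : ds_grp i) : dirlim_opp (dirlim_in x) = dirlim_in (- x).
Proof.
rewrite /dirlim_opp.
have : dirlim_in (tagged (repr (dirlim_in x) : pair)) = dirlim_in x.
  by rewrite -[RHS]reprK /dirlim_in; case: (repr _).
case: (repr _ : pair) => [a x'] /= /dirlim_inP[n [an [iN ex]]].
by apply/dirlim_inP; exists n, an, iN; rewrite !raddfN ex.
Qed.

Lemma dirlim_zeroE i : dirlim_zero = dirlim_in (0 : ds_grp i).
Proof.
have [k [ik jk]] := ds_directed (ds_idx0 D) i.
by apply/dirlim_inP; exists k, ik, jk; rewrite !raddf0.
Qed.

Lemma dirlim_addA : associative dirlim_add.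
Proof.
move=> u v w; have [i [x [y [-> ->]]]] := dirlim_in2 u v.
have [j [z ->]] := dirlim_in_surj w; have [k [ik jk]] := ds_directed i j.
rewrite -(dirlim_in_map ik x) -(dirlim_in_map ik y) -(dirlim_in_map jk z).
by rewrite !dirlim_addE addrA.
Qed.

Lemma dirlim_addC : commutative dirlim_add.
Proof.
move=> u v; have [i [x [y [-> ->]]]] := dirlim_in2 u v.
by rewrite !dirlim_addE addrC.
Qed.

Lemma dirlim_add0 : left_id dirlim_zero dirlim_add.
Proof.
move=> u; have [i [x ->]] := dirlim_in_surj u.
by rewrite (dirlim_zeroE i) dirlim_addE add0r.
Qed.

Lemma dirlim_addN : left_inverse dirlim_zero dirlim_opp dirlim_add.
Proof.
move=> u; have [i [x ->]] := dirlim_in_surj u.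
by rewrite (dirlim_zeroE i) dirlim_oppE dirlim_addE addNr.
Qed.

HB.instance Definition _ := GRing.isZmodule.Build dirlim
  dirlim_addA dirlim_addC dirlim_add0 dirlim_addN.

Lemma dirlim_in_is_zmod_morphism i : zmod_morphism (@dirlim_in i).
Proof.
move=> x y; rewrite -[RHS]/(dirlim_add (dirlim_in x) (dirlim_opp (dirlim_in y))).
by rewrite dirlim_oppE dirlim_addE.
Qed.
HB.instance Definition _ i := GRing.isZmodMorphism.Build
  (ds_grp i) dirlim (@dirlim_in i) (@dirlim_in_is_zmod_morphism i).

End dirlim.

(** A sequence G 0 -> G 1 -> G 2 -> ... as a direct system over nat. *)
Section seqsys.
Context (G : nat -> zmodType) (f : forall n, {additive G n -> G n.+1}).

Fixpoint seqsys_add m d : {additive G m -> G (d + m)%N} :=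
  if d is d'.+1 then f (d' + m) \o seqsys_add m d' else idfun.

Lemma seqsys_eq_zmod_morphism m n (e : m = n) :
  zmod_morphism (fun x : G m => ecast k (G k) e x).
Proof. by case: n / e. Qed.

Definition seqsys_map m n (h : (m <= n)%N) (x : G m) : G n :=
  ecast k (G k) (subnK h) (seqsys_add m (n - m) x).

Lemma seqsys_map_is_zmod_morphism m n (h : (m <= n)%N) :
  zmod_morphism (seqsys_map h).
Proof. by move=> x y; rewrite /seqsys_map raddfB seqsys_eq_zmod_morphism. Qed.
HB.instance Definition _ m n (h : (m <= n)%N) := GRing.isZmodMorphism.Build
  (G m) (G n) (seqsys_map h) (seqsys_map_is_zmod_morphism h).

Lemma seqsys_map_addE m d (h : (m <= d + m)%N) x :
  seqsys_map h x = seqsys_add m d x.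
Proof.
rewrite /seqsys_map; move: (subnK h); rewrite addnK => e.
by rewrite (eq_irrelevance e erefl).
Qed.

Lemma seqsys_map_id m (h : (m <= m)%N) x : seqsys_map h x = x.
Proof. exact: (@seqsys_map_addE m 0). Qed.

Lemma seqsys_mapS m n (h : (m <= n)%N) (h' : (m <= n.+1)%N) x :
  seqsys_map h' x = f n (seqsys_map h x).
Proof.
have [d e] : exists d, (d + m)%N = n by exists (n - m)%N; rewrite subnK.
case: n / e h h' => h h'; by rewrite (@seqsys_map_addE m d.+1) seqsys_map_addE.
Qed.

Lemma seqsys_map_comp m n p (hmn : (m <= n)%N) (hnp : (n <= p)%N)
  (hmp : (m <= p)%N) x : seqsys_map hnp (seqsys_map hmn x) = seqsys_map hmp x.
Proof.
have [d e] : exists d, (d + n)%N = p by exists (p - n)%N; rewrite subnK.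
case: p / e hnp hmp; elim: d => [|d IH] hnp hmp.
  by rewrite (seqsys_map_id hnp) (bool_irrelevance hmn hmp).
have h1 : (n <= d + n)%N by rewrite leq_addl.
have h2 : (m <= d + n)%N by exact: leq_trans h1.
by rewrite (seqsys_mapS h1) (seqsys_mapS h2) IH.
Qed.

Definition seqsys : dirsys := @DirSys nat 0%N (fun m n => (m <= n)%N)
  leqnn (fun i j k => @leq_trans j i k)
  (fun i j => ex_intro _ (maxn i j) (conj (leq_maxl i j) (leq_maxr i j)))
  G (fun m n h => seqsys_map h) seqsys_map_id seqsys_map_comp.

End seqsys.

(** * Cech cohomology: direct limit over open covers of the H^1 of the nerve *)

Section cech.
Context (X : topologicalType).

Record open_cover := OpenCover {
  cover_sets :> set X -> Prop;
  cover_open : forall U, cover_sets U -> open U;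
  cover_full : forall x, exists U, cover_sets U /\ U x
}.

Definition refined_by (C D : open_cover) : Prop :=
  forall V, D V -> exists U, C U /\ V `<=` U.

Lemma refined_by_refl C : refined_by C C.
Proof. by move=> V CV; exists V; split. Qed.

Lemma refined_by_trans C D E :
  refined_by C D -> refined_by D E -> refined_by C E.
Proof.
move=> CD DE W /DE [V [/CD [U [CU VU]] WV]].
by exists U; split=> //; exact: (subset_trans WV VU).
Qed.

Lemma refined_by_directed C D : exists E, refined_by C E /\ refined_by D E.
Proof.
pose E := [set W | exists U V, [/\ C U, D V & W = U `&` V]].
have Eo W : E W -> open W.
  by move=> [U [V [/cover_open oU /cover_open oV ->]]]; exact: openI.
have Ef x : exists W, E W /\ W x.
  have [U [CU Ux]] := cover_full C x; have [V [DV Vx]] := cover_full D x.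
  by exists (U `&` V); split=> //; exists U, V.
exists (OpenCover Eo Ef); split=> W /= [U [V [CU DV ->]]].
  by exists U; split=> //; exact: subIsetl.
by exists V; split=> //; exact: subIsetr.
Qed.

Lemma trivial_cover_open (U : set X) : [set setT] U -> open U.
Proof. by move=> ->; exact: openT. Qed.

Lemma trivial_cover_full (x : X) : exists U, [set [set: X]] U /\ U x.
Proof. by exists setT. Qed.

Definition trivial_cover := OpenCover trivial_cover_open trivial_cover_full.

(* Ordered simplices of the nerve: tuples of members of the cover, possibly
   with repetitions, with nonempty intersection. *)
Definition is_nerve1 (C : open_cover) (p : set X * set X) : Prop :=
  [/\ C p.1, C p.2 & (p.1 `&` p.2) !=set0].
Definition is_nerve2 (C : open_cover) (p : set X * set X * set X) : Prop :=
  [/\ C p.1.1, C p.1.2, C p.2 & (p.1.1 `&` p.1.2 `&` p.2) !=set0].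
Definition nerve0 (C : open_cover) := {U : set X | C U /\ U !=set0}.
Definition nerve1 (C : open_cover) := {p | is_nerve1 C p}.
Definition nerve2 (C : open_cover) := {p | is_nerve2 C p}.

Section nerve.
Context (C : open_cover).

Lemma nerve_d1_0_subproof (e : nerve1 C) :
  C (sval e).2 /\ (sval e).2 !=set0.
Proof. by case: e => p /= [_ ? [x [_ ?]]]; split=> //; exists x. Qed.

Lemma nerve_d1_1_subproof (e : nerve1 C) :
  C (sval e).1 /\ (sval e).1 !=set0.
Proof. by case: e => p /= [? _ [x [? _]]]; split=> //; exists x. Qed.

Definition nerve_d1_0 (e : nerve1 C) : nerve0 C :=
  exist _ (sval e).2 (nerve_d1_0_subproof e).
Definition nerve_d1_1 (e : nerve1 C) : nerve0 C :=
  exist _ (sval e).1 (nerve_d1_1_subproof e).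

Lemma nerve_d2_0_subproof (t : nerve2 C) :
  is_nerve1 C ((sval t).1.2, (sval t).2).
Proof. by case: t => p /= [? ? ? [x [[? ?] ?]]]; split=> //; exists x. Qed.

Lemma nerve_d2_1_subproof (t : nerve2 C) :
  is_nerve1 C ((sval t).1.1, (sval t).2).
Proof. by case: t => p /= [? ? ? [x [[? ?] ?]]]; split=> //; exists x. Qed.

Lemma nerve_d2_2_subproof (t : nerve2 C) :
  is_nerve1 C ((sval t).1.1, (sval t).1.2).
Proof. by case: t => p /= [? ? ? [x [[? ?] ?]]]; split=> //; exists x. Qed.

Definition nerve_d2_0 (t : nerve2 C) : nerve1 C :=
  exist (is_nerve1 C)
    ((sval t).1.2, (sval t).2) (nerve_d2_0_subproof t).
Definition nerve_d2_1 (t : nerve2 C) : nerve1 C :=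
  exist (is_nerve1 C)
    ((sval t).1.1, (sval t).2) (nerve_d2_1_subproof t).
Definition nerve_d2_2 (t : nerve2 C) : nerve1 C :=
  exist (is_nerve1 C)
    ((sval t).1.1, (sval t).1.2) (nerve_d2_2_subproof t).

Lemma nerve_d0d1 t : nerve_d1_0 (nerve_d2_1 t) = nerve_d1_0 (nerve_d2_0 t).
Proof. exact: eq_exist. Qed.

Lemma nerve_d0d2 t : nerve_d1_0 (nerve_d2_2 t) = nerve_d1_1 (nerve_d2_0 t).
Proof. exact: eq_exist. Qed.

Lemma nerve_d1d2 t : nerve_d1_1 (nerve_d2_2 t) = nerve_d1_1 (nerve_d2_1 t).
Proof. exact: eq_exist. Qed.

Definition nerve : sset2 := SSet2 nerve_d0d1 nerve_d0d2 nerve_d1d2.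

End nerve.

(* A choice of r with V `<=` r V is a simplicial map between the nerves; on H^1
   it does not depend on the choice (refine_H1_unique). *)
Section refinement.
Context (C D : open_cover) (r : set X -> set X).
Context (Cr : forall V, D V -> C (r V)) (rsub : forall V, D V -> V `<=` r V).

Lemma refine0_subproof (v : nerve0 D) :
  C (r (sval v)) /\ r (sval v) !=set0.
Proof.
case: v => V /= [DV [x Vx]]; split; first exact: Cr.
by exists x; exact: rsub.
Qed.

Lemma refine1_subproof (e : nerve1 D) :
  [/\ C (r (sval e).1), C (r (sval e).2)
    & (r (sval e).1 `&` r (sval e).2) !=set0].
Proof.
case: e => p /= [h1 h2 [x [x1 x2]]]; split; [exact: Cr|exact: Cr|].
by exists x; split; exact: rsub.
Qed.

Lemma refine2_subproof (t : nerve2 D) :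
  [/\ C (r (sval t).1.1), C (r (sval t).1.2), C (r (sval t).2)
    & (r (sval t).1.1 `&` r (sval t).1.2 `&` r (sval t).2) !=set0].
Proof.
case: t => p /= [h1 h2 h3 [x [[x1 x2] x3]]].
split; [exact: Cr|exact: Cr|exact: Cr|].
by exists x; split; [split|]; exact: rsub.
Qed.

Definition refine0 (v : nerve0 D) : nerve0 C :=
  exist _ (r (sval v)) (refine0_subproof v).
Definition refine1 (e : nerve1 D) : nerve1 C :=
  exist (is_nerve1 C)
    (r (sval e).1, r (sval e).2) (refine1_subproof e).
Definition refine2 (t : nerve2 D) : nerve2 C :=
  exist (is_nerve2 C)
    (r (sval t).1.1, r (sval t).1.2, r (sval t).2) (refine2_subproof t).

Lemma refine_d1_0 e : nerve_d1_0 (refine1 e) = refine0 (nerve_d1_0 e).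
Proof. exact: eq_exist. Qed.

Lemma refine_d1_1 e : nerve_d1_1 (refine1 e) = refine0 (nerve_d1_1 e).
Proof. exact: eq_exist. Qed.

Lemma refine_d2_0 t : nerve_d2_0 (refine2 t) = refine1 (nerve_d2_0 t).
Proof. exact: eq_exist. Qed.

Lemma refine_d2_1 t : nerve_d2_1 (refine2 t) = refine1 (nerve_d2_1 t).
Proof. exact: eq_exist. Qed.

Lemma refine_d2_2 t : nerve_d2_2 (refine2 t) = refine1 (nerve_d2_2 t).
Proof. exact: eq_exist. Qed.

Definition refine_map : sset2_map (nerve D) (nerve C) :=
  @SSet2Map (nerve D) (nerve C) refine0 refine1 refine2
    refine_d1_0 refine_d1_1 refine_d2_0 refine_d2_1 refine_d2_2.

End refinement.

Lemma refine_H1_unique (C D : open_cover) (r r' : set X -> set X)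
  (Cr : forall V, D V -> C (r V)) (rsub : forall V, D V -> V `<=` r V)
  (Cr' : forall V, D V -> C (r' V)) (rsub' : forall V, D V -> V `<=` r' V) :
  H1_pullback (refine_map Cr rsub) =1 H1_pullback (refine_map Cr' rsub').
Proof.
move=> x; rewrite -[x]reprK !H1_pullbackE; apply/eqP.
rewrite -Quotient.idealrBE; apply/asboolP; move: (repr x) => [c cZ].
have cT t : cobd1 c t = 0 by move/asboolP: (cZ); apply.
have hP (v : nerve0 D) : let V := sval v in
    [/\ C (r V), C (r' V) & (r V `&` r' V) !=set0].
  case: v => V /= [DV [y Vy]]; split; [exact: Cr|exact: Cr'|].
  by exists y; split; [exact: rsub|exact: rsub'].
pose P v : nerve1 C := exist (is_nerve1 C) (r (sval v), r' (sval v)) (hP v).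
exists (fun v => - c (P v)); apply/funext => e.
rewrite -[LHS]/(c (refine1 Cr rsub e) - c (refine1 Cr' rsub' e)).
rewrite -[RHS]/(- c (P (nerve_d1_0 e)) - - c (P (nerve_d1_1 e))).
case: e => -[U V] /= UV; have [/= DU DV [y [Uy Vy]]] := UV.
set e : nerve1 D := exist (is_nerve1 D) (U, V) UV.
have t1P : [/\ C (r U), C (r V), C (r' V)
    & (r U `&` r V `&` r' V) !=set0].
  split; [exact: Cr|exact: Cr|exact: Cr'|].
  by exists y; split; [split|]; (exact: rsub || exact: rsub').
have t2P : [/\ C (r U), C (r' U), C (r' V)
    & (r U `&` r' U `&` r' V) !=set0].
  split; [exact: Cr|exact: Cr'|exact: Cr'|].
  by exists y; split; [split|]; (exact: rsub || exact: rsub').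
pose t1 : nerve2 C := exist (is_nerve2 C)
  (r U, r V, r' V) t1P.
pose t2 : nerve2 C := exist (is_nerve2 C)
  (r U, r' U, r' V) t2P.
have := cT t1; have := cT t2; rewrite /cobd1 /=.
have -> : nerve_d2_0 t1 = P (nerve_d1_0 e) by exact: eq_exist.
have -> : nerve_d2_2 t1 = refine1 Cr rsub e by exact: eq_exist.
have -> : nerve_d2_0 t2 = refine1 Cr' rsub' e by exact: eq_exist.
have -> : nerve_d2_2 t2 = P (nerve_d1_1 e) by exact: eq_exist.
have -> : nerve_d2_1 t2 = nerve_d2_1 t1 by exact: eq_exist.
lra.
Qed.

Section refine_H1.
Context (C D : open_cover) (CD : refined_by C D).

Definition refine_choice : {r : set X -> set X |
  forall V, D V -> C (r V) /\ V `<=` r V}.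
Proof.
apply: cid; exists (fun V => if pselect (D V) is left DV
  then sval (cid (CD DV)) else V) => V DV.
by case: pselect => // DV'; case: cid.
Qed.

Definition refine_H1 : {additive H1 (nerve C) -> H1 (nerve D)} :=
  H1_pullback (refine_map (fun V DV => (svalP refine_choice V DV).1)
                          (fun V DV => (svalP refine_choice V DV).2)).

Lemma refine_H1E (r : set X -> set X) (Cr : forall V, D V -> C (r V))
    (rsub : forall V, D V -> V `<=` r V) x :
  refine_H1 x = H1_pullback (refine_map Cr rsub) x.
Proof. exact: refine_H1_unique. Qed.

End refine_H1.

Lemma refine_H1_id C (CC : refined_by C C) x : refine_H1 CC x = x.
Proof.
have h1 V : C V -> C (id V) by [].
have h2 V : C V -> V `<=` id V by move=> _; exact: subset_refl.
rewrite (refine_H1E CC h1 h2) -[x]reprK H1_pullbackE.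
apply: (congr1 \pi_(H1 (nerve _))); apply/val_inj/funext => e /=.
by congr (val (repr x) _); case: e => -[U V] h; exact: eq_exist.
Qed.

Lemma refine_H1_comp C D E (CD : refined_by C D) (DE : refined_by D E)
  (CE : refined_by C E) x : refine_H1 DE (refine_H1 CD x) = refine_H1 CE x.
Proof.
have hr := svalP (refine_choice CD); set r := sval _ in hr.
have hr' := svalP (refine_choice DE); set r' := sval _ in hr'.
have h1 V : E V -> C (r (r' V)) by move=> /hr' [/hr []].
have h2 V : E V -> V `<=` r (r' V).
  by move=> /hr' [/hr [_ h] h']; exact: (subset_trans h' h).
rewrite (refine_H1E CE h1 h2) /refine_H1 /=.
set m1 : sset2_map (nerve D) (nerve C) := refine_map _ _.
set m2 : sset2_map (nerve E) (nerve D) := refine_map _ _.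
have -> : H1_pullback m2 (H1_pullback m1 x) =
    \pi_(H1 (nerve E)) (Z1_pullback m2 (Z1_pullback m1 (repr x))).
  by rewrite -H1_pullbackE.
apply: (congr1 \pi_(H1 (nerve E))); apply/val_inj/funext => e /=.
by apply: congr1; exact: eq_exist.
Qed.

Definition cech_system : dirsys := @DirSys open_cover trivial_cover refined_by
  refined_by_refl refined_by_trans refined_by_directed
  (fun C => H1 (nerve C)) refine_H1 refine_H1_id refine_H1_comp.

Definition cech_H1 : zmodType := dirlim cech_system.

End cech.

(** * Quotient spaces and singular cohomology *)

(** The quotient of a space by the equivalence relation generated by r. *)
Section topquot.
Context (T : topologicalType) (r : T -> T -> Prop).

Definition gen_rel : rel T := fun x y => `[< clos_refl_sym_trans T r x y >].

Lemma gen_rel_class : equiv_class_of gen_rel.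
Proof.
split=> [x|x y|y x z]; first by apply/asboolP; exact: (rst_refl T r x).
  by apply/asboolP/asboolP; exact: (rst_sym T r).
by move=> /asboolP yx /asboolP xz; apply/asboolP; exact: (rst_trans T r _ _ _ yx xz).
Qed.
Canonical gen_equiv := EquivRelPack gen_rel_class.

Definition topquot : topologicalType := quotient_topology {eq_quot gen_equiv}.

Definition topquot_pi (x : T) : topquot :=
  \pi_(quotient_topology {eq_quot gen_equiv}) x.

Definition topquot_repr (u : topquot) : T :=
  repr (u : quotient_topology {eq_quot gen_equiv}).

Lemma topquot_reprK u : topquot_pi (topquot_repr u) = u.
Proof. exact: reprK. Qed.

Lemma topquot_piP x y :
  topquot_pi x = topquot_pi y <-> clos_refl_sym_trans T r x y.
Proof.
by split=> [/(eqmodP gen_equiv)/asboolP|h] //; apply/(eqmodP gen_equiv)/asboolP.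
Qed.

End topquot.

Lemma prod_topology_continuous (I : Type) (K : I -> topologicalType)
    (X : topologicalType) (f : X -> prod_topology K) :
  (forall i, continuous (fun x => f x i)) -> continuous f.
Proof.
move=> fc x; apply/cvg_sup => i U [_ [[W oW <-] Wfx WU]].
have : nbhs x ((fun y => f y i) @^-1` W).
  by apply: fc; apply: open_nbhs_nbhs; split.
by apply: filterS => y Wy; exact: WU.
Qed.

Section singular.
Context (R : realType).

Definition simplex n : set (prod_topology (fun _ : 'I_n.+1 => R)) :=
  [set x | (forall i, 0 <= x i) /\ \sum_i x i = 1].
Arguments simplex : clear implicits.

(* The i-th coface map, inserting a zero i-th barycentric coordinate. *)
Definition insert0 n (i : 'I_n.+2) (x : prod_topology (fun _ : 'I_n.+1 => R)) :
    prod_topology (fun _ : 'I_n.+2 => R) :=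
  fun j => if unlift i j is Some k then x k else 0.

Lemma insert0_continuous n (i : 'I_n.+2) : continuous (@insert0 n i).
Proof.
apply: prod_topology_continuous => j.
rewrite /insert0; case: (unlift i j) => [k|].
  exact: (@proj_continuous _ (fun _ : 'I_n.+1 => (R : topologicalType)) k).
exact: cst_continuous.
Qed.

Lemma insert0_simplex n (i : 'I_n.+2) x :
  x \in simplex n -> insert0 i x \in simplex n.+1.
Proof.
rewrite !inE => -[x0 x1]; split=> [j|].
  by rewrite /insert0; case: (unlift i j).
rewrite (bigD1 i) //= {1}/insert0 unlift_none add0r -x1.
rewrite (reindex_onto (lift i) (fun j => odflt ord0 (unlift i j))) /=; last first.
  by move=> j; rewrite eq_sym => /unlift_some[k -> _]; rewrite liftK.
apply: eq_big => [k|k _]; first by rewrite liftK /= eqxx andbT eq_sym neq_lift.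
by rewrite /insert0 liftK.
Qed.

Definition coface n (i : 'I_n.+2) (x : simplex n) : simplex n.+1 :=
  exist _ (insert0 i (val x)) (insert0_simplex i (valP x)).

Lemma coface_continuous n (i : 'I_n.+2) : continuous (@coface n i).
Proof.
apply: continuous_comp_initial => x.
apply: (@continuous_comp _ _ _ (set_val : simplex n -> _) (insert0 i)).
  exact: initial_continuous.
exact: insert0_continuous.
Qed.
HB.instance Definition _ n i :=
  isContinuous.Build (simplex n) (simplex n.+1) (coface i) (@coface_continuous n i).

Context (X : topologicalType).

Definition sing_face n (i : 'I_n.+2) (s : continuousType (simplex n.+1) X) :
  continuousType (simplex n) X := s \o coface i.

Lemma insert0_vertexE (i : 'I_3) (k : 'I_2)
    (x : prod_topology (fun _ : 'I_1 => R)) :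
  insert0 i (insert0 k x) =
  (fun m => if m == lift i (lift k ord0) then x ord0 else 0).
Proof.
apply/funext => m; rewrite /insert0.
case: (unliftP i m) => [j ->|->]; last by rewrite (negPf (neq_lift _ _)).
rewrite (inj_eq (@lift_inj _ i)).
case: (unliftP k j) => [l ->|->]; last by rewrite (negPf (neq_lift _ _)).
by rewrite (ord1 l) eqxx.
Qed.

Lemma sing_face_comm (i j : 'I_3) (k l : 'I_2)
    (t : continuousType (simplex 2) X) :
  lift i (lift k ord0) = lift j (lift l ord0) ->
  sing_face k (sing_face i t) = sing_face l (sing_face j t).
Proof.
move=> h; apply/continuousEP => x.
rewrite -[LHS]/(t (coface i (coface k x))) -[RHS]/(t (coface j (coface l x))).
by congr (t _); apply/val_inj; rewrite /= !insert0_vertexE h.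
Qed.

Lemma sing_d0d1 (t : continuousType (simplex 2) X) :
  sing_face 0 (sing_face 1 t) = sing_face 0 (sing_face 0 t).
Proof. by apply: sing_face_comm; exact/val_inj. Qed.

Lemma sing_d0d2 (t : continuousType (simplex 2) X) :
  sing_face 0 (sing_face 2 t) = sing_face 1 (sing_face 0 t).
Proof. by apply: sing_face_comm; exact/val_inj. Qed.

Lemma sing_d1d2 (t : continuousType (simplex 2) X) :
  sing_face 1 (sing_face 2 t) = sing_face 1 (sing_face 1 t).
Proof. by apply: sing_face_comm; exact/val_inj. Qed.

Definition sing : sset2 := SSet2 sing_d0d1 sing_d0d2 sing_d1d2.

Definition sing_H1 : zmodType := H1 sing.

End singular.
Arguments simplex R n : clear implicits.
Arguments sing R X : clear implicits.
Arguments sing_H1 R X : clear implicits.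

Section singular_pullback.
Context (R : realType) (X Y : topologicalType) (f : continuousType X Y).

Definition sing_comp n (s : continuousType (simplex R n) X) :
  continuousType (simplex R n) Y := f \o s.

Lemma sing_comp_face n i (s : continuousType (simplex R n.+1) X) :
  sing_face i (sing_comp s) = sing_comp (sing_face i s).
Proof. exact/continuousEP. Qed.

Definition sing_map : sset2_map (sing R X) (sing R Y) :=
  @SSet2Map (sing R X) (sing R Y) (@sing_comp 0) (@sing_comp 1) (@sing_comp 2)
    (sing_comp_face 0) (sing_comp_face 1)
    (sing_comp_face 0) (sing_comp_face 1) (sing_comp_face 2).

Definition sing_pullback : {additive sing_H1 R Y -> sing_H1 R X} :=
  H1_pullback sing_map.

End singular_pullback.
Arguments sing_pullback R {X Y} f.

(** * Mixed substitution systems *)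

Record substitution (A : eqType) := Substitution {
  subst_fun :> A -> seq A;
  subst_neq0 : forall a, subst_fun a != [::]
}.

Definition subst_word (A : Type) (phi : A -> seq A) (w : seq A) : seq A :=
  flatten (map phi w).

Section substitutions.
Context (A : finType).
Implicit Types (phi psi : substitution A) (a : A) (w u : seq A).

Lemma subst_word_cat (phi : A -> seq A) w u :
  subst_word phi (w ++ u) = subst_word phi w ++ subst_word phi u.
Proof. by rewrite /subst_word map_cat flatten_cat. Qed.

Lemma size_subst_word phi w : (size w <= size (subst_word phi w))%N.
Proof.
elim: w => //= a w IH; rewrite /subst_word /= size_cat -add1n leq_add //.
by rewrite lt0n size_eq0 subst_neq0.
Qed.

Lemma infix_subst_word phi w u :
  infix w u -> infix (subst_word phi w) (subst_word phi u).
Proof.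
move=> /infixP[p [q ->]]; apply/infixP.
by exists (subst_word phi p), (subst_word phi q); rewrite !subst_word_cat.
Qed.

Lemma subst_comp_neq0 phi psi a : subst_word phi (psi a) != [::].
Proof.
rewrite -size_eq0 -lt0n; apply: leq_trans (size_subst_word _ _).
by rewrite lt0n size_eq0 subst_neq0.
Qed.

Definition subst_comp phi psi : substitution A :=
  Substitution (subst_comp_neq0 phi psi).

Definition subst_mx phi : 'M[nat]_#|A| :=
  \matrix_(i, j) count_mem (enum_val i) (phi (enum_val j)).

(** Bi-infinite sequences, with the product topology of the discrete A *)
Definition biseq := prod_topology (fun _ : int => discrete_topology A).

Definition bishift (n : int) (T : biseq) : biseq := fun m => T (m + n).

Definition bword (T : biseq) (m : int) (l : nat) : seq A :=
  mkseq (fun n => T (m + n%:Z) : A) l.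

(* phi(T): the letter at p >= 0 is read off phi(a_0) phi(a_1) ..., the letter at
   - (q+1) is the q-th one from the right end of ... phi(a_-2) phi(a_-1). *)
Definition subst_biseq phi (T : biseq) : biseq := fun p =>
  match p with
  | Posz p => nth (T 0) (subst_word phi (bword T 0 p.+1)) p
  | Negz q => nth (T 0) (rev (subst_word phi (bword T (Negz q) q.+1))) q
  end.

Section system.
Context (k : nat) (F : 'I_k.+1 -> substitution A).
Implicit Types s : nat -> 'I_k.+1.

Definition sshift (i : nat) s : nat -> 'I_k.+1 := fun n => s (i + n)%N.

Fixpoint subst_iter s m l : substitution A :=
  if l is l'.+1 then subst_comp (F (s m)) (subst_iter s m.+1 l') else F (s m).

(* phi_{s[m,n]} for m <= n *)
Definition subst_range s m n := subst_iter s m (n - m).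

Definition primitive s := forall n, exists d, (1 <= d)%N /\
  forall i j, (0 < subst_mx (subst_range s n (n + d)) i j)%N.

Definition admitted s (T : biseq) := forall m l, exists n a,
  infix (bword T m l) (subst_range s 0 n a).

Definition Sigma s : set biseq := [set T | admitted s T].

Definition L2 s : set (A * A) :=
  [set ab | exists T m, [/\ Sigma s T, T m = ab.1 & T (m + 1) = ab.2]].

Lemma bword_shift n T m l : bword (bishift n T) m l = bword T (m + n) l.
Proof. by apply: eq_mkseq => i; rewrite /bishift addrAC. Qed.

Lemma Sigma_shift s n T : Sigma s T -> Sigma s (bishift n T).
Proof. by move=> sT m l; rewrite bword_shift; exact: sT. Qed.

Lemma bword_cat T m l l' :
  bword T m (l + l') = bword T m l ++ bword T (m + l%:Z) l'.
Proof.
rewrite /bword /mkseq iotaD map_cat add0n; congr (_ ++ _).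
rewrite -[in LHS](addn0 l) iotaDl -map_comp; apply: eq_map => i /=.
by rewrite PoszD addrA.
Qed.

Lemma size_bword T m l : size (bword T m l) = l.
Proof. exact: size_mkseq. Qed.

Lemma subst_biseq_pos phi T p N x0 : (p < N)%N ->
  subst_biseq phi T p%:Z = nth x0 (subst_word phi (bword T 0 N)) p.
Proof.
move=> pN; have -> : N = (p.+1 + (N - p.+1))%N by lia.
have h := size_subst_word phi (bword T 0 p.+1); rewrite size_bword in h.
by rewrite bword_cat subst_word_cat nth_cat h /=; exact: set_nth_default.
Qed.

Lemma subst_biseq_neg phi T q N x0 : (q < N)%N ->
  subst_biseq phi T (Negz q) =
  nth x0 (rev (subst_word phi (bword T (- N%:Z) N))) q.
Proof.
move=> qN; have -> : bword T (- N%:Z) N =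
    bword T (- N%:Z) (N - q.+1) ++ bword T (Negz q) q.+1.
  have := bword_cat T (- N%:Z) (N - q.+1) q.+1; rewrite subnK // => ->.
  by congr (_ ++ bword _ _ _); rewrite NegzE; lia.
have h := size_subst_word phi (bword T (Negz q) q.+1); rewrite size_bword in h.
rewrite subst_word_cat rev_cat nth_cat size_rev h /=; apply: set_nth_default.
by rewrite size_rev.
Qed.

(* The window [-N, N) of T is mapped to a word containing that of phi(T). *)
Lemma bword_subst_biseq phi T m l : exists m' l',
  infix (bword (subst_biseq phi T) m l) (subst_word phi (bword T m' l')).
Proof.
have [N NE] : exists N, N = (absz m + l + 1)%N by exists (absz m + l + 1)%N.
exists (- N%:Z), (N + N)%N; rewrite bword_cat subst_word_cat addNr.
set L : seq A := subst_word phi (bword T (- N%:Z) N).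
set W : seq A := subst_word phi (bword T 0 N).
have hL : (N <= @size A L)%N by rewrite -{1}(size_bword T (- N%:Z) N) size_subst_word.
have hW : (N <= @size A W)%N by rewrite -{1}(size_bword T 0 N) size_subst_word.
pose st := absz ((@size A L)%:Z + m).
have stE : st%:Z = (@size A L)%:Z + m by rewrite /st; lia.
have -> : bword (subst_biseq phi T) m l = take l (drop st (L ++ W)).
  pose x0 : A := T 0; apply: (@eq_from_nth A x0).
    rewrite size_bword size_takel // size_drop size_cat.
    by clearbody st; lia.
  move=> i; rewrite size_bword => il; rewrite nth_mkseq // nth_take // nth_drop.
  rewrite nth_cat; case E : (m + i%:Z) => [p|q].
    have -> : (st + i < size L)%N = false by lia.
    have -> : (st + i - size L = p)%N by lia.
    by apply: subst_biseq_pos; clearbody st; lia.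
  rewrite NegzE in E.
  have -> : (st + i < size L)%N by lia.
  rewrite (@subst_biseq_neg _ _ _ N x0); last by lia.
  rewrite -/L nth_rev; last by apply: leq_trans hL; lia.
  by congr (nth _ _ _); rewrite -[size _]/(@size A L); clearbody st; lia.
apply/infixP; exists (take st (L ++ W)), (drop l (drop st (L ++ W))).
by rewrite !cat_take_drop.
Qed.

Lemma subst_iter_shiftS s i m l a :
  subst_iter (sshift i.+1 s) m l a = subst_iter (sshift i s) m.+1 l a.
Proof.
elim: l m a => [|l IH] m a /=; first by rewrite /sshift addSnnS.
by rewrite IH /sshift addSnnS.
Qed.

Lemma Sigma_subst s i T : Sigma (sshift i.+1 s) T ->
  Sigma (sshift i s) (subst_biseq (F (s i)) T).
Proof.
move=> sT m l; have [m' [l' h]] := bword_subst_biseq (F (s i)) T m l.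
have [n [a ha]] := sT m' l'; exists n.+1, a.
apply: infix_trans h _; have := infix_subst_word (F (s i)) ha.
by rewrite /subst_range !subn0 subst_iter_shiftS /= /sshift addn0.
Qed.

End system.
End substitutions.

(** * Tiling spaces *)

Section tiling.
Context (R : realType) (A : finType) (k : nat) (F : 'I_k.+1 -> substitution A).
Implicit Types s : nat -> 'I_k.+1.

Definition unit_interval : set R := [set` `[0, 1]].

Definition tiling_pre s := (set_type (Sigma F s) * set_type unit_interval)%type.

Definition tiling_glue s (x y : tiling_pre s) : Prop :=
  [/\ val x.2 = 1, val y.2 = 0 & val y.1 = bishift 1 (val x.1)].

Definition Omega s : topologicalType := topquot (@tiling_glue s).

(* The representative of [(T, t)] with t in [0, 1). *)
Definition tiling_norm s (x : tiling_pre s) : biseq A * R :=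
  if val x.2 == 1 then (bishift 1 (val x.1), 0) else (val x.1, val x.2).

Definition subst_point (phi : substitution A) (p : biseq A * R) : biseq A * R :=
  let u := (size (phi (p.1 0)))%:R * p.2 in
  (bishift (Num.floor u) (subst_biseq phi p.1), u - (Num.floor u)%:~R).

Lemma subst_point_Sigma s i (x : tiling_pre (sshift i.+1 s)) :
  (subst_point (F (s i)) (tiling_norm x)).1 \in Sigma F (sshift i s).
Proof.
apply/mem_set/Sigma_shift/Sigma_subst; rewrite /tiling_norm.
by case: ifP => _; [apply: Sigma_shift|]; exact: (set_mem (valP x.1)).
Qed.

Lemma subst_point_unit s i (x : tiling_pre (sshift i.+1 s)) :
  (subst_point (F (s i)) (tiling_norm x)).2 \in unit_interval.
Proof.
apply/mem_set; rewrite /unit_interval /= in_itv /=.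
set u := _ * _; apply/andP; split; first by rewrite subr_ge0 floor_le.
by rewrite lerBlDl ltW // -intrD1 floorD1_gt.
Qed.

Definition tiling_map_pre s i (x : tiling_pre (sshift i.+1 s)) :
    tiling_pre (sshift i s) :=
  (SigSub (subst_point_Sigma x), SigSub (subst_point_unit x)).

Definition tiling_map s i (u : Omega (sshift i.+1 s)) : Omega (sshift i s) :=
  topquot_pi (@tiling_glue (sshift i s)) (tiling_map_pre (topquot_repr u)).

Lemma tiling_mapE s i (x : tiling_pre (sshift i.+1 s)) :
  tiling_map (topquot_pi (@tiling_glue _) x) =
  topquot_pi (@tiling_glue _) (tiling_map_pre x).
Proof.
rewrite /tiling_map; congr (topquot_pi _ _).
set y := topquot_repr _.
have : tiling_norm y = tiling_norm x.
  have /topquot_piP := topquot_reprK (topquot_pi (@tiling_glue _) x).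
  rewrite -/y; elim=> {y x} [x y [x1 y0 xy]|//|x y _ ->//|x y z _ -> _ ->//].
  by rewrite /tiling_norm x1 eqxx y0 xy eq_sym oner_eq0.
move=> e; rewrite /tiling_map_pre.
by congr (_, _); apply/val_inj; rewrite /= e.
Qed.

Definition recognisable s := forall i, injective (@tiling_map s i).

(** * Barge-Diamond complexes *)

(* The initial value 1/2 of the minima is neutral, as 1 <= size (F j a). *)
Definition bd_eps : R :=
  \big[Num.min/2^-1]_(j < k.+1) \big[Num.min/2^-1]_(a : A)
    (2 * (size (F j a))%:R)^-1.

(* [inl a] labels the edge e_a and [inr (a, b)] the edge e_ab. *)
Definition bd_label := discrete_topology (A + A * A)%type.

Definition bd_edges s : set (R * bd_label) := [set p |
  match p.2 : A + A * A with
  | inl a => bd_eps <= p.1 <= 1 - bd_eps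
  | inr ab => - bd_eps <= p.1 <= bd_eps /\ L2 F s ab
  end].

Definition bd_glue s (x y : set_type (bd_edges s)) : Prop := exists a b,
  (val x = (1 - bd_eps, inl a) /\ val y = (- bd_eps, inr (a, b))) \/
  (val x = (bd_eps, inl b) /\ val y = (bd_eps, inr (a, b))).

Definition bd_complex s : topologicalType := topquot (@bd_glue s).

(* For phi(a) = a_1 ... a_n, laid out so that e_{a_j} covers
   [j - 1 + eps, j - eps] and e_{a_j a_{j+1}} covers [j - eps, j + eps], the
   edge e_a is mapped affinely onto the path [eps, n - eps]. *)
Definition bd_image (phi : substitution A) (p q : R * bd_label) : Prop :=
  match p.2 : A + A * A with
  | inl a =>
      let w := phi a in
      let u := bd_eps + (p.1 - bd_eps) *
        (((size w)%:R - 2 * bd_eps) / (1 - 2 * bd_eps)) in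
      (exists2 j, (j < size w)%N & q = (u - j%:R, inl (nth a w j))) \/
      (exists2 j, (j.+1 < size w)%N &
        q = (u - j.+1%:R, inr (nth a w j, nth a w j.+1)))
  | inr ab => q = (p.1, inr (last ab.1 (phi ab.1), head ab.2 (phi ab.2)))
  end.

(* g is the cellular map K_{i+1} -> K_i induced by phi_{s_i}. The range of the
   parameter of q, which selects the cell hit by u, is part of q being in
   bd_edges. *)
Definition is_bd_map s i
    (g : bd_complex (sshift i.+1 s) -> bd_complex (sshift i s)) : Prop :=
  forall p, exists2 q, bd_image (F (s i)) (val p) (val q) &
    g (topquot_pi (@bd_glue _) p) = topquot_pi (@bd_glue _) q.

End tiling.
Arguments Omega R {A k} F s.
Arguments bd_complex R {A k} F s.
Arguments recognisable R {A k} F s.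

(* Main.v *)
(* Both groups are compared with the locally constant functions f on Sigma modulo
   the coboundaries h - h o shift. A Cech class of Omega is represented by a locally
   additive function c of pairs of points; pulled back to Sigma x [0, 1] it has a
   potential, whose variation along the unit tiles is f, and every f arises.

   On the other side, a singular cocycle z of K_i is determined up to coboundary by
   its values on the edges, hence by the function T |-> z(e_a) + z(e_ab), where
   a = T 0 and b = T 1. Summing a function over the words phi_{s_i}(a) pushes it from
   level i to level i + 1, and this is what g_i^* does to the functions above.
   Recognisability makes this push a bijection on classes. By primitivity the words
   phi_{s[i,n]}(a) outgrow every window, so that every locally constant function,
   pushed far enough, becomes cohomologous to a function of the two letters T 0 and
   T 1, and, if it is a coboundary, to H(T 1) - H(T 0) for some H. These two facts give
   surjectivity and injectivity. *)

Require Import Defs.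
From HB Require Import structures.
From mathcomp Require Import all_boot all_order all_algebra generic_quotient ring_quotient.
From mathcomp Require Import all_classical all_reals all_analysis.
From Stdlib Require Import Relation_Operators.
From mathcomp Require Import ring lra zify.

Set Implicit Arguments.
Unset Strict Implicit.
Unset Printing Implicit Defensive.

Import Order.TTheory GRing.Theory Num.Theory.
Import numFieldNormedType.Exports.
Import Quotient.Exports.

Local Open Scope classical_set_scope.
Local Open Scope ring_scope.
Local Open Scope quotient_scope.

(** No map between [Omega] and the complexes is constructed: the two groups are joined by a relation
    between cocycles, closed under differences, so that only existence on both sides and two
    statements about zero classes remain. Cech cocycles are replaced by Alexander-Spanier cocycles
    because these pull back along any continuous map and, on a product with [[0, 1]], have a
    potential near each fibre. Over a sequence space such potentials patch freely, so that the
    gluing of the ends of tiles is the only obstruction. Integrated along paths, the same kind of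
    cocycle gives singular cocycles with prescribed weights on the edges [e_ab]; that the weights
    determine the class rests on a cover of the complex by contractible stars and open edges. The
    push is inverted through [(T, j) |-> shift^j (phi T)], with [j] a position in the word of [T 0].
    It is onto by compactness; recognisability makes it injective, and compactness again makes its
    inverse continuous, so that functions at level [i] can be prescribed in the coordinates
    [(T, j)]. *)

Lemma additive_bijection_of_rel (U V : zmodType) (r : U -> V -> Prop) :
  (forall u u' v v', r u v -> r u' v' -> r (u - u') (v - v')) ->
  (forall u, exists v, r u v) -> (forall v, exists u, r u v) ->
  (forall v, r 0 v -> v = 0) -> (forall u, r u 0 -> u = 0) ->
  exists f : {additive U -> V}, bijective f.
Proof.
move=> rB rtot rsurj r0 rinj.
have [f0 f0P] := choice rtot; have [g0 g0P] := choice rsurj.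
have f0_add : zmod_morphism f0.
  move=> u u'; apply/eqP; rewrite -subr_eq0; apply/eqP/r0.
  by rewrite -(subrr (u - u')); apply: (rB _ _ _ _ (f0P _)); exact: rB.
pose f : {additive U -> V} :=
  HB.pack f0 (GRing.isZmodMorphism.Build U V f0 f0_add).
exists f; exists g0 => [u|v]; apply/eqP; rewrite -subr_eq0; apply/eqP.
  by apply: rinj; rewrite -(subrr (f0 u)); apply: rB.
by apply: r0; rewrite -(subrr (g0 v)); apply: rB.
Qed.

Lemma H1_eq0 (S : sset2) (c : Z1 S) :
  \pi_(H1 S) c = 0 <-> exists h, val c = cobd0 h.
Proof.
rewrite -(raddf0 \pi_(H1 S)); split=> [/eqP|[h hc]].
  by rewrite -Quotient.idealrBE subr0 => /asboolP.
by apply/eqP; rewrite -Quotient.idealrBE subr0; apply/asboolP; exists h.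
Qed.

Lemma continuous_pair (X Y Z : topologicalType) (f : X -> Y) (g : X -> Z) :
  continuous f -> continuous g -> continuous (fun x => (f x, g x)).
Proof. by move=> fc gc x; apply: cvg_pair; [exact: fc|exact: gc]. Qed.

(** Compactness and connectedness of [[a, b]], packaged for properties stable under concatenation of
    intervals: the supremum of the points reachable from [a] is reached, and can be passed unless it
    is [b]. The subdivision arguments below are instances. *)
Lemma interval_induction (R : realType) (Q : R -> R -> Prop) :
  (forall u v w : R, u <= v -> v <= w -> Q u v -> Q v w -> Q u w) ->
  (forall t : R, 0 <= t <= 1 -> exists2 d : R, 0 < d &
     forall u v : R, t - d < u -> u <= v -> v < t + d -> Q u v) ->
  forall a b : R, 0 <= a -> a <= b -> b <= 1 -> Q a b.
Proof.
move=> Qt Ql a b a0 ab b1.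
pose S : set R := [set v | a <= v <= b /\ Q a v].
have [d d0 hd] := Ql a ltac:(by rewrite a0 (le_trans ab)).
have Sa : S a by split; [rewrite lexx ab|apply: hd; lra].
have supS : has_sup S by split; [exists a|exists b => v [/andP[]]].
have ubS := sup_upper_bound supS.
have as' : a <= sup S by exact: ubS.
have sb : sup S <= b by apply: ge_sup; [exists a|move=> v [/andP[]]].
have [e e0 he] := Ql (sup S) ltac:(by rewrite (le_trans a0) //= (le_trans sb)).
have [v [/andP[av vb] Qv] sv] := sup_adherent e0 supS.
have vs : v <= sup S by apply: ubS; split=> //; rewrite av.
have [sbe|sbe] := ltP b (sup S + e).
  by apply: (Qt _ v) => //; apply: he => //; lra.
have : S (sup S + e / 2).
  split; first by apply/andP; split; lra.
  by apply: (Qt _ v) => //; [lra|apply: he => //; lra].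
by move=> /ubS; lra.
Qed.

(** * Alexander-Spanier cocycles of degree one *)

(** Only the germ of [c] along the diagonal matters, and its values need not be locally constant. *)
Definition as_cocycle (X : topologicalType) (c : X -> X -> int) :=
  forall x : X, exists2 U : set X, nbhs x U &
    forall p q r, U p -> U q -> U r -> c p q + c q r = c p r.

(** Stated at one point, so that a potential can be required over [0 <= t <= 1] only, while the
    cocycle lives over all of [R]. A potential is determined up to a locally constant function
    ([as_potential_near]). *)
Definition as_potential (X : topologicalType) (c : X -> X -> int)
    (s : X -> int) (x : X) :=
  exists2 U : set X, nbhs x U & forall p q, U p -> U q -> c p q = s q - s p.

Section alexander_spanier.
Context (X : topologicalType).
Implicit Types (c : X -> X -> int) (s : X -> int) (x : X).

Lemma as_cocycle_diag c x : as_cocycle c -> c x x = 0.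
Proof.
move=> /(_ x)[U /nbhs_singleton Ux /(_ _ _ _ Ux Ux Ux)] h.
by apply: (addrI (c x x)); rewrite h addr0.
Qed.

Lemma as_cocycle_comp (Y : topologicalType) (q : Y -> X) c :
  continuous q -> as_cocycle c -> as_cocycle (fun y y' => c (q y) (q y')).
Proof.
move=> qc cc y; have [U qU cU] := cc (q y).
by exists (q @^-1` U); [exact: qc|move=> p p' p''; exact: cU].
Qed.

Lemma as_potential_comp (Y : topologicalType) (q : Y -> X) c s y :
  continuous q -> as_potential c s (q y) ->
  as_potential (fun y y' => c (q y) (q y')) (s \o q) y.
Proof.
move=> qc [U qU cU].
by exists (q @^-1` U); [exact: qc|move=> p p'; exact: cU].
Qed.

Lemma as_potentialD c c' s s' x : as_potential c s x -> as_potential c' s' x ->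
  as_potential (fun p q => c p q + c' p q) (s \+ s') x.
Proof.
move=> [U xU sU] [U' xU' sU']; exists (U `&` U'); first exact: filterI.
by move=> p q [Up Up'] [Uq Uq'] /=; rewrite sU // sU' //; ring.
Qed.

Lemma as_potentialB c c' s s' x : as_potential c s x -> as_potential c' s' x ->
  as_potential (fun p q => c p q - c' p q) (s \- s') x.
Proof.
move=> [U xU sU] [U' xU' sU']; exists (U `&` U'); first exact: filterI.
by move=> p q [Up Up'] [Uq Uq'] /=; rewrite sU // sU' //; ring.
Qed.

Lemma as_potential_near c s s' x : as_potential c s x -> as_potential c s' x ->
  \forall y \near x, s y - s' y = s x - s' x.
Proof.
move=> [U xU sU] [U' xU' sU']; near=> y.
have [Uy Uy'] : U y /\ U' y by split; near: y.
have := sU _ _ (nbhs_singleton xU) Uy; rewrite (sU' _ _ (nbhs_singleton xU') Uy').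
lra.
Unshelve. all: by end_near. Qed.

(** Off the level [v] of [tau], only one of the two potentials is seen nearby; on it, both agree
    nearby after the shift by [k], so that the case distinction becomes invisible. *)
Lemma as_potential_glue (R : realType) (tau : X -> R) (v : R) c s1 s2 k x :
  continuous tau ->
  (tau x <= v -> as_potential c s1 x) -> (v <= tau x -> as_potential c s2 x) ->
  (tau x = v -> \forall y \near x, s1 y = s2 y + k) ->
  as_potential c (fun y => if tau y <= v then s1 y else s2 y + k) x.
Proof.
move=> tc h1 h2 h3; have [xv|xv|xv] := ltgtP (tau x) v.
- have [U xU sU] := h1 (ltW xv); exists (U `&` [set y | tau y < v]).
    by apply: filterI => //; exact: (tc x _ (lt_nbhsl xv)).
  by move=> p q [Up /= pv] [Uq /= qv]; rewrite !ltW //; exact: sU.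
- have [U xU sU] := h2 (ltW xv); exists (U `&` [set y | v < tau y]).
    by apply: filterI => //; exact: (tc x _ (lt_nbhsr xv)).
  move=> p q [Up /= pv] [Uq /= qv]; rewrite !leNgt pv qv /= sU //; ring.
- have [U xU sU] := h1 ltac:(by rewrite xv).
  exists (U `&` [set y | s1 y = s2 y + k]); first by apply: filterI => //; exact: h3.
  have e y : s1 y = s2 y + k -> (if tau y <= v then s1 y else s2 y + k) = s1 y.
    by move=> <-; case: ifP.
  by move=> p q [Up /= pv] [Uq /= qv]; rewrite !e //; exact: sU.
Qed.

End alexander_spanier.

(** * Potentials over intervals, tubes and squares *)

Section tube.
Context (R : realType).

(** Potentials on adjacent time intervals differ by a constant near the common point [(b, v)], hence
    can be glued; the neighbourhood of [b] shrinks at each concatenation. *)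
Lemma as_potential_tube (B : topologicalType) (c : B * R -> B * R -> int) (b : B) :
  as_cocycle c -> exists2 P : set B, nbhs b P & exists s : B * R -> int,
    forall (b' : B) (t : R), P b' -> 0 <= t <= 1 -> as_potential c s (b', t).
Proof.
move=> cc.
pose Q (u v : R) := exists2 P : set B, nbhs b P & exists s : B * R -> int,
    forall (b' : B) (t : R), P b' -> u <= t <= v -> as_potential c s (b', t).
suff: Q 0 1 by [].
apply: interval_induction => // [u v w uv vw|t _].
  move=> [P1 bP1 [s1 hs1]] [P2 bP2 [s2 hs2]].
  have p1 : as_potential c s1 (b, v).
    by apply: hs1; [exact: nbhs_singleton|rewrite uv lexx].
  have p2 : as_potential c s2 (b, v).
    by apply: hs2; [exact: nbhs_singleton|rewrite vw lexx].
  have [[P V] /= [bP vV] PV] := as_potential_near p1 p2.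
  (* The interior of [P] is taken so that the difference is constant near [(b', v)] for every [b'],
     and not only near [(b, v)]. *)
  exists (P1 `&` P2 `&` P°).
    by do 2?apply: filterI => //; exact: nbhs_interior.
  exists (fun y => if y.2 <= v then s1 y else s2 y + (s1 (b, v) - s2 (b, v))).
  move=> b' t [[P1b' P2b'] Pb'] /andP[ut tw].
  apply: (@as_potential_glue _ R snd) => /= [|tv|tv|tv].
  - by move=> y; exact: cvg_snd.
  - by apply: hs1; rewrite ?ut.
  - by apply: hs2; rewrite ?tv.
  - rewrite tv; exists (P, V) => //= -[b1 t1] /= [Pb1 Vt1].
    by have /= <- := PV (b1, t1) (conj Pb1 Vt1); rewrite addrC subrK.
have [U [[P V] /= [bP tV] PVU] cU] := cc (b, t).
have [d d0 dV] : exists2 d : R, 0 < d & ball t d `<=` V by exact/nbhs_ballP.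
exists d => // u v ud uv vd; exists P°; first exact: nbhs_interior.
exists (c (b, t)) => b' t' Pb' /andP[ut' tv'].
have Ubt : U (b, t) by apply: PVU; split; exact: nbhs_singleton.
exists U.
  exists (P, V) => //; split=> //=.
  apply: (@filterS _ _ _ (ball t d)) => //; apply: open_nbhs_nbhs; split.
    exact: ball_open.
  by rewrite /ball /= ltr_distlC; lra.
by move=> p q Up Uq; have <- := cU _ _ _ Ubt Up Uq; ring.
Qed.

Lemma as_potential_constant (c : R -> R -> int) s s' :
  (forall t : R, 0 <= t <= 1 -> as_potential c s t) ->
  (forall t : R, 0 <= t <= 1 -> as_potential c s' t) ->
  forall a b : R, 0 <= a <= 1 -> 0 <= b <= 1 -> s a - s' a = s b - s' b.
Proof.
move=> hs hs'; suff h a b : 0 <= a -> a <= b -> b <= 1 -> s a - s' a = s b - s' b.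
  by move=> a b a1 b1; have [ab|/ltW ba] := leP a b; [|apply/esym]; apply: h; lra.
apply: (@interval_induction _ (fun u v => s u - s' u = s v - s' v)) => [u v w _ _ -> //|t t01].
have /nbhs_ballP[d d0 hd] := as_potential_near (hs t t01) (hs' t t01).
exists d => // u v ud uv vd.
by rewrite (hd u) ?(hd v) // /ball /= ltr_distlC; lra.
Qed.

Lemma as_potential_interval (c : R -> R -> int) : as_cocycle c ->
  exists s, forall t : R, 0 <= t <= 1 -> as_potential c s t.
Proof.
move=> cc.
have cc' : as_cocycle (fun p q : R * R => c p.2 q.2).
  by apply: (as_cocycle_comp (q := snd)) => // ?; exact: cvg_snd.
have [P bP [s hs]] := as_potential_tube 0 cc'.
exists (fun t => s (0, t)) => t t01.
apply: (@as_potential_comp (R * R)%type R (fun t => (0, t)) (fun p q => c p.2 q.2)).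
  by apply: continuous_pair => x; [exact: cvg_cst|exact: cvg_id].
by apply: hs => //; exact: nbhs_singleton.
Qed.

(** Thin strips come from the tube lemma. Along the side common to two strips the potentials differ
    by a single constant, because this side is an interval. *)
Lemma as_potential_square (c : R * R -> R * R -> int) : as_cocycle c ->
  exists s, forall x t : R, 0 <= x <= 1 -> 0 <= t <= 1 -> as_potential c s (x, t).
Proof.
move=> cc.
pose Q (u v : R) := exists s, forall x t : R, u <= x <= v -> 0 <= t <= 1 ->
  as_potential c s (x, t).
suff: Q 0 1 by [].
apply: interval_induction => // [u v w uv vw [s1 hs1] [s2 hs2]|x _].
  have cst t : 0 <= t <= 1 -> s1 (v, t) - s2 (v, t) = s1 (v, 0) - s2 (v, 0).
    move=> t01; pose q (t : R) := (v, t).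
    have qc : continuous q.
      by apply: continuous_pair => y; [exact: cvg_cst|exact: cvg_id].
    apply: (@as_potential_constant (fun t t' => c (q t) (q t'))) (s1 \o q) (s2 \o q) _ _ _ _ _ _ => //.
    - by move=> y y01; apply: as_potential_comp => //; apply: hs1 => //; rewrite uv lexx.
    - by move=> y y01; apply: as_potential_comp => //; apply: hs2 => //; rewrite vw lexx.
    - by rewrite lexx ler01.
  exists (fun y => if y.1 <= v then s1 y else s2 y + (s1 (v, 0) - s2 (v, 0))).
  move=> x t /andP[ux xw] t01.
  apply: (@as_potential_glue _ R fst) => /= [|tv|tv|tv].
  - by move=> y; exact: cvg_fst.
  - by apply: hs1; rewrite ?ux.
  - by apply: hs2; rewrite ?tv.
  - subst x; rewrite -(cst t) //.
    have := as_potential_near (hs1 v t ltac:(by rewrite uv lexx) t01)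
                              (hs2 v t ltac:(by rewrite vw lexx) t01).
    by apply: filterS => y <-; rewrite addrC subrK.
have [P xP [s hs]] := as_potential_tube x cc.
have /nbhs_ballP[d d0 dP] := xP; exists d => // u v ud uv vd; exists s => x' t x'uv t01.
by apply: hs => //; apply: dP; rewrite /ball /= ltr_distlC; lra.
Qed.

End tube.

(** * Cech classes as Alexander-Spanier classes *)

Definition as_cohomologous (X : topologicalType) (c c' : X -> X -> int) :=
  exists k : X -> int, forall x, as_potential (fun p q => c p q - c' p q) k x.

Lemma as_cohomologous_trans (X : topologicalType) (c1 c2 c3 : X -> X -> int) :
  as_cohomologous c1 c2 -> as_cohomologous c2 c3 -> as_cohomologous c1 c3.
Proof.
move=> [k h] [k' h']; exists (k \+ k') => x.
have [U xU e] := as_potentialD (h x) (h' x).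
by exists U => // p q Up Uq; rewrite -e //; ring.
Qed.

Lemma as_cohomologousB (X : topologicalType) (c1 c2 c1' c2' : X -> X -> int) :
  as_cohomologous c1 c2 -> as_cohomologous c1' c2' ->
  as_cohomologous (fun p q => c1 p q - c1' p q) (fun p q => c2 p q - c2' p q).
Proof.
move=> [k h] [k' h']; exists (k \- k') => x.
have [U xU e] := as_potentialB (h x) (h' x).
by exists U => // p q Up Uq; rewrite -e //; ring.
Qed.

Lemma as_cohomologous_sym (X : topologicalType) (c c' : X -> X -> int) :
  as_cohomologous c c' -> as_cohomologous c' c.
Proof.
move=> [k h]; exists (- k) => x; have [U xU e] := h x.
by exists U => // p q Up Uq; have := e _ _ Up Uq; rewrite !fctE; lra.
Qed.

Section cech_alexander_spanier.
Context (X : topologicalType).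

Definition cover_at (C : open_cover X) (x : X) : set X := sval (cid (cover_full C x)).

Lemma cover_atP (C : open_cover X) x : C (cover_at C x) /\ cover_at C x x.
Proof. by rewrite /cover_at; case: cid. Qed.

Section cover.
Context (C : open_cover X).
Implicit Types (n : Z1 (nerve C)) (U V W : set X).

(** Extension by 0 to all pairs of sets, which keeps the membership proofs out of the formulas. *)
Definition nerve_ext (n : nerve1 C -> int) U V : int :=
  if pselect (is_nerve1 C (U, V)) is left h then n (exist _ (U, V) h) else 0.

Lemma nerve_extE (n : nerve1 C -> int) e : nerve_ext n (sval e).1 (sval e).2 = n e.
Proof.
rewrite /nerve_ext; case: pselect => [h|[]]; last by case: e => -[].
by congr n; case: e h => -[U V] h h'; exact: eq_exist.
Qed.

Lemma nerve_ext_cocycle n U V W x : C U -> C V -> C W -> U x -> V x -> W x ->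
  nerve_ext (val n) U V + nerve_ext (val n) V W = nerve_ext (val n) U W.
Proof.
move=> CU CV CW Ux Vx Wx.
have tP : is_nerve2 C (U, V, W) by split=> //; exists x.
pose t : nerve2 C := exist (is_nerve2 C) (U, V, W) tP.
have /asboolP/(_ t) : val n \in cocycle1 (nerve C) by exact: valP.
by rewrite /cobd1 /= -!nerve_extE /=; lra.
Qed.

Lemma nerve_ext_diag n U x : C U -> U x -> nerve_ext (val n) U U = 0.
Proof. by move=> CU Ux; have := nerve_ext_cocycle n CU CU CU Ux Ux Ux; lra. Qed.

(* By the cocycle identity, the value does not depend on the choice of V. *)
Definition cech_as n (x y : X) : int :=
  if pselect (exists V, [/\ C V, V x & V y]) is left h then
    let V := sval (cid h) in
    nerve_ext (val n) (cover_at C x) V + nerve_ext (val n) V (cover_at C y)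
  else 0.

Lemma cech_asE n V x y : C V -> V x -> V y ->
  cech_as n x y =
  nerve_ext (val n) (cover_at C x) V + nerve_ext (val n) V (cover_at C y).
Proof.
move=> CV Vx Vy; rewrite /cech_as; case: pselect => [h|[]]; last by exists V.
case: cid => W /= [CW Wx Wy].
have [Cx xx] := cover_atP C x; have [Cy yy] := cover_atP C y.
rewrite -(nerve_ext_cocycle n Cx CV CW xx Vx Wx) -(nerve_ext_cocycle n CV CW Cy Vy Wy yy).
by ring.
Qed.

Lemma cech_as_cocycle n : as_cocycle (cech_as n).
Proof.
move=> x; have [V [CV Vx]] := cover_full C x; exists V.
  by apply: open_nbhs_nbhs; split=> //; exact: cover_open CV.
move=> p q r Vp Vq Vr; rewrite !(cech_asE n CV) //.
have [Cq qq] := cover_atP C q.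
have := nerve_ext_cocycle n CV Cq CV Vq qq Vq.
by rewrite (nerve_ext_diag n CV Vq); lra.
Qed.

Lemma nerve_extB n n' U V :
  nerve_ext (val (n - n')) U V = nerve_ext (val n) U V - nerve_ext (val n') U V.
Proof. by rewrite /nerve_ext; case: pselect => // h; rewrite subr0. Qed.

Lemma cech_asB n n' x y : cech_as (n - n') x y = cech_as n x y - cech_as n' x y.
Proof.
rewrite /cech_as; case: pselect => [h|]; last by rewrite subr0.
by rewrite /= !nerve_extB; ring.
Qed.

Lemma cech_as_coboundary n : \pi_(H1 (nerve C)) n = 0 ->
  as_cohomologous (cech_as n) (fun _ _ => 0).
Proof.
move=> /H1_eq0[h hn].
pose k U := if pselect (C U /\ U !=set0) is left h' then h (exist _ U h') else 0.
have nk U V x : C U -> C V -> U x -> V x -> nerve_ext (val n) U V = k V - k U.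
  move=> CU CV Ux Vx; rewrite /nerve_ext; case: pselect => [UV|[]]; last first.
    by split=> //; exists x.
  rewrite hn /cobd0 /k; case: pselect => [h1|[]]; last by split=> //; exists x.
  case: pselect => [h2|[]]; last by split=> //; exists x.
  by congr (h _ - h _); exact: eq_exist.
exists (fun x => k (cover_at C x)) => x; have [V [CV Vx]] := cover_full C x.
exists V; first by apply: open_nbhs_nbhs; split=> //; exact: cover_open CV.
move=> p q Vp Vq; rewrite (cech_asE n CV) //.
have [Cp pp] := cover_atP C p; have [Cq qq] := cover_atP C q.
by rewrite (nk _ _ p) // (nk _ _ q) //; ring.
Qed.

End cover.

Lemma cech_as_refine (C D : open_cover X) (CD : refined_by C D) (n : Z1 (nerve C))
    (n' : Z1 (nerve D)) :
  refine_H1 CD (\pi_(H1 (nerve C)) n) = \pi_(H1 (nerve D)) n' ->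
  as_cohomologous (cech_as n') (cech_as n).
Proof.
rewrite /refine_H1 /= H1_pullbackE; set m := Z1_pullback _ _ => /eqP.
rewrite eq_sym -subr_eq0 -raddfB => /eqP /cech_as_coboundary nm.
have [k nmk] := nm; have hr := svalP (refine_choice CD).
set r := sval _ in hr m nm nmk.
apply: (@as_cohomologous_trans _ _ (cech_as m)).
  exists k => x; have [U xU e] := nmk x; exists U => // p q Up Uq.
  by rewrite -e // cech_asB subr0.
have mE U V x : D U -> D V -> U x -> V x ->
    nerve_ext (val m) U V = nerve_ext (val n) (r U) (r V).
  move=> DU DV Ux Vx; rewrite {1}/nerve_ext; case: pselect => [UV|[]]; last first.
    by split=> //; exists x.
  by rewrite /= -nerve_extE.
(* The correction at [x] compares the member of [C] chosen at [x] with the member of [C] assigned by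
   [r] to the member of [D] chosen at [x]. *)
exists (fun x => nerve_ext (val n) (cover_at C x) (r (cover_at D x))) => x.
have [V [DV Vx]] := cover_full D x; exists V.
  by apply: open_nbhs_nbhs; split=> //; exact: cover_open DV.
move=> p q Vp Vq.
have [DVp DVpp] := cover_atP D p; have [DVq DVqq] := cover_atP D q.
have [CVp CVpp] := cover_atP C p; have [CVq CVqq] := cover_atP C q.
have [CrV sV] := hr _ DV; have [Crp sp] := hr _ DVp; have [Crq sq] := hr _ DVq.
rewrite (cech_asE m DV) // (cech_asE n CrV) //; [|exact: sV|exact: sV].
rewrite (mE _ _ p) // (mE _ _ q) //.
have := nerve_ext_cocycle n CVp Crp CrV CVpp (sp _ DVpp) (sV _ Vp).
have := nerve_ext_cocycle n CrV CVq Crq (sV _ Vq) CVqq (sq _ DVqq).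
lra.
Qed.

(** The potential trivialises [n] after a refinement to open sets on which it computes the cocycle;
    on such a set the value of the 0-cochain can be read at any of its points. *)
Lemma cech_as_zero (C : open_cover X) (n : Z1 (nerve C)) :
  as_cohomologous (cech_as n) (fun _ _ => 0) ->
  @dirlim_in (cech_system X) C (\pi_(H1 (nerve C)) n) = 0.
Proof.
move=> [s hs].
pose D W := [/\ open W, exists2 U, C U & W `<=` U &
  forall p q, W p -> W q -> cech_as n p q = s q - s p].
have Dcov x : exists W, D W /\ W x.
  have [U xU e] := hs x; have [V [CV Vx]] := cover_full C x.
  exists (U° `&` V); split; last by split=> //; exact: nbhs_singleton (nbhs_interior xU).
  split; first by apply: openI; [exact: open_interior|exact: cover_open CV].
    by exists V => //; exact: subIsetr.
  move=> p q [/interior_subset Up _] [/interior_subset Uq _].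
  by rewrite -e // subr0.
pose Dc := OpenCover (fun W (h : D W) => let: And3 h _ _ := h in h) Dcov.
have CD : refined_by C Dc by move=> W [_ [U CU WU] _]; exists U.
rewrite -(dirlim_in_map (CD : ds_le (d := cech_system X) C Dc)) /=.
rewrite [X in dirlim_in X](_ : _ = 0) ?raddf0 // H1_pullbackE.
have hr := svalP (refine_choice CD); set r := sval _ in hr *.
apply/H1_eq0.
have hk (W : nerve0 Dc) : exists k, forall x, sval W x ->
    k = s x + nerve_ext (val n) (cover_at C x) (r (sval W)).
  case: W => W /= [DW [x Wx]].
  exists (s x + nerve_ext (val n) (cover_at C x) (r W)) => y Wy.
  have [_ _ /(_ _ _ Wx Wy)] := DW; have [CrW sW] := hr _ DW.
  rewrite (cech_asE n CrW); [|exact: sW|exact: sW].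
  have [Cy yy] := cover_atP C y.
  have := nerve_ext_cocycle n CrW Cy CrW (sW _ Wy) yy (sW _ Wy).
  by rewrite (nerve_ext_diag n CrW (sW _ Wy)); lra.
have [k kP] := choice hk; exists k; apply/funext => e; rewrite /cobd0 /=.
rewrite -[LHS](nerve_extE (val n)) /=; case: e => -[U V] UV /=.
have [/= DU DV [x [Ux Vx]]] := UV.
rewrite (kP _ x) //= (kP _ x) //=.
have [Cx xx] := cover_atP C x; have [CrU sU] := hr _ DU; have [CrV sV] := hr _ DV.
have := nerve_ext_cocycle n Cx CrU CrV xx (sU _ Ux) (sV _ Vx); lra.
Qed.

(** The cover consists of the open sets on which [c] is additive. The value on [(U, V)] goes from a
    base point of [U] to one of [V] through a point [y] of the intersection, since the base points
    need not lie in a common member. *)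
Lemma cech_as_surj (c : X -> X -> int) : as_cocycle c ->
  exists C (n : Z1 (nerve C)), as_cohomologous c (cech_as n).
Proof.
move=> cc.
pose P U := open U /\ forall p q r, U p -> U q -> U r -> c p q + c q r = c p r.
have Pcov x : exists U, P U /\ U x.
  have [U xU e] := cc x; exists U°; split; last exact: nbhs_singleton (nbhs_interior xU).
  split; first exact: open_interior.
  move=> p q r /interior_subset Up /interior_subset Uq /interior_subset Ur; exact: e.
pose C := OpenCover (fun W (h : P W) => h.1) Pcov.
have hb (U : nerve0 C) : exists x, sval U x.
  by have [_ [x Ux]] := svalP U; exists x.
have [b bP] := choice hb.
have hn (e : nerve1 C) : exists k, forall y, (sval e).1 y -> (sval e).2 y ->
    k = c (b (nerve_d1_1 e)) y + c y (b (nerve_d1_0 e)).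
  move: (bP (nerve_d1_1 e)) (bP (nerve_d1_0 e)).
  case: e => -[U V] /= UV; set u := b _; set v := b _ => Uu Vv.
  have [/= [_ hU] [_ hV] [y [Uy Vy]]] := UV.
  exists (c u y + c y v) => z Uz Vz.
  by have := hU _ _ _ Uu Uy Uz; have := hV _ _ _ Vy Vz Vv; lra.
have [m mP] := choice hn.
have mZ : m \in cocycle1 (nerve C).
  apply/asboolP => -[[[U V] W] t]; rewrite /cobd1 /=.
  have [/= hU hV hW [x [[Ux Vx] Wx]]] := t.
  rewrite (mP _ x) // (mP (nerve_d2_1 _) x) // (mP (nerve_d2_2 _) x) //.
  set t0 := exist _ _ _.
  have -> : nerve_d1_0 (nerve_d2_1 t0) = nerve_d1_0 (nerve_d2_0 t0) by exact: eq_exist.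
  have -> : nerve_d1_0 (nerve_d2_2 t0) = nerve_d1_1 (nerve_d2_0 t0) by exact: eq_exist.
  have -> : nerve_d1_1 (nerve_d2_2 t0) = nerve_d1_1 (nerve_d2_1 t0) by exact: eq_exist.
  have := hV.2 _ _ _ Vx (bP (nerve_d1_1 (nerve_d2_0 t0))) Vx.
  by rewrite as_cocycle_diag //; lra.
pose n : Z1 (nerve C) := exist _ m mZ.
have atP x : C (cover_at C x) /\ cover_at C x !=set0.
  by have [? ?] := cover_atP C x; split=> //; exists x.
exists C, n, (fun x => c (b (exist _ _ (atP x))) x) => x.
have [V [CV Vx]] := cover_full C x; exists V.
  by apply: open_nbhs_nbhs; split=> //; exact: cover_open CV.
move=> p q Vp Vq; rewrite (cech_asE n CV) //.
have [Cp pp] := cover_atP C p; have [Cq qq] := cover_atP C q.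
have V0 : C V /\ V !=set0 by split=> //; exists x.
have -> : nerve_ext (val n) (cover_at C p) V =
    c (b (exist _ _ (atP p))) p + c p (b (exist _ _ V0)).
  rewrite /nerve_ext; case: pselect => [h|[]]; last by split=> //; exists p.
  rewrite -[LHS]/(m _) (mP _ p) //=.
  by congr (c (b _) _ + c _ (b _)); exact: eq_exist.
have -> : nerve_ext (val n) V (cover_at C q) =
    c (b (exist _ _ V0)) q + c q (b (exist _ _ (atP q))).
  rewrite /nerve_ext; case: pselect => [h|[]]; last by split=> //; exists q.
  rewrite -[LHS]/(m _) (mP _ q) //=.
  by congr (c (b _) _ + c _ (b _)); exact: eq_exist.
have := CV.2 _ _ _ Vp (bP (exist _ _ V0)) Vq.
have := Cq.2 _ _ _ qq (bP (exist _ _ (atP q))) qq.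
by rewrite (as_cocycle_diag q cc); lra.
Qed.

(** A relation and not a map: the cover, the nerve cocycle and [c] are only determined up to
    cohomology. *)
Definition cech_class (x : cech_H1 X) (c : X -> X -> int) :=
  as_cocycle c /\ exists (C : open_cover X) (n : Z1 (nerve C)),
    x = @dirlim_in (cech_system X) C (\pi_(H1 (nerve C)) n) /\
    as_cohomologous c (cech_as n).

Lemma cech_class_ex x : exists c, cech_class x c.
Proof.
have [C [y ->]] := dirlim_in_surj x; exists (cech_as (repr (y : H1 (nerve C)))).
split; first exact: cech_as_cocycle.
exists C, (repr (y : H1 (nerve C))); split; first by rewrite reprK.
by exists (fun=> 0) => z; exists setT; [exact: filterT|move=> p q _ _; rewrite !subrr].
Qed.

Lemma cech_class_surj c : as_cocycle c -> exists x, cech_class x c.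
Proof.
move=> cc; have [C [n cn]] := cech_as_surj cc.
by exists (@dirlim_in (cech_system X) C (\pi_(H1 (nerve C)) n)); split=> //; exists C, n.
Qed.

Lemma as_cocycleB (c c' : X -> X -> int) : as_cocycle c -> as_cocycle c' ->
  as_cocycle (fun p q => c p q - c' p q).
Proof.
move=> h h' x; have [U xU e] := h x; have [V xV e'] := h' x.
exists (U `&` V); first exact: filterI.
by move=> p q r [? ?] [? ?] [? ?]; rewrite -(e p q r) // -(e' p q r) //; ring.
Qed.

Lemma cech_classB x x' c c' : cech_class x c -> cech_class x' c' ->
  cech_class (x - x') (fun p q => c p q - c' p q).
Proof.
move=> [cc [C [n [-> cn]]]] [cc' [C' [n' [-> cn']]]].
split; first exact: as_cocycleB.
have [D [CD C'D]] := refined_by_directed C C'.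
rewrite -(dirlim_in_map (CD : ds_le (d := cech_system X) C D)).
rewrite -(dirlim_in_map (C'D : ds_le (d := cech_system X) C' D)) -raddfB /=.
set y := refine_H1 CD _; set y' := refine_H1 C'D _.
exists D, (repr y - repr y'); split.
  by congr (dirlim_in _); rewrite -[y in LHS]reprK -[y' in LHS]reprK -raddfB.
have e : as_cohomologous (fun p q => c p q - c' p q)
    (fun p q => cech_as (repr y) p q - cech_as (repr y') p q).
  apply: as_cohomologousB.
    apply: as_cohomologous_trans cn (as_cohomologous_sym _).
    by apply: (cech_as_refine (CD := CD)); rewrite reprK.
  apply: as_cohomologous_trans cn' (as_cohomologous_sym _).
  by apply: (cech_as_refine (CD := C'D)); rewrite reprK.
have [k hk] := e; exists k => z; have [U zU hU] := hk z.
by exists U => // p q Up Uq; rewrite cech_asB -hU.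
Qed.

Lemma cech_class_eq0 x c : cech_class x c ->
  x = 0 <-> as_cohomologous c (fun _ _ => 0).
Proof.
move=> [cc [C [n [-> cn]]]]; split=> [|c0]; last first.
  by apply: cech_as_zero; apply: as_cohomologous_trans c0; exact: as_cohomologous_sym.
rewrite -(raddf0 (@dirlim_in (cech_system X) C)) => /dirlim_inP[D [CD [CD']]].
rewrite raddf0 => /esym n0; apply: as_cohomologous_trans cn _.
have := @cech_as_refine _ _ CD n 0; rewrite raddf0 => /(_ (esym n0)) h.
apply: as_cohomologous_trans (as_cohomologous_sym h) _.
by apply: cech_as_coboundary; rewrite raddf0.
Qed.

End cech_alexander_spanier.

(** * Singular cocycles along paths *)

Definition continuous_of (X Y : topologicalType) (f : X -> Y) (fc : continuous f) :
  continuousType X Y := HB.pack f (isContinuous.Build X Y f fc).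

Lemma continuous_add (R : realType) (X : topologicalType) (f g : X -> R) :
  continuous f -> continuous g -> continuous (fun x => f x + g x).
Proof. by move=> fc gc x; apply: cvgD; [exact: fc|exact: gc]. Qed.

Section clamp.
Context (R : realType).

(** For [a <= b], the retraction of the line onto [[a, b]]. It allows paths to be maps from all of
    [R] of which only an interval is used. *)
Definition clamp (a b t : R) : R := Num.max a (Num.min b t).

Lemma clamp_itv a b t : a <= b -> a <= clamp a b t <= b.
Proof. by move=> ab; rewrite /clamp le_max lexx /= ge_max ab ge_min lexx. Qed.

Lemma clamp_id a b t : a <= t <= b -> clamp a b t = t.
Proof. by move=> /andP[at_ tb]; rewrite /clamp min_r // max_r. Qed.

Lemma clamp_continuous a b : continuous (clamp a b).
Proof.
by move=> t; apply: continuous_max; [exact: cvg_cst|apply: continuous_min; [exact: cvg_cst|exact: cvg_id]].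
Qed.

End clamp.

Section singular_paths.
Context (R : realType).

Definition coord n (i : 'I_n.+1) (x : simplex R n) : R := val x i.

Lemma coord_continuous n (i : 'I_n.+1) : continuous (coord i).
Proof.
move=> x; apply: (@continuous_comp _ _ _ (set_val : simplex R n -> _) (fun y => y i)).
  exact: initial_continuous.
exact: (@proj_continuous _ (fun _ : 'I_n.+1 => (R : topologicalType)) i).
Qed.

Lemma coord_ge0 n (i : 'I_n.+1) x : 0 <= coord i x.
Proof. by have [h _] := set_mem (valP x); exact: h. Qed.

Lemma coord_sum n (x : simplex R n) : \sum_i coord i x = 1.
Proof. by have [_ h] := set_mem (valP x). Qed.

Lemma coord_ext n (x y : simplex R n) : (forall i, coord i x = coord i y) -> x = y.
Proof. by move=> h; apply/val_inj/funext => i; exact: h. Qed.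

Definition i0 n : 'I_n.+1 := @Ordinal n.+1 0 isT.
Definition i1 n : 'I_n.+2 := @Ordinal n.+2 1 isT.
Definition i2 n : 'I_n.+3 := @Ordinal n.+3 2 isT.

Lemma coord_sum1 (x : simplex R 1) : coord (i0 1) x = 1 - coord (i1 0) x.
Proof.
have := coord_sum x; rewrite !big_ord_recl big_ord0 addr0 => <-.
rewrite -[in RHS](_ : lift ord0 ord0 = i1 0); last exact: val_inj.
by rewrite addrK; congr coord; exact: val_inj.
Qed.

Lemma simplex_point1_subproof (t : R) :
  (fun i : 'I_2 => if i == i0 1 then 1 - clamp 0 1 t else clamp 0 1 t) \in simplex R 1.
Proof.
rewrite inE; have /andP[t0 t1] := @clamp_itv R 0 1 t ler01; split=> [i|].
  by case: ifP => _; rewrite ?subr_ge0.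
by rewrite !big_ord_recl big_ord0 /= addr0 subrK.
Qed.

Definition point1 (t : R) : simplex R 1 :=
  exist (fun x => x \in simplex R 1) _ (simplex_point1_subproof t).

Lemma to_simplex_continuous n (X : topologicalType) (f : X -> simplex R n) :
  (forall i, continuous (coord i \o f)) -> continuous f.
Proof.
move=> fc; apply: (continuous_comp_initial (w := set_val)).
exact: prod_topology_continuous.
Qed.

Lemma point1_continuous : continuous point1.
Proof.
apply: to_simplex_continuous => i.
have -> : coord i \o point1 = if i == i0 1 then (fun t => 1 - clamp 0 1 t) else clamp 0 1.
  by apply/funext => t; rewrite /coord /=; case: ifP.
case: ifP => _; last exact: clamp_continuous.
by move=> t; apply: cvgB; [exact: cvg_cst|exact: clamp_continuous].
Qed.

(** The map [(a, b) |-> (1 - a, a (1 - b), a b)] collapses the square to the triangle: the side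
    [a = 0] goes to the vertex 0, and the sides [a = 1], [b = 1], [b = 0] parametrise the faces 0,
    1, 2. *)
Lemma simplex_point2_subproof (p : R * R) :
  (fun i : 'I_3 => let a := clamp 0 1 p.1 in let b := clamp 0 1 p.2 in
     if i == i0 2 then 1 - a else if i == i1 1 then a * (1 - b) else a * b) \in simplex R 2.
Proof.
rewrite inE /=; have /andP[a0 a1] := @clamp_itv R 0 1 p.1 ler01.
have /andP[b0 b1] := @clamp_itv R 0 1 p.2 ler01; split=> [i|].
  case: ifP => _; first by rewrite subr_ge0.
  by case: ifP => _; rewrite mulr_ge0 // subr_ge0.
by rewrite !big_ord_recl big_ord0 /=; ring.
Qed.

Definition point2 (p : R * R) : simplex R 2 :=
  exist (fun x => x \in simplex R 2) _ (simplex_point2_subproof p).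

Lemma point2_continuous : continuous point2.
Proof.
apply: to_simplex_continuous => i.
have c1 : continuous (fun p : R * R => clamp 0 1 p.1).
  by move=> p; apply: (@continuous_comp _ _ _ fst (clamp 0 1)); [exact: cvg_fst|exact: clamp_continuous].
have c2 : continuous (fun p : R * R => clamp 0 1 p.2).
  by move=> p; apply: (@continuous_comp _ _ _ snd (clamp 0 1)); [exact: cvg_snd|exact: clamp_continuous].
rewrite /comp /coord /=; case: (i == i0 2) => p.
  by apply: cvgB; [exact: cvg_cst|exact: c1].
case: (i == i1 1); last by apply: cvgM; [exact: c1|exact: c2].
by apply: cvgM; [exact: c1|apply: cvgB; [exact: cvg_cst|exact: c2]].
Qed.

Definition bary1 (p q : R * R) (x : simplex R 1) : R * R :=
  (p.1 * coord (i0 1) x + q.1 * coord (i1 0) x,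
   p.2 * coord (i0 1) x + q.2 * coord (i1 0) x).

Definition bary2 (p q r : R * R) (x : simplex R 2) : R * R :=
  (p.1 * coord (i0 2) x + q.1 * coord (i1 1) x + r.1 * coord (i2 0) x,
   p.2 * coord (i0 2) x + q.2 * coord (i1 1) x + r.2 * coord (i2 0) x).

Lemma scale_coord_continuous n (i : 'I_n.+1) (a : R) :
  continuous (fun x : simplex R n => a * coord i x).
Proof.
move=> x; apply: (@continuous_comp _ _ _ (coord i) (fun y => a * y)).
  exact: coord_continuous.
exact: mulrl_continuous.
Qed.

Lemma bary1_continuous p q : continuous (bary1 p q).
Proof.
by apply: continuous_pair; apply: continuous_add; exact: scale_coord_continuous.
Qed.

Lemma bary2_continuous p q r : continuous (bary2 p q r).
Proof.
by apply: continuous_pair; do 2?apply: continuous_add; exact: scale_coord_continuous.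
Qed.

Context (X : topologicalType).
Implicit Types (G : continuousType (R * R)%type X) (z : Z1 (sing R X)).

Lemma seg_continuous G p q : continuous (G \o bary1 p q).
Proof.
by move=> x; apply: continuous_comp; [exact: bary1_continuous|exact: cts_fun].
Qed.
Definition seg G p q : continuousType (simplex R 1) X :=
  continuous_of (@seg_continuous G p q).

Lemma tri_continuous G p q r : continuous (G \o bary2 p q r).
Proof.
by move=> x; apply: continuous_comp; [exact: bary2_continuous|exact: cts_fun].
Qed.
Definition tri G p q r : continuousType (simplex R 2) X :=
  continuous_of (@tri_continuous G p q r).

Lemma path_seg_continuous (g : continuousType R X) (a b : R) :
  continuous (fun x : simplex R 1 => g (a * coord (i0 1) x + b * coord (i1 0) x)).
Proof.
move=> x; apply: (@continuous_comp _ _ _ (fun x => a * coord (i0 1) x + b * coord (i1 0) x) g).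
  by apply: continuous_add; exact: scale_coord_continuous.
exact: cts_fun.
Qed.
Definition path_seg (g : continuousType R X) (a b : R) : continuousType (simplex R 1) X :=
  continuous_of (@path_seg_continuous g a b).

Lemma coord_coface_lift n (i j' : 'I_n.+2) (j : 'I_n.+1) (x : simplex R n) :
  j' = lift i j -> coord j' (coface i x) = coord j x.
Proof. by move=> ->; rewrite /coord /= /insert0 liftK. Qed.

Lemma coord_coface_id n (i j : 'I_n.+2) (x : simplex R n) :
  j = i -> coord j (coface i x) = 0.
Proof. by move=> ->; rewrite /coord /= /insert0 unlift_none. Qed.

Lemma tri_face0 G p q r : sing_face 0 (tri G p q r) = seg G q r.
Proof.
apply/continuousEP => x; rewrite /= /bary2 /bary1.
have e0 : coord (i0 2) (coface (0 : 'I_3) x) = 0.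
  by apply: coord_coface_id; exact: val_inj.
have e1 : coord (i1 1) (coface (0 : 'I_3) x) = coord (i0 1) x.
  by apply: coord_coface_lift; exact: val_inj.
have e2 : coord (i2 0) (coface (0 : 'I_3) x) = coord (i1 0) x.
  by apply: coord_coface_lift; exact: val_inj.
by rewrite e0 e1 e2 !mulr0 !add0r.
Qed.

Lemma tri_face1 G p q r : sing_face 1 (tri G p q r) = seg G p r.
Proof.
apply/continuousEP => x; rewrite /= /bary2 /bary1.
have e0 : coord (i1 1) (coface (1 : 'I_3) x) = 0.
  by apply: coord_coface_id; exact: val_inj.
have e1 : coord (i0 2) (coface (1 : 'I_3) x) = coord (i0 1) x.
  by apply: coord_coface_lift; exact: val_inj.
have e2 : coord (i2 0) (coface (1 : 'I_3) x) = coord (i1 0) x.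
  by apply: coord_coface_lift; exact: val_inj.
by rewrite e0 e1 e2 !mulr0 !addr0.
Qed.

Lemma tri_face2 G p q r : sing_face 2 (tri G p q r) = seg G p q.
Proof.
apply/continuousEP => x; rewrite /= /bary2 /bary1.
have e0 : coord (i2 0) (coface (2 : 'I_3) x) = 0.
  by apply: coord_coface_id; exact: val_inj.
have e1 : coord (i0 2) (coface (2 : 'I_3) x) = coord (i0 1) x.
  by apply: coord_coface_lift; exact: val_inj.
have e2 : coord (i1 1) (coface (2 : 'I_3) x) = coord (i1 0) x.
  by apply: coord_coface_lift; exact: val_inj.
by rewrite e0 e1 e2 !mulr0 !addr0.
Qed.

Lemma sing_seg_add z G p q r :
  val z (seg G p q) + val z (seg G q r) = val z (seg G p r).
Proof.
have /asboolP/(_ (tri G p q r)) : val z \in cocycle1 (sing R X) by exact: valP.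
by rewrite /cobd1 /= tri_face0 tri_face1 tri_face2; lra.
Qed.

Lemma fst_path_continuous (g : continuousType R X) : continuous (fun p : R * R => g p.1).
Proof.
move=> p; apply: (@continuous_comp _ _ _ fst g); [exact: cvg_fst|exact: cts_fun].
Qed.

(** Made constant in a second variable, the path becomes a map of the plane, and the three segments
    bound a degenerate triangle. *)
Lemma sing_path_add z (g : continuousType R X) a b d :
  val z (path_seg g a b) + val z (path_seg g b d) = val z (path_seg g a d).
Proof.
pose G : continuousType (R * R)%type X := continuous_of (@fst_path_continuous g).
have e u v : path_seg g u v = seg G (u, 0) (v, 0) by exact/continuousEP.
by rewrite !e sing_seg_add.
Qed.

Lemma sing_path_cst z (g : continuousType R X) a : val z (path_seg g a a) = 0.
Proof. by have := sing_path_add z g a a a; lra. Qed.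

Lemma path_seg_eq (g g' : continuousType R X) a b a' b' :
  (forall t, 0 <= t <= 1 -> g (a * (1 - t) + b * t) = g' (a' * (1 - t) + b' * t)) ->
  path_seg g a b = path_seg g' a' b'.
Proof.
move=> h; apply/continuousEP => x; rewrite /= coord_sum1; apply: h.
by rewrite coord_ge0 -subr_ge0 -coord_sum1 coord_ge0.
Qed.

Lemma seg_path_eq G (g : continuousType R X) p q a b :
  (forall t, 0 <= t <= 1 -> G (p.1 * (1 - t) + q.1 * t, p.2 * (1 - t) + q.2 * t) =
                          g (a * (1 - t) + b * t)) ->
  seg G p q = path_seg g a b.
Proof.
move=> h; apply/continuousEP => x; rewrite /= /bary1 !coord_sum1; apply: h.
by rewrite coord_ge0 -subr_ge0 -coord_sum1 coord_ge0.
Qed.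

Lemma path_of_simplex_continuous (e : continuousType (simplex R 1) X) :
  continuous (e \o point1).
Proof.
by move=> x; apply: continuous_comp; [exact: point1_continuous|exact: cts_fun].
Qed.
Definition path_of_simplex e : continuousType R X :=
  continuous_of (@path_of_simplex_continuous e).

Lemma point1_coord (x : simplex R 1) : point1 (coord (i1 0) x) = x.
Proof.
have x1 : 0 <= coord (i1 0) x <= 1.
  by rewrite coord_ge0 -subr_ge0 -coord_sum1 coord_ge0.
apply: coord_ext => i; rewrite {1}/coord /= clamp_id //.
case: ifP => [/eqP ->|i0i]; first by rewrite -coord_sum1.
by congr coord; apply: val_inj; case: i i0i => -[|[]].
Qed.

Lemma path_of_simplexK e : path_seg (path_of_simplex e) 0 1 = e.
Proof. by apply/continuousEP => x; rewrite /= mul0r add0r mul1r point1_coord. Qed.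

Lemma simplex0_subproof : (fun _ : 'I_1 => 1 : R) \in simplex R 0.
Proof. by rewrite inE; split=> [i|]; rewrite ?big_ord1 ?ler01. Qed.
Definition point0 : simplex R 0 := exist (fun x => x \in simplex R 0) _ simplex0_subproof.

Lemma sing_path_coboundary z (h : X -> int) :
  (forall g : continuousType R X, val z (path_seg g 0 1) = h (g 1) - h (g 0)) ->
  \pi_(H1 (sing R X)) z = 0.
Proof.
move=> hz; apply/H1_eq0; exists (fun v => h ((v : continuousType _ _) point0)).
apply/funext => e; rewrite -[LHS]/(val z e) -[in LHS](path_of_simplexK e) hz /cobd0 /=.
have E (i : 'I_2) : (i == i0 1) = (i != i1 0) by case: i => -[|[]].
congr (h (e _) - h (e _)); apply: coord_ext => i.
  rewrite {1}/coord /= clamp_id ?lexx ?ler01 //.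
  case: ifP => [/eqP ->|/negbT].
    by rewrite subrr; apply/esym/coord_coface_id; exact: val_inj.
  rewrite E negbK => /eqP ->.
  by apply/esym; rewrite (coord_coface_lift (j := 0)) //; exact: val_inj.
rewrite {1}/coord /= clamp_id ?lexx ?ler01 //.
case: ifP => [/eqP ->|/negbT].
  by apply/esym; rewrite subr0 (coord_coface_lift (j := 0)) //; exact: val_inj.
rewrite E negbK => /eqP ->.
by apply/esym/coord_coface_id; exact: val_inj.
Qed.

Lemma reparam_continuous (g : continuousType R X) (a b : R) :
  continuous (fun t => g (a + (b - a) * clamp 0 1 t)).
Proof.
move=> t; apply: (@continuous_comp _ _ _ (fun t => a + (b - a) * clamp 0 1 t) g); last first.
  exact: cts_fun.
apply: (@continuous_add _ _ (fun=> a)) => [?|y]; first exact: cvg_cst.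
apply: (@continuous_comp _ _ _ (clamp 0 1) (fun y => (b - a) * y)).
  exact: clamp_continuous.
exact: mulrl_continuous.
Qed.

(** A single [h] that works for short paths works for all: a path is cut into pieces lying in the
    given neighbourhoods. *)
Lemma sing_path_local z (h : X -> int) :
  (forall x : X, exists2 U : set X, nbhs x U & forall g : continuousType R X,
     (forall t, U (g t)) -> val z (path_seg g 0 1) = h (g 1) - h (g 0)) ->
  \pi_(H1 (sing R X)) z = 0.
Proof.
move=> hz; apply: (@sing_path_coboundary z h) => g.
apply: (@interval_induction R (fun u v => val z (path_seg g u v) = h (g v) - h (g u)))
  => [u v w _ _ e e'|t _|||]; rewrite ?lexx ?ler01 //.
  by rewrite -(sing_path_add _ _ u v) e e'; ring.
have [U gU hU] := hz (g t).
have /nbhs_ballP[d d0 hd] : nbhs t (g @^-1` U) := @cts_fun _ _ g t U gU.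
exists d => // u v ud uv vd.
pose g' : continuousType R X := continuous_of (@reparam_continuous g u v).
have -> : path_seg g u v = path_seg g' 0 1.
  apply: path_seg_eq => y y01; rewrite mul0r add0r mul1r /= clamp_id //.
  by congr (g _); ring.
have -> : g v = g' 1 by rewrite /= clamp_id ?ler01 ?lexx //; congr (g _); ring.
have -> : g u = g' 0 by rewrite /= clamp_id ?ler01 ?lexx //; congr (g _); ring.
apply: hU => y; apply: hd; rewrite /ball /= ltr_distlC.
have /andP[c0 c1] := @clamp_itv R 0 1 y ler01.
have : 0 <= (v - u) * clamp 0 1 y by rewrite mulr_ge0 // subr_ge0.
have : (v - u) * clamp 0 1 y <= v - u by rewrite ler_piMr // subr_ge0.
by move=> ? ?; apply/andP; split; lra.
Qed.

(* H contracts U to v. In the square (t, s) -> H (g t) s one side is constant and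
   the opposite one is g, so z (g) is the difference of the values of z on the
   tracks s -> H (g t) s of the end points t = 0, 1. *)
Lemma sing_path_contract z (h : X -> int) (U : set X) (H : X -> R -> X) (v : X) :
  (forall x (s : R), U x -> 0 <= s <= 1 -> {for (x, s), continuous (fun p : X * R => H p.1 p.2)}) ->
  (forall x, U x -> H x 1 = x) -> (forall x, U x -> H x 0 = v) ->
  (forall x (d : continuousType R X), U x -> (forall s, 0 <= s <= 1 -> d s = H x s) ->
     val z (path_seg d 0 1) = h x - h v) ->
  forall g : continuousType R X, (forall t, U (g t)) ->
    val z (path_seg g 0 1) = h (g 1) - h (g 0).
Proof.
move=> Hc H1 H0 track g gU.
pose f (p : R * R) := (g p.1, clamp 0 1 p.2).
have fc : continuous f.
  apply: continuous_pair => p; last first.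
    by apply: (@continuous_comp _ _ _ snd (clamp 0 1)); [exact: cvg_snd|exact: clamp_continuous].
  exact: fst_path_continuous.
have Gc : continuous (fun p : R * R => H (g p.1) (clamp 0 1 p.2)).
  move=> p; apply: (@continuous_comp _ _ _ f (fun p => H p.1 p.2)); first exact: fc.
  by apply: Hc => //; exact: clamp_itv.
pose G : continuousType (R * R)%type X := continuous_of Gc.
have Vc (a : R) : continuous (fun s : R => G (a, s)).
  move=> s; apply: (@continuous_comp _ _ _ (fun s => (a, s)) G); last exact: cts_fun.
  by apply: continuous_pair => y; [exact: cvg_cst|exact: cvg_id].
pose V (a : R) : continuousType R X := continuous_of (Vc a).
have Vz a : val z (seg G (a, 0) (a, 1)) = h (g a) - h v.
  rewrite (@seg_path_eq _ (V a) _ _ 0 1) => [|t t01] /=.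
    by apply: track => // s s01; rewrite /= clamp_id.
  by congr H; congr (g _); ring.
have z0 : val z (seg G (0, 0) (1, 0)) = 0.
  have -> : seg G (0, 0) (1, 0) = path_seg (V 0) 0 0.
    apply: seg_path_eq => t t01 /=.
    by rewrite !mul0r !add0r clamp_id ?lexx ?ler01 // !H0.
  exact: sing_path_cst.
have z1 : val z (seg G (0, 1) (1, 1)) = val z (path_seg g 0 1).
  congr (val z _); apply: seg_path_eq => t t01 /=.
  have -> : 1 * (1 - t) + 1 * t = 1 by ring.
  by rewrite clamp_id ?lexx ?ler01 // H1.
have := sing_seg_add z G (0, 0) (1, 0) (1, 1).
by rewrite -(sing_seg_add z G (0, 0) (0, 1) (1, 1)) z0 z1 !Vz; lra.
Qed.

Section as_sing.
Context (c : X -> X -> int) (cc : as_cocycle c).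

Lemma path_potential (g : continuousType R X) :
  exists s, forall t : R, 0 <= t <= 1 -> as_potential (fun p q => c (g p) (g q)) s t.
Proof. by apply: as_potential_interval; apply: as_cocycle_comp => //; exact: cts_fun. Qed.

(** The integral of [c] along [e]. By [as_potential_constant] the choice of the potential does not
    matter. *)
Definition as_sing_fun (e : continuousType (simplex R 1) X) : int :=
  let s := sval (cid (path_potential (path_of_simplex e))) in s 1 - s 0.

Lemma as_sing_funE (g : continuousType R X) (s : R -> int) :
  (forall t : R, 0 <= t <= 1 -> as_potential (fun p q => c (g p) (g q)) s t) ->
  as_sing_fun (path_seg g 0 1) = s 1 - s 0.
Proof.
move=> hs; rewrite /as_sing_fun; case: cid => s' /= hs'.
suff h' t : 0 <= t <= 1 -> as_potential (fun p q => c (path_of_simplex (path_seg g 0 1) p)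
    (path_of_simplex (path_seg g 0 1) q)) (s \o clamp 0 1) t.
  have := as_potential_constant hs' h' (a := 1) (b := 0).
  rewrite /= !lexx ler01 /= => /(_ isT isT).
  by rewrite !clamp_id ?lexx ?ler01 //; lra.
move=> t01; have gE p : path_of_simplex (path_seg g 0 1) p = g (clamp 0 1 p).
  by rewrite /= mul0r add0r mul1r /coord /=.
have := @as_potential_comp _ _ (clamp 0 1) (fun p q => c (g p) (g q)) s t (@clamp_continuous R 0 1).
rewrite clamp_id // => /(_ (hs t t01)) [U tU hU]; exists U => // p q Up Uq.
by rewrite !gE hU.
Qed.

Lemma as_sing_cocycle : as_sing_fun \in cocycle1 (sing R X).
Proof.
apply/asboolP => T; rewrite /cobd1 /=.
have Gc : continuous (T \o point2).
  by move=> p; apply: continuous_comp; [exact: point2_continuous|exact: cts_fun].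
pose G : continuousType (R * R)%type X := continuous_of Gc.
(* With a potential on the square, the values on the three faces become increments of [s] along
   three of its sides. *)
have [s hs] : exists s, forall x t : R, 0 <= x <= 1 -> 0 <= t <= 1 ->
    as_potential (fun p q => c (G p) (G q)) s (x, t).
  by apply: as_potential_square; apply: as_cocycle_comp => //; exact: cts_fun.
have face (e : continuousType (simplex R 1) X) (l : R -> R * R) :
    continuous l -> (forall t, 0 <= t <= 1 -> 0 <= (l t).1 <= 1 /\ 0 <= (l t).2 <= 1) ->
    (forall t, 0 <= t <= 1 -> e (point1 t) = G (l t)) -> as_sing_fun e = s (l 1) - s (l 0).
  move=> lc l01 eG.
  have gc : continuous (G \o l).
    by move=> t; apply: continuous_comp; [exact: lc|exact: cts_fun].
  have -> : e = path_seg (continuous_of gc) 0 1.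
    rewrite -[e]path_of_simplexK; apply: path_seg_eq => t t01.
    by rewrite !mul0r !add0r !mul1r /= eG.
  apply: (@as_sing_funE _ (s \o l)) => t t01.
  apply: (@as_potential_comp _ _ l (fun p q => c (G p) (G q))) => //.
  by have [] := l01 _ t01; rewrite [l t]surjective_pairing; exact: hs.
have lc1 (b : R) : continuous (fun t : R => (t, b)).
  by apply: continuous_pair => y; [exact: cvg_id|exact: cvg_cst].
have lc2 (a : R) : continuous (fun t : R => (a, t)).
  by apply: continuous_pair => y; [exact: cvg_cst|exact: cvg_id].
have B2 (i : 'I_3) : (i == i0 2) || (i == i1 1) || (i == i2 0) by case: i => -[|[|[]]].
have H := (@ler01 R, lexx (0 : R), lexx (1 : R)).
rewrite (face _ (fun t => (1, t))) //=; last 2 first.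
- by move=> t t01; rewrite !H.
- move=> t t01; congr (T _); apply: coord_ext => i.
  have /orP[/orP[]|] := B2 i => /eqP ->.
  + rewrite coord_coface_id; last exact: val_inj.
    by rewrite /coord /= clamp_id ?H // subrr.
  + rewrite (coord_coface_lift (j := i0 1)); last exact: val_inj.
    by rewrite /coord /= !clamp_id ?H // mul1r.
  + rewrite (coord_coface_lift (j := i1 0)); last exact: val_inj.
    by rewrite /coord /= !clamp_id ?H // mul1r.
rewrite (face _ (fun t => (t, 1))) //=; last 2 first.
- by move=> t t01; rewrite !H.
- move=> t t01; congr (T _); apply: coord_ext => i.
  have /orP[/orP[]|] := B2 i => /eqP ->.
  + rewrite (coord_coface_lift (j := i0 1)); last exact: val_inj.
    by rewrite /coord /= !clamp_id ?H.
  + rewrite coord_coface_id; last exact: val_inj.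
    by rewrite /coord /= !clamp_id ?H // subrr mulr0.
  + rewrite (coord_coface_lift (j := i1 0)); last exact: val_inj.
    by rewrite /coord /= !clamp_id ?H // mulr1.
rewrite (face _ (fun t => (t, 0))) //=; last 2 first.
- by move=> t t01; rewrite !H.
- move=> t t01; congr (T _); apply: coord_ext => i.
  have /orP[/orP[]|] := B2 i => /eqP ->.
  + rewrite (coord_coface_lift (j := i0 1)); last exact: val_inj.
    by rewrite /coord /= !clamp_id ?H.
  + rewrite (coord_coface_lift (j := i1 0)); last exact: val_inj.
    by rewrite /coord /= !clamp_id ?H // subr0 mulr1.
  + rewrite coord_coface_id; last exact: val_inj.
    by rewrite /coord /= !clamp_id ?H // mulr0.
(* On the side that is collapsed to a vertex the pulled back cocycle vanishes, so that [s] is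
   constant there. *)
have s0 : s (0, 1) = s (0, 0).
  have h0 t : 0 <= t <= 1 -> as_potential (fun p q => c (G (0, p)) (G (0, q))) (fun=> 0) t.
    move=> t01; exists setT; first exact: filterT.
    move=> p q _ _; have -> : G (0, p) = G (0, q).
      congr (T _); apply: coord_ext => i; rewrite /coord /= clamp_id ?H //.
      by case: ifP => _ //; rewrite !mul0r.
    by rewrite as_cocycle_diag.
  have hs0 t : 0 <= t <= 1 ->
      as_potential (fun p q => c (G (0, p)) (G (0, q))) (fun t => s (0, t)) t.
    move=> t01; apply: (@as_potential_comp _ _ (fun t => (0, t)) (fun p q => c (G p) (G q))) => //.
    by apply: hs; rewrite ?H.
  by have := as_potential_constant hs0 h0 (a := 1) (b := 0); rewrite !H /= => /(_ isT isT); lra.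
by rewrite s0; ring.
Qed.

Definition as_sing : Z1 (sing R X) := exist _ as_sing_fun as_sing_cocycle.

End as_sing.

End singular_paths.

Section as_sing_path.
Context (R : realType) (X : topologicalType) (c : X -> X -> int) (cc : as_cocycle c).

Lemma as_sing_path (g : continuousType R X) (a b : R) (s : R -> int) : a <= b ->
  (forall t : R, a <= t <= b -> as_potential (fun p q => c (g p) (g q)) s t) ->
  val (as_sing R cc) (path_seg g a b) = s b - s a.
Proof.
move=> ab hs; pose m t := a + (b - a) * clamp 0 1 t.
have mc : continuous m.
  apply: (@continuous_add _ _ (fun=> a)) => [t|t]; first exact: cvg_cst.
  apply: (@continuous_comp _ _ _ (clamp 0 1) (fun y => (b - a) * y)).
    exact: clamp_continuous.
  exact: mulrl_continuous.
pose g' : continuousType R X := continuous_of (@reparam_continuous R X g a b).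
have -> : path_seg g a b = path_seg g' 0 1.
  apply: path_seg_eq => y y01; rewrite mul0r add0r mul1r /= clamp_id //.
  by congr (g _); ring.
rewrite -[val _ _]/(as_sing_fun cc (path_seg g' 0 1)).
rewrite (@as_sing_funE R X c cc g' (s \o m)) => [|t t01] /=.
  rewrite /m !clamp_id ?lexx ?ler01 // mulr1 mulr0 addr0.
  by congr (s _ - _); ring.
apply: (as_potential_comp (c := fun p q => c (g p) (g q)) mc); apply: hs.
rewrite /m clamp_id //; have /andP[t0 t1] := t01.
have : 0 <= (b - a) * t by rewrite mulr_ge0 // subr_ge0.
have : (b - a) * t <= b - a by rewrite ler_piMr // subr_ge0.
by move=> *; apply/andP; split; lra.
Qed.

End as_sing_path.

Lemma nbhs_forall (T : topologicalType) (I : finType) (x : T) (f : I -> set T) :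
  (forall i, nbhs x (f i)) -> nbhs x [set y | forall i, f i y].
Proof. by move=> h; exact: (@filter_forall _ _ f (nbhs x) _ h). Qed.

Lemma sing_path_boundary (R : realType) (X : topologicalType) (z : Z1 (sing R X)) :
  \pi_(H1 (sing R X)) z = 0 -> exists h : X -> int,
    forall (g : continuousType R X) a b, val z (path_seg g a b) = h (g b) - h (g a).
Proof.
move=> /H1_eq0[h zh].
have ptc (x : X) : continuous (fun _ : simplex R 0 => x) by exact: cst_continuous.
pose pt (x : X) : splx0 (sing R X) := continuous_of (ptc x).
exists (h \o pt) => g a b; rewrite zh /cobd0.
have c1 x : coord (i0 0) x = 1 :> R by rewrite -(coord_sum x) big_ord1; congr coord; exact: val_inj.
congr (h _ - h _); apply/continuousEP => x; rewrite /= /pt /=; congr (g _).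
  rewrite (coord_coface_id (i := 0) (j := i0 1)); last exact: val_inj.
  rewrite (coord_coface_lift (i := 0) (j' := i1 0) (j := i0 0)); last exact: val_inj.
  by rewrite c1; ring.
rewrite (coord_coface_id (i := 1) (j := i1 0)); last exact: val_inj.
rewrite (coord_coface_lift (i := 1) (j' := i0 1) (j := i0 0)); last exact: val_inj.
by rewrite c1; ring.
Qed.

(** * Locally constant functions on shift spaces *)

Section biinfinite_words.
Context (A : finType).
Implicit Types (T U : biseq A) (f h : biseq A -> int) (N : nat).

Definition agree N T U := forall m : int, (absz m <= N)%N -> T m = U m.

Lemma agreeW N M T U : (N <= M)%N -> agree M T U -> agree N T U.
Proof. by move=> NM h m mN; apply: h; exact: leq_trans NM. Qed.

Lemma agree_sym N T U : agree N T U -> agree N U T.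
Proof. by move=> h m /h. Qed.

Lemma agree_trans N T U V : agree N T U -> agree N U V -> agree N T V.
Proof. by move=> h h' m mN; rewrite h // h'. Qed.

Lemma agree_shift N M T U (n : int) : (N + absz n <= M)%N -> agree M T U ->
  agree N (bishift n T) (bishift n U).
Proof. by move=> NM h m mN; apply: h; lia. Qed.

Lemma agree_all T U : (forall N, agree N T U) -> T = U.
Proof. by move=> h; apply/funext => m; apply: (h (absz m)). Qed.

Lemma agree_bword N T U (m : int) l :
  (forall i, (i < l)%N -> (absz (m + i%:Z)%R <= N)%N) ->
  agree N T U -> bword T m l = bword U m l.
Proof.
move=> ml h; apply/eq_in_map => i; rewrite mem_iota add0n => /andP[_ il].
by apply: h; exact: ml.
Qed.

Lemma bishift_add n m T : bishift n (bishift m T) = bishift (n + m) T.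
Proof. by apply/funext => p; rewrite /bishift addrA. Qed.

Lemma bishift0 T : bishift 0 T = T.
Proof. by apply/funext => p; rewrite /bishift addr0. Qed.

Lemma agree_nbhs N T : nbhs T [set U : biseq A | agree N U T].
Proof.
have cyl m : nbhs T [set U : biseq A | U m = T m].
  have /(_ [set T m]) := @proj_continuous _ (fun _ : int => discrete_topology A) m T.
  apply; exact: discrete_set1.
elim: N => [|N IH].
  by apply: filterS (cyl 0) => U U0 m; rewrite leqn0 absz_eq0 => /eqP ->.
apply: filterS (filterI IH (filterI (cyl N.+1%:Z) (cyl (- N.+1%:Z)))).
move=> U [h [h1 h2]] m mN; have [/h //|Nm] := leqP (absz m) N.
by have [->|->] : m = N.+1%:Z \/ m = - N.+1%:Z by lia.
Qed.

Lemma biseq_cluster (T_ : nat -> biseq A) : exists T : biseq A,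
  forall V, nbhs T V -> forall M, exists2 N, (M <= N)%N & V (T_ N).
Proof.
have cA : compact [set: biseq A].
  have -> : [set: biseq A] = [set g : biseq A | forall i, [set: discrete_topology A] (g i)].
    by apply/seteqP; split.
  apply: (@tychonoff _ (fun _ : int => discrete_topology A) (fun=> setT)) => i.
  by apply: finite_compact; exact: finite_finset.
have [T [_ clT]] := cA (T_ @ \oo) _ filterT.
exists T => V TV M.
have hU : (T_ @ \oo) [set T_ n | n in [set n | (M <= n)%N]].
  by exists M => // n /= Mn; exists n.
by have [U [[n /= Mn <-] Vn]] := clT _ _ hU TV; exists n.
Qed.

Lemma biseq_seq_compact (T_ : nat -> biseq A) :
  exists T, forall M, exists2 N, (M <= N)%N & agree M (T_ N) T.
Proof. by have [T h] := biseq_cluster T_; exists T => M; exact: (h _ (agree_nbhs M T) M). Qed.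

(** If no cylinder around [T] were contained in [V], points outside [V] that agree with [T] on
    larger and larger windows would cluster at [T]. *)
Lemma nbhs_biseq T (V : set (biseq A)) : nbhs T V ->
  exists N, forall U, agree N U T -> V U.
Proof.
move=> TV; apply: contrapT => hN.
have /choice[T_ hT] : forall N, exists U : biseq A, agree N U T /\ ~ V U.
  move=> N; apply: contrapT => h; apply: hN; exists N => U UT.
  by apply: contrapT => nV; apply: h; exists U.
have [T' hT'] := biseq_cluster T_.
have eT : T' = T.
  apply: agree_all => N; have [n Nn h] := hT' _ (agree_nbhs N T') N.
  by apply: agree_trans (agree_sym h) (agreeW Nn (hT n).1).
by have [n _] := hT' V (ltac:(by rewrite eT)) 0; exact: (hT n).2.
Qed.

(** Local constancy on [P] with a uniform window. On a closed [P] the uniformity is automatic by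
    compactness ([windowed_of_local]). *)
Definition windowed (P : set (biseq A)) f := exists N, forall T U,
  P T -> P U -> agree N T U -> f T = f U.

Definition cohomologous (P : set (biseq A)) f f' := exists2 h, windowed P h &
  forall T, P T -> f T - f' T = h T - h (bishift 1 T).

Definition birkhoff f n T : int := \sum_(0 <= j < n) f (bishift j%:Z T).

Lemma birkhoffD f m n T :
  birkhoff f (m + n) T = birkhoff f m T + birkhoff f n (bishift m%:Z T).
Proof.
rewrite /birkhoff (@big_cat_nat _ _ _ m) ?leq_addr //=; congr (_ + _).
rewrite -{1}[m]add0n big_addn addKn; apply: eq_bigr => i _.
by rewrite bishift_add PoszD.
Qed.

Lemma birkhoff0 f T : birkhoff f 0 T = 0.
Proof. by rewrite /birkhoff big_nil. Qed.

Lemma birkhoff1 f T : birkhoff f 1 T = f T.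
Proof. by rewrite /birkhoff big_nat1 bishift0. Qed.

Lemma birkhoff_coboundary h n T :
  birkhoff (fun T => h T - h (bishift 1 T)) n T = h T - h (bishift n%:Z T).
Proof.
elim: n => [|n IH]; first by rewrite birkhoff0 bishift0 subrr.
rewrite -addn1 birkhoffD IH birkhoff1 bishift_add addn1.
by have -> : 1 + n%:Z = n.+1%:Z by []; ring.
Qed.

Lemma eq_birkhoff (P : set (biseq A)) f f' n T : (forall m U, P U -> P (bishift m U)) ->
  P T -> (forall U, P U -> f U = f' U) -> birkhoff f n T = birkhoff f' n T.
Proof. by move=> Ps PT ff'; apply: eq_bigr => j _; apply: ff'; exact: Ps. Qed.

Lemma birkhoffB f f' n T :
  birkhoff (fun U => f U - f' U) n T = birkhoff f n T - birkhoff f' n T.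
Proof. by rewrite /birkhoff sumrB. Qed.

Lemma windowedB P f f' : windowed P f -> windowed P f' -> windowed P (fun T => f T - f' T).
Proof.
move=> [N hN] [M hM]; exists (maxn N M) => T U PT PU TU.
by rewrite (hN T U) ?(hM T U) //; apply: agreeW TU; lia.
Qed.

Lemma cohomologous_refl P f : cohomologous P f f.
Proof. by exists (fun=> 0) => [|T _]; [exists 0%N|rewrite !subrr]. Qed.

Lemma cohomologous_sym P f f' : cohomologous P f f' -> cohomologous P f' f.
Proof.
move=> [h wh e]; exists (fun T => 0 - h T) => [|T PT].
  by apply: windowedB => //; exists 0%N.
by have := e T PT; lra.
Qed.

Lemma cohomologousB P f1 f2 f1' f2' : cohomologous P f1 f2 -> cohomologous P f1' f2' ->
  cohomologous P (fun T => f1 T - f1' T) (fun T => f2 T - f2' T).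
Proof.
move=> [h wh e] [h' wh' e']; exists (fun T => h T - h' T) => [|T PT].
  exact: windowedB.
by have := e T PT; have := e' T PT; lra.
Qed.

Lemma cohomologous_trans P f1 f2 f3 : cohomologous P f1 f2 -> cohomologous P f2 f3 ->
  cohomologous P f1 f3.
Proof.
move=> [h wh e] [h' wh' e']; exists (fun T => h T - (0 - h' T)) => [|T PT].
  by do 2?apply: windowedB => //; exists 0%N.
by have := e T PT; have := e' T PT; lra.
Qed.

Lemma eq_cohomologous (P : set (biseq A)) f f' : (forall T, P T -> f T = f' T) ->
  cohomologous P f f'.
Proof.
move=> e; have [h wh h'] := cohomologous_refl P f; exists h => // T PT.
by rewrite -h' // e.
Qed.

(* Psi T is obtained from T by replacing each letter a by the word th a, the word
   of T 0 starting at position 0. *)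
Record covers (th : A -> seq A) (Psi : biseq A -> biseq A) : Prop := Covers {
  covers_size : forall a, (0 < size (th a))%N;
  covers_shift : forall T, Psi (bishift 1 T) = bishift (size (th (T 0)))%:Z (Psi T);
  covers_nth : forall T j x0, (j < size (th (T 0)))%N -> Psi T j%:Z = nth x0 (th (T 0)) j;
  covers_agree : forall N T U, agree N T U -> agree N (Psi T) (Psi U)
}.

Definition push (th : A -> seq A) (Psi : biseq A -> biseq A) f T :=
  birkhoff f (size (th (T 0))) (Psi T).

Lemma bwordS T m l : bword T m l.+1 = bword T m l ++ [:: T (m + l%:Z) : A].
Proof. by rewrite -addn1 bword_cat /bword /mkseq /= addr0. Qed.

Lemma subst_word1 (th : A -> seq A) a : subst_word th [:: a] = th a.
Proof. by rewrite /subst_word /= cats0. Qed.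

Section covers.
Context (th : A -> seq A) (Psi : biseq A -> biseq A) (cov : covers th Psi).

Lemma covers_shiftn T n : Psi (bishift n%:Z T) =
  bishift (size (subst_word th (bword T 0 n)))%:Z (Psi T).
Proof.
elim: n => [|n IH]; first by rewrite !bishift0.
rewrite -addn1 PoszD [_ + 1]addrC -bishift_add (covers_shift cov) IH bishift_add.
by rewrite addn1 bwordS subst_word_cat size_cat PoszD subst_word1 addrC /bishift !add0r.
Qed.

Lemma covers_bword T n l : (l <= size (subst_word th (bword T 0 n)))%N ->
  bword (Psi T) 0 l = take l (subst_word th (bword T 0 n)).
Proof.
elim: n l => [|n IH] l; first by rewrite leqn0 => /eqP ->; rewrite take0.
set L := size (subst_word th (bword T 0 n)) in IH *.
rewrite bwordS subst_word_cat size_cat subst_word1 add0r -/L => lL.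
have [lL'|Ll] := leqP l L; first by rewrite takel_cat //; exact: IH.
rewrite -(subnKC (ltnW Ll)) bword_cat IH // take_size take_cat -/L ltnNge leq_addr /=.
rewrite addKn; congr (_ ++ _); set b : A := T n%:Z.
have bE : bishift n%:Z T 0 = b by rewrite /bishift add0r.
have lb : (l - L <= size (th b))%N by rewrite leq_subLR.
apply: (@eq_from_nth _ b) => [|i]; first by rewrite size_bword size_takel.
rewrite size_bword => il; rewrite nth_mkseq // nth_take //.
have := covers_nth cov (T := bishift n%:Z T) (j := i) b; rewrite bE => <-; last by lia.
by rewrite covers_shiftn -/L /bishift add0r addrC.
Qed.

Lemma push_birkhoff f n T :
  birkhoff (push th Psi f) n T =
  birkhoff f (size (subst_word th (bword T 0 n))) (Psi T).
Proof.
elim: n => [|n IH]; first by rewrite !birkhoff0.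
rewrite -addn1 birkhoffD IH birkhoff1 addn1 bwordS subst_word_cat size_cat birkhoffD.
by rewrite subst_word1 -covers_shiftn /push add0r /bishift add0r.
Qed.

(** The sum over a word telescopes, and the next word begins where it stops. *)
Lemma push_coboundary h T :
  push th Psi (fun T => h T - h (bishift 1 T)) T = h (Psi T) - h (Psi (bishift 1 T)).
Proof. by rewrite /push birkhoff_coboundary (covers_shift cov). Qed.

Definition width := (\sum_(a : A) size (th a))%N.

Lemma size_width a : (size (th a) <= width)%N.
Proof. by rewrite /width (bigD1 a) //= leq_addr. Qed.

Section push_windowed.
Context (P Q : set (biseq A)).
Hypothesis Ps : forall m U, P U -> P (bishift m U).
Hypothesis QP : forall U, Q U -> P (Psi U).

Lemma windowed_comp h : windowed P h -> windowed Q (h \o Psi).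
Proof.
move=> [N hN]; exists N => T U QT QU TU; apply: hN; [exact: QP|exact: QP|].
exact: (covers_agree cov).
Qed.

Lemma windowed_birkhoff f (m : A -> nat) : windowed P f ->
  windowed Q (fun T => birkhoff f (m (T 0)) (Psi T)).
Proof.
move=> [N hN]; exists (N + \sum_a m a)%N => T U QT QU TU.
have e0 : T 0 = U 0 by apply: TU.
rewrite e0; apply: eq_big_nat => j /andP[_ jm]; apply: hN; [exact/Ps/QP|exact/Ps/QP|].
apply: agree_shift (covers_agree cov TU).
rewrite leq_add2l absz_nat; apply: leq_trans (ltnW jm) _.
by rewrite (bigD1 (U 0)) //= leq_addr.
Qed.

Lemma push_windowed f : windowed P f -> windowed Q (push th Psi f).
Proof. exact: (@windowed_birkhoff f (fun a => size (th a))). Qed.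

Lemma push_cohomologous f f' : cohomologous P f f' ->
  cohomologous Q (push th Psi f) (push th Psi f').
Proof.
move=> [h wh e]; exists (h \o Psi) => [|T QT]; first exact: windowed_comp.
rewrite /= -push_coboundary /push -birkhoffB; apply: eq_birkhoff Ps _ _ => //.
exact: QP.
Qed.

End push_windowed.
End covers.

Lemma covers_id : covers (fun a => [:: a]) id.
Proof. by split=> // T j x0; rewrite ltnS leqn0 => /eqP ->. Qed.

Lemma covers_comp th1 Psi1 th2 Psi2 : covers th1 Psi1 -> covers th2 Psi2 ->
  covers (fun a => subst_word th1 (th2 a)) (Psi1 \o Psi2).
Proof.
move=> c1 c2.
have w T : bword (Psi2 T) 0 (size (th2 (T 0))) = th2 (T 0).
  have h : size (subst_word th2 (bword T 0 1)) = size (th2 (T 0)).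
    by rewrite /bword /mkseq /= subst_word1.
  by rewrite (@covers_bword _ _ c2 T 1) ?h // /bword /mkseq /= subst_word1 take_size.
split=> [a|T|T j x0 jl|N T U TU] /=.
- case: (th2 a) (covers_size c2 a) => // b u _.
  by rewrite /subst_word /= size_cat; have := covers_size c1 b; lia.
- by rewrite (covers_shift c2) (covers_shiftn c1) w.
- have := @covers_bword _ _ c1 (Psi2 T) (size (th2 (T 0))) j.+1; rewrite w => /(_ jl) e.
  have := congr1 (fun u => nth x0 u j) e; rewrite nth_mkseq // nth_take // => <-.
- exact/(covers_agree c1)/(covers_agree c2).
Qed.

Lemma push_comp th1 Psi1 th2 Psi2 f T : covers th1 Psi1 -> covers th2 Psi2 ->
  push th2 Psi2 (push th1 Psi1 f) T =
  push (fun a => subst_word th1 (th2 a)) (Psi1 \o Psi2) f T.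
Proof.
move=> c1 c2; rewrite {1}/push (push_birkhoff c1) /push /=.
congr (birkhoff f (size (subst_word th1 _)) _).
have h : size (subst_word th2 (bword T 0 1)) = size (th2 (T 0)).
  by rewrite /bword /mkseq /= subst_word1.
by rewrite (@covers_bword _ _ c2 T 1) ?h // /bword /mkseq /= subst_word1 take_size.
Qed.

Lemma subst_biseq_covers (phi : substitution A) : covers phi (subst_biseq phi).
Proof.
have s0 a : (0 < size (phi a))%N by rewrite lt0n size_eq0 subst_neq0.
have bw1 T N : bword T 0 N.+1 = (T 0 : A) :: bword (bishift 1 T) 0 N.
  by rewrite -add1n bword_cat bword_shift.
(* The shift moves [T 0] to the left of the origin, where it is the first letter read backwards. *)
have bwN T N : bword (bishift 1 T) (- N.+1%:Z) N.+1 = bword T (- N%:Z) N ++ [:: T 0 : A].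
  rewrite bword_shift bwordS; congr (bword _ _ _ ++ [:: T _]); lia.
split=> // [T|T j x0 jl|N T U TU m mN].
- apply/funext => m; rewrite {2}/bishift; set L := size _; pose x0 : A := T 0.
  case: m => [p|q].
    rewrite (@subst_biseq_pos _ _ _ p p.+1 x0) // -PoszD.
    rewrite (@subst_biseq_pos _ _ _ (p + L) (p + L).+1 x0) //.
    have -> : (p + L).+1 = (p.+1 + L.-1).+1 by have := s0 (T 0); rewrite -/L; lia.
    rewrite (bw1 T) bword_cat -cat1s !subst_word_cat subst_word1.
    have := size_subst_word phi (bword (bishift 1 T) 0 p.+1); rewrite size_bword.
    move: (subst_word phi (bword (bishift 1 T) 0 p.+1)) => w pw.
    by rewrite nth_cat -/L ltnNge leq_addl /= addnK nth_cat pw.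
  rewrite (@subst_biseq_neg _ _ _ q q.+1 x0) // bwN subst_word_cat subst_word1.
  (* Either the position falls in the word of [T 0], which lies to the right of the origin before
     the shift, or it is to the left both times. *)
  rewrite rev_cat nth_cat size_rev -/L; case: ltnP => qL.
    have -> : Negz q + L%:Z = (L - q.+1)%N%:Z by rewrite NegzE; lia.
    rewrite (@subst_biseq_pos _ _ _ _ (L - q.+1).+1 x0) // (bw1 T) -cat1s subst_word_cat subst_word1.
    rewrite nth_cat -/L nth_rev //.
    have -> // : (L - q.+1 < L)%N by lia.
  have -> : Negz q + L%:Z = Negz (q - L) by rewrite !NegzE; lia.
  by rewrite (@subst_biseq_neg _ _ _ _ q x0) //; have := s0 (T 0); rewrite -/L; lia.
- rewrite (@subst_biseq_pos _ _ _ _ j.+1 x0) // (bw1 T) -cat1s subst_word_cat subst_word1.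
  by rewrite nth_cat jl.
- have T0 : T 0 = U 0 by apply: TU.
  case: m mN => [p|q] mN.
    by rewrite /subst_biseq (@agree_bword N T U) ?T0 // => i ip; move: mN; lia.
  by rewrite /subst_biseq (@agree_bword N T U) ?T0 // => i iq; move: mN; rewrite NegzE; lia.
Qed.

End biinfinite_words.

(** * Desubstitution *)

(** In the applications [P M j] says that the value [j] is attained at some index beyond [M], and a
    value attained infinitely often is extracted. If each [j < B] failed from some [m j] on, all
    would fail at the sum of the [m j]. *)
Lemma bounded_pigeonhole (P : nat -> nat -> Prop) B :
  (forall M, exists2 j, (j < B)%N & P M j) ->
  (forall M N j, (M <= N)%N -> P N j -> P M j) ->
  exists2 j, (j < B)%N & forall M, P M j.
Proof.
move=> hP mP; apply: contrapT => h.
have /choice[m hm] : forall j, exists M, (j < B)%N -> ~ P M j.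
  move=> j; apply: contrapT => hj; apply: h; exists j.
    by apply: contrapT => jB; apply: hj; exists 0%N => /jB.
  by move=> M; apply: contrapT => nP; apply: hj; exists M.
have [j jB Pj] := hP (\sum_(j < B) m j)%N; apply: (hm j jB); apply: mP Pj.
by rewrite (bigD1 (Ordinal jB)) //= leq_addr.
Qed.

Section seq_compact2.
Context (A : finType).

Lemma biseq_seq_compact2 (T_ U_ : nat -> biseq A) : exists T U, forall M,
  exists N, [/\ (M <= N)%N, agree M (T_ N) T & agree M (U_ N) U].
Proof.
have [T hT] := biseq_seq_compact T_.
have /choice[n hn] : forall M, exists N, (M <= N)%N /\ agree M (T_ N) T.
  by move=> M; have [N MN h] := hT M; exists N.
have [U hU] := biseq_seq_compact (U_ \o n); exists T, U => M.
have [K MK h] := hU M; have [Kn h'] := hn K; exists (n K); split=> //.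
- exact: leq_trans Kn.
- exact: agreeW h'.
Qed.

Lemma subst_word_cons (th : A -> seq A) a w :
  subst_word th (a :: w) = th a ++ subst_word th w.
Proof. by []. Qed.

Lemma subst_word_comp (th th' : A -> seq A) w :
  subst_word (fun a => subst_word th (th' a)) w = subst_word th (subst_word th' w).
Proof.
by elim: w => // a w IH; rewrite !subst_word_cons subst_word_cat IH.
Qed.

Lemma size_subst_word_ge (th : A -> seq A) w N : (forall a, (N <= size (th a))%N) ->
  (size w * N <= size (subst_word th w))%N.
Proof.
move=> h; elim: w => //= a w IH.
by rewrite subst_word_cons size_cat mulSn leq_add.
Qed.

Lemma size_subst_word_le (th : A -> seq A) w N : (forall a, (size (th a) <= N)%N) ->
  (size (subst_word th w) <= size w * N)%N.
Proof.
move=> h; elim: w => //= a w IH.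
by rewrite subst_word_cons size_cat mulSn leq_add.
Qed.

Lemma subst_word_position (th : A -> seq A) u P : (P < size (subst_word th u))%N ->
  exists u1 b u2 j, [/\ u = u1 ++ b :: u2, (j < size (th b))%N &
    P = (size (subst_word th u1) + j)%N].
Proof.
elim: u P => [|a u IH] P; first by rewrite ltn0.
rewrite subst_word_cons size_cat => Pu.
have [Pa|aP] := ltnP P (size (th a)); first by exists [::], a, u, P.
have [u1 [b [u2 [j [-> jb e]]]]] := IH (P - size (th a))%N ltac:(lia).
exists (a :: u1), b, u2, j; split=> //.
by rewrite subst_word_cons size_cat; lia.
Qed.

(** Pairs that violate larger and larger windows converge along a subsequence to a common limit in
    [P], whose local window they contradict. *)
Lemma windowed_of_local (P : set (biseq A)) (f : biseq A -> int) :
  (forall T : biseq A, (forall M, exists2 U, P U & agree M U T) -> P T) ->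
  (forall T, P T -> exists N, forall U, P U -> agree N U T -> f U = f T) ->
  windowed P f.
Proof.
move=> Pc floc; apply: contrapT => h.
have /choice[x hx] : forall N, exists x : biseq A * biseq A,
    [/\ P x.1, P x.2, agree N x.1 x.2 & f x.1 <> f x.2].
  move=> N; apply: contrapT => hN; apply: h; exists N => T U PT PU TU.
  by apply: contrapT => ne; apply: hN; exists (T, U).
have [T [U h2]] := biseq_seq_compact2 (fun N => (x N).1) (fun N => (x N).2).
have PT : P T.
  by apply: Pc => M; have [N [_ h1 _]] := h2 M; exists (x N).1 => //; case: (hx N).
have eT : T = U.
  apply: agree_all => M; have [N [MN h1 h3]] := h2 M; have [_ _ e _] := hx N.
  exact: agree_trans (agree_sym h1) (agree_trans (agreeW MN e) h3).
have [N0 hN0] := floc T PT; have [N [MN h1 h3]] := h2 N0; have [p1 p2 _] := hx N.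
by apply; rewrite hN0 // hN0 // eT.
Qed.

End seq_compact2.

Section system.
Context (A : finType) (k : nat) (F : 'I_k.+1 -> substitution A) (s : nat -> 'I_k.+1).

Definition level i : set (biseq A) := Sigma F (sshift i s).
Definition phi i : biseq A -> biseq A := subst_biseq (F (s i)).

Lemma phi_covers i : covers (F (s i)) (phi i).
Proof. exact: subst_biseq_covers. Qed.

Lemma level_shift i m T : level i T -> level i (bishift m T).
Proof. exact: Sigma_shift. Qed.

Lemma level_phi i T : level i.+1 T -> level i (phi i T).
Proof. exact: Sigma_subst. Qed.

Lemma infix_bword (T : biseq A) m l (N : nat) : (absz m + l <= N)%N ->
  infix (bword T m l) (bword T (- N%:Z) (N + N).+1).
Proof.
move=> mlN; have -> : (N + N).+1 = (absz (m + N%:Z)%R + (l + ((N + N).+1 - (absz (m + N%:Z)%R + l))))%N by lia.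
rewrite 2!bword_cat; apply/infixP; eexists; eexists; congr (_ ++ (bword _ _ _ ++ _)).
lia.
Qed.

(** Only the central windows of the approximations have to be legal words; the sequences built in
    [desubstitution_window] are arbitrary further out. *)
Lemma level_limit i T : (forall M, exists2 U : biseq A, agree M U T &
    exists n a, infix (bword U (- M%:Z) (M + M).+1) (subst_range F (sshift i s) 0 n a)) ->
  level i T.
Proof.
move=> h m l; have [U UT [n [a na]]] := h (absz m + l)%N.
exists n, a; apply: infix_trans na; rewrite -(agree_bword _ UT); first exact: infix_bword.
by move=> j jl; lia.
Qed.

Lemma level_closed i T : (forall M, exists2 U, level i U & agree M U T) -> level i T.
Proof.
move=> h; apply: level_limit => M; have [U lU UT] := h M; exists U => //; exact: lU.
Qed.

(** Here [n1] and [n2] count the letters of the source word on both sides of the one covering the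
    centre. Images have length at most [B], so a window of radius [K] forces at least [N] letters on
    each side. *)
Lemma desubstitution_bound (N B K n1 n2 x1 x2 y p q j : nat) :
  (0 < B)%N -> K = (N * B + B)%N -> (j < y)%N -> (y <= B)%N ->
  (p + K = x1 + j)%N -> (x1 + (y + x2) = p + ((K + K).+1 + q))%N ->
  (x1 <= n1 * B)%N -> (x2 <= n2 * B)%N -> (N <= n1)%N /\ (N <= n2)%N.
Proof. by move=> B0 *; split; rewrite -(leq_pmul2r B0); lia. Qed.

Lemma window_index_lt (N y z c j r : nat) (m : int) : (absz m <= N)%N ->
  (j < y)%N -> (N <= z)%N -> m + (j%:Z + c%:Z) = r%:Z -> (r < c + (y + z))%N.
Proof. lia. Qed.

Lemma window_index_eq (N K p x c j r L : nat) (m : int) : (absz m <= N)%N ->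
  (N < K)%N -> (p + K = x + j)%N -> (x = L + c)%N ->
  m + (j%:Z + c%:Z) = r%:Z -> (p + absz (K%:Z + m)%R = L + r)%N.
Proof. lia. Qed.

Lemma nth_cat_shift (b : A) (w w' : seq A) r :
  nth b (w ++ w') (size w + r) = nth b w' r.
Proof. by rewrite nth_cat ltnNge leq_addr /= addKn. Qed.

Lemma nth_cat_lt (b : A) (w w' : seq A) r : (r < size w)%N ->
  nth b (w ++ w') r = nth b w r.
Proof. by rewrite nth_cat => ->. Qed.

(** A long central window of [S] occurs in the image of a legal word [u] of the next level. The
    letter of [u] that covers the centre becomes [T 0], and [N] neighbours on each side are kept. *)
Lemma desubstitution_window i S N : level i S -> exists (T : biseq A) j,
  [/\ (j < size (F (s i) (T 0)))%N, agree N S (bishift j%:Z (phi i T)) &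
    exists n a, infix (bword T (- N%:Z) (N + N).+1)
                      (subst_range F (sshift i.+1 s) 0 n a)].
Proof.
move=> lS; pose B := width (F (s i)).
have sB a : (size (F (s i) a) <= B)%N by exact: size_width.
have s0 a : (1 <= size (F (s i) a))%N by rewrite lt0n size_eq0 subst_neq0.
(* Room for [N] images on each side and for the one that covers the centre. *)
pose K := (N.+1 * B)%N.
have [n [a]] := lS (- K%:Z) (K + K).+1; set W := bword S _ _.
have B0 : (0 < B)%N by apply: leq_trans (sB a).
have NK : (N < K)%N by rewrite /K; nia.
have sW : size W = (K + K).+1 by rewrite size_bword.
(* For [n = 0] the window would lie in the image of one letter, which is too short. *)
case: n => [|n].
  rewrite /subst_range subnn /= /sshift addn0 => /size_infix.
  by rewrite sW; have := sB a; rewrite /K; nia.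
rewrite /subst_range subn0 /= {1}/sshift addn0 => hW.
have [u [hu e]] : exists u : seq A, u = subst_range F (sshift i.+1 s) 0 n a /\
    infix W (subst_word (F (s i)) u).
  by eexists; split; first reflexivity; rewrite /subst_range subn0 subst_iter_shiftS.
have /infixP[p [q uE]] := e.
have pu : (size p + K < size (subst_word (F (s i)) u))%N by rewrite uE !size_cat sW; lia.
have [u1 [b [u2 [j [u12 jb Pj]]]]] := subst_word_position pu.
have su := congr1 size uE; rewrite u12 subst_word_cat subst_word_cons !size_cat sW in su.
have l1 := size_subst_word_le u1 sB; have l2 := size_subst_word_le u2 sB.
have KE : K = (N * B + B)%N by rewrite /K mulSnr.
have [N1 N2] := desubstitution_bound B0 KE jb (sB b) Pj su l1 l2.
set x1 := drop (size u1 - N) u1; set x2 := take N u2.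
have sx1 : size x1 = N by rewrite size_drop subKn.
have sx2 : size x2 = N by rewrite size_takel.
pose x := x1 ++ b :: x2.
have sx : size x = (N + N).+1 by rewrite size_cat /= sx1 sx2 addnS.
have xu : infix x u.
  apply/infixP; exists (take (size u1 - N) u1), (drop N u2).
  by rewrite u12 /x -catA cat_cons catA cat_take_drop cat_take_drop.
(* Only the indices from 0 to [2N] are read; elsewhere [V] is junk. *)
pose V : biseq A := fun m => nth b x (absz m).
have Vx : bword V 0 (N + N).+1 = x.
  apply: (@eq_from_nth _ b); first by rewrite size_bword sx.
  by move=> r; rewrite size_bword => rN; rewrite nth_mkseq // /V add0r.
have Vx1 : bword V 0 N = x1.
  apply: (@eq_from_nth _ b); first by rewrite size_bword sx1.
  by move=> r; rewrite size_bword => rN; rewrite nth_mkseq // /V add0r nth_cat sx1 rN.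
exists (bishift N%:Z V), j; split.
- have -> : bishift N V 0 = b :> A by rewrite /bishift add0r /V nth_cat sx1 ltnn subnn.
  exact: jb.
- rewrite /phi (covers_shiftn (subst_biseq_covers _)) Vx1 bishift_add.
  set c := size (subst_word _ x1) => m mN.
  have Nc : (N <= c)%N by rewrite /c -{1}sx1 size_subst_word.
  have x2c : (N <= size (subst_word (F (s i)) x2))%N by rewrite -{1}sx2 size_subst_word.
  pose r := absz (m + (j%:Z + c%:Z))%R.
  have rE : m + (j%:Z + c%:Z) = r%:Z by rewrite /r; lia.
  have rx : (r < size (subst_word (F (s i)) x))%N.
    rewrite /x subst_word_cat subst_word_cons !size_cat.
    exact: (window_index_lt mN jb x2c rE).
  have := @covers_bword _ _ _ (subst_biseq_covers (F (s i))) V (N + N).+1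
    (size (subst_word (F (s i)) x)).
  rewrite Vx => /(_ (leqnn _)); rewrite take_size => /(congr1 (fun w => nth b w r)).
  rewrite nth_mkseq // add0r.
  rewrite -[bishift _ _ m]/(subst_biseq (F (s i)) V (m + (j%:Z + c%:Z))) rE => ->.
  have -> : S m = nth b W (absz (K%:Z + m)%R).
    rewrite nth_mkseq; last by lia.
    by congr (S _); lia.
  have -> : nth b W (absz (K%:Z + m)%R) = nth b (subst_word (F (s i)) u) (size p + absz (K%:Z + m)%R).
    by rewrite uE nth_cat_shift nth_cat_lt // sW; lia.
  have -> : u = take (size u1 - N) u1 ++ x ++ drop N u2.
    by rewrite u12 /x -catA cat_cons catA cat_take_drop cat_take_drop.
  have su1 : size (subst_word (F (s i)) u1) =
      (size (subst_word (F (s i)) (take (size u1 - N) u1)) + c)%N.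
    by rewrite -{1}(cat_take_drop (size u1 - N) u1) subst_word_cat size_cat.
  rewrite subst_word_cat (subst_word_cat _ x); set L := size (subst_word _ (take _ _)) in su1 *.
  have -> : (size p + absz (K%:Z + m)%R)%N = (L + r)%N.
    exact: (window_index_eq mN NK Pj su1 rE).
  by rewrite nth_cat_shift nth_cat_lt.
- exists n, a; rewrite -hu bword_shift addNr Vx.
  exact: xu.
Qed.

(** The local preimages converge along indices at which the offset has a constant value [j]. *)
Lemma desubstitution i S : level i S -> exists (T : biseq A) j,
  [/\ level i.+1 T, (j < size (F (s i) (T 0)))%N & S = bishift j%:Z (phi i T)].
Proof.
move=> lS; pose B := width (F (s i)).
have /choice[x hx] : forall N, exists x : biseq A * nat,
  [/\ (x.2 < size (F (s i) (x.1 0)))%N, agree N S (bishift x.2%:Z (phi i x.1)) &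
    exists n a, infix (bword x.1 (- N%:Z) (N + N).+1)
                      (subst_range F (sshift i.+1 s) 0 n a)].
  by move=> N; have [T [j h]] := desubstitution_window N lS; exists (T, j).
have [T hT] := biseq_seq_compact (fun N => (x N).1).
have [j jB hj] : exists2 j, (j < B)%N & forall M, exists N,
    [/\ (M <= N)%N, agree M (x N).1 T & (x N).2 = j].
  apply: bounded_pigeonhole => [M|M N j MN [K [NK h e]]]; last first.
    by exists K; split=> //; [exact: leq_trans NK|exact: agreeW h].
  have [N MN h] := hT M; exists (x N).2; last by exists N.
  by have [h1 _ _] := hx N; apply: leq_trans h1 (size_width _ _).
exists T, j; split.
- apply: level_limit => M; have [N MN h] := hT M; exists (x N).1 => //.
  have [_ _ [n [a na]]] := hx N; exists n, a; apply: infix_trans na.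
  have -> : (N + N).+1 = (N - M + ((M + M).+1 + (N - M)))%N by lia.
  rewrite 2!bword_cat; apply/infixP; eexists; eexists; congr (_ ++ (bword _ _ _ ++ _)).
  lia.
- have [N [_ h e]] := hj 0%N; have [h1 _ _] := hx N.
  by rewrite -e -(h 0).
- apply: agree_all => M; have [N [MN h e]] := hj (M + j)%N; have [_ h2 _] := hx N.
  apply: (agree_trans (agreeW _ h2)); first by lia.
  by rewrite e; apply: agree_shift (covers_agree (phi_covers i) h); rewrite absz_nat.
Qed.

End system.

(** * Transfer of cohomology along substitutions *)

Section recognisability.
Context (A : finType) (k : nat) (F : 'I_k.+1 -> substitution A) (s : nat -> 'I_k.+1).
Context (i : nat).
Local Notation level := (level F s).
Local Notation phi := (phi F s).
Local Notation width := (width (F (s i))).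
Implicit Types (T U S : biseq A) (f h : biseq A -> int).

Definition unique_desubstitution := forall T U j l,
  level i.+1 T -> level i.+1 U ->
  (j < size (F (s i) (T 0)))%N -> (l < size (F (s i) (U 0)))%N ->
  bishift j%:Z (phi i T) = bishift l%:Z (phi i U) -> T = U /\ j = l.

Hypothesis uniq_desubst : unique_desubstitution.

(** The map [(T, j) |-> shift^j (phi T)] is a continuous bijection from a compact space to level
    [i], so its inverse is continuous and a window in [T] gives one in [S]. In sequences: preimages
    of points that agree more and more have limits with the same image, hence equal limits. *)
Lemma windowed_desubstitution f :
  (exists N, forall T U, level i.+1 T -> level i.+1 U -> agree N T U ->
     forall j, (j < size (F (s i) (T 0)))%N ->
     f (bishift j%:Z (phi i T)) = f (bishift j%:Z (phi i U))) ->
  windowed (level i) f.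
Proof.
move=> [N0 hN0]; apply: contrapT => nw; pose B := width.
have /choice[x hx] : forall N, exists x : (biseq A * nat) * (biseq A * nat),
    [/\ level i.+1 x.1.1 /\ level i.+1 x.2.1,
        (x.1.2 < size (F (s i) (x.1.1 0)))%N /\ (x.2.2 < size (F (s i) (x.2.1 0)))%N,
        agree N (bishift x.1.2%:Z (phi i x.1.1)) (bishift x.2.2%:Z (phi i x.2.1)) &
        f (bishift x.1.2%:Z (phi i x.1.1)) <> f (bishift x.2.2%:Z (phi i x.2.1))].
  move=> N; apply: contrapT => hN; apply: nw; exists N => S S' lS lS' SS'.
  apply: contrapT => ne; apply: hN.
  have [T [j [lT jT e]]] := desubstitution lS; have [U [l [lU jU e']]] := desubstitution lS'.
  by exists ((T, j), (U, l)); split=> //=; rewrite -e -e'.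
have xB N : ((x N).1.2 < B)%N /\ ((x N).2.2 < B)%N.
  by have [_ [h1 h2] _ _] := hx N; split;
    [apply: leq_trans h1 _|apply: leq_trans h2 _]; exact: size_width.
have [T [U hTU]] := biseq_seq_compact2 (fun N => (x N).1.1) (fun N => (x N).2.1).
have [j jB hj] : exists2 j, (j < B)%N & forall M, exists N,
    [/\ (M <= N)%N, agree M (x N).1.1 T, agree M (x N).2.1 U & (x N).1.2 = j].
  apply: bounded_pigeonhole => [M|M N j MN [K [NK h h' e]]]; last first.
    by exists K; split=> //; [exact: leq_trans NK|exact: agreeW h|exact: agreeW h'].
  by have [N [MN h h']] := hTU M; exists (x N).1.2; [case: (xB N)|exists N].
have [l lB hl] : exists2 l, (l < B)%N & forall M, exists N,
    [/\ (M <= N)%N, agree M (x N).1.1 T, agree M (x N).2.1 U & (x N).1.2 = j /\ (x N).2.2 = l].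
  apply: bounded_pigeonhole => [M|M N l MN [K [NK h h' e]]]; last first.
    by exists K; split=> //; [exact: leq_trans NK|exact: agreeW h|exact: agreeW h'].
  by have [N [MN h h' e]] := hj M; exists (x N).2.2; [case: (xB N)|exists N].
have lT : level i.+1 T.
  by apply: level_closed => M; have [N [_ h _ _]] := hl M; exists (x N).1.1 => //; case: (hx N) => -[].
have lU : level i.+1 U.
  by apply: level_closed => M; have [N [_ _ h _]] := hl M; exists (x N).2.1 => //; case: (hx N) => -[].
have jT : (j < size (F (s i) (T 0%R)))%N.
  by have [N [_ h _ [<- _]]] := hl 0%N; have [_ [h1 _] _ _] := hx N; rewrite -(h 0).
have lUl : (l < size (F (s i) (U 0%R)))%N.
  by have [N [_ _ h [_ <-]]] := hl 0%N; have [_ [_ h1] _ _] := hx N; rewrite -(h 0).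
have [eTU ejl] : T = U /\ j = l.
  apply: uniq_desubst => //; apply: agree_all => M.
  have [N [MN h h' [ej el]]] := hl (M + (j + l))%N; have [_ _ e _] := hx N.
  have e1 : agree M (bishift j%:Z (phi i (x N).1.1)) (bishift j%:Z (phi i T)).
    by apply: agree_shift (covers_agree (phi_covers F s i) h); rewrite absz_nat; lia.
  have e2 : agree M (bishift l%:Z (phi i (x N).2.1)) (bishift l%:Z (phi i U)).
    by apply: agree_shift (covers_agree (phi_covers F s i) h'); rewrite absz_nat; lia.
  apply: agree_trans (agree_sym e1) (agree_trans _ e2); rewrite -ej -el.
  by apply: agreeW e; lia.
have [N [_ h h' [ej el]]] := hl N0; have [[l1 l2] [j1 j2] _] := hx N.
by apply; rewrite ej el -ejl; apply: hN0 => //; [rewrite eTU in h; exact: agree_trans h (agree_sym h')|rewrite -ej].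
Qed.

Definition desubst (S : biseq A) : biseq A * nat :=
  xget (S, 0%N) [set x : biseq A * nat | [/\ level i.+1 x.1,
    (x.2 < size (F (s i) (x.1 0)))%N & S = bishift x.2%:Z (phi i x.1)]].

Lemma desubstP T j : level i.+1 T -> (j < size (F (s i) (T 0)))%N ->
  desubst (bishift j%:Z (phi i T)) = (T, j).
Proof.
move=> lT jT; rewrite /desubst; case: xgetP => [[U l] _ /= [lU jU e]|h]; last first.
  by case: (h (T, j)).
by have [-> ->] := uniq_desubst lT lU jT jU e.
Qed.

Lemma push_surj f : windowed (level i.+1) f -> exists2 f',
  windowed (level i) f' & forall T, level i.+1 T -> push (F (s i)) (phi i) f' T = f T.
Proof.
(* The whole value [f T] is put on the first letter of the word of [T 0], and 0 on the others. *)
move=> [N wf]; exists (fun S => if (desubst S).2 == 0%N then f (desubst S).1 else 0).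
  apply: windowed_desubstitution; exists N => T U lT lU TU j jT.
  have T0 : T 0 = U 0 by apply: TU.
  by rewrite !desubstP -?T0 //=; case: ifP => // _; exact: wf.
move=> T lT; rewrite /push /birkhoff.
have : (0 < size (F (s i) (T 0)))%N by exact: (covers_size (phi_covers F s i)).
case E : (size _) => [//|n] _.
rewrite big_nat_recl // big_nat big1 ?addr0 => [|j /andP[_ jn]].
  by rewrite desubstP // E.
by rewrite desubstP ?E.
Qed.

Lemma push_inj f : windowed (level i) f ->
  cohomologous (level i.+1) (push (F (s i)) (phi i) f) (fun=> 0) ->
  cohomologous (level i) f (fun=> 0).
Proof.
move=> wf [h wh hf].
(* The formula is forced: starting from [h T] at the beginning of the word, each letter passed
   subtracts its value of [f]. *)
pose h' S := let: (T, j) := desubst S in h T - birkhoff f j (phi i T).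
have h'E T j : level i.+1 T -> (j < size (F (s i) (T 0)))%N ->
    h' (bishift j%:Z (phi i T)) = h T - birkhoff f j (phi i T).
  by move=> lT jT; rewrite /h' desubstP.
exists h'.
  have [M hM] := wh; have [N hN] := wf.
  apply: windowed_desubstitution; exists (M + (N + width))%N => T U lT lU TU j jT.
  have T0 : T 0 = U 0 by apply: TU.
  rewrite !h'E -?T0 //; congr (_ - _); first by apply: hM => //; apply: agreeW TU; lia.
  apply: eq_big_nat => l /andP[_ lj]; apply: hN; try exact/level_shift/level_phi.
  apply: agree_shift (covers_agree (phi_covers F s i) TU); rewrite absz_nat.
  rewrite addnCA leq_add2l; apply: leq_trans (leq_addl _ _).
  exact: ltnW (leq_trans (ltn_trans lj jT) (size_width _ _)).
move=> S /desubstitution[T [j [lT jT ->]]]; rewrite h'E // bishift_add subr0.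
have -> : 1 + j%:Z = j.+1%:Z by [].
have := jT; rewrite leq_eqVlt => /orP[/eqP jE|jT'].
  (* At the last letter the shift enters the next word at offset 0, and the required identity is the
     one satisfied by [h]. *)
  rewrite jE -(covers_shift (phi_covers F s i)).
  have l1 : level i.+1 (bishift 1 T) by exact: level_shift.
  have := h'E (bishift 1 T) 0%N l1 (covers_size (phi_covers F s i) _).
  rewrite bishift0 => ->; rewrite birkhoff0 subr0.
  have := hf T lT; rewrite /push -jE -addn1 birkhoffD birkhoff1; lra.
by rewrite h'E // -addn1 birkhoffD birkhoff1; ring.
Qed.

End recognisability.

(** * Superwords: growth and reduction to two letters *)

Section growth.
Context (A : finType) (k : nat) (F : 'I_k.+1 -> substitution A) (s : nat -> 'I_k.+1).
Local Notation level := (level F s).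
Local Notation phi := (phi F s).
Implicit Types (T U S : biseq A) (f h : biseq A -> int).

(** The composite of the substitutions of indices [i], ..., [i + d - 1], peeled at the innermost
    factor to match [pushn]. As [subst_iter] peels the outermost one, [thetaS] is needed to compare
    them. *)
Fixpoint theta i d : A -> seq A :=
  if d is d'.+1 then fun a => subst_word (theta i d') (F (s (d' + i)) a) else fun a => [:: a].

Fixpoint Psi i d : biseq A -> biseq A :=
  if d is d'.+1 then Psi i d' \o phi (d' + i) else id.

Fixpoint pushn i d f : biseq A -> int :=
  if d is d'.+1 then push (F (s (d' + i))) (phi (d' + i)) (pushn i d' f) else f.

Lemma theta_covers i d : covers (theta i d) (Psi i d).
Proof. by elim: d => [|d IH];
  [exact: covers_id|exact: (covers_comp IH (phi_covers F s (d + i)))]. Qed.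

Lemma pushnE i d f T : pushn i d f T = push (theta i d) (Psi i d) f T.
Proof.
elim: d T => [|d IH] T; first by rewrite /push /= birkhoff1.
rewrite /= -(push_comp _ _ (theta_covers i d) (phi_covers F s (d + i))).
by apply: eq_bigr => j _; exact: IH.
Qed.

Lemma Psi_level i d T : level (d + i) T -> level i (Psi i d T).
Proof. by elim: d T => // d IH T lT; apply/IH/level_phi. Qed.

Lemma pushn_windowed i d f : windowed (level i) f -> windowed (level (d + i)) (pushn i d f).
Proof.
move=> wf; elim: d => //= d IH; apply: push_windowed IH.
- exact: phi_covers.
- exact: level_shift.
- exact: level_phi.
Qed.

Lemma pushn_cohomologous i d f f' : cohomologous (level i) f f' ->
  cohomologous (level (d + i)) (pushn i d f) (pushn i d f').
Proof.
move=> wf; elim: d => //= d IH; apply: push_cohomologous IH.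
- exact: phi_covers.
- exact: level_shift.
- exact: level_phi.
Qed.

Lemma thetaS i d a : theta i d.+1 a = subst_word (F (s i)) (theta i.+1 d a).
Proof.
elim: d a => [|d IH] a; first by rewrite /= subst_word1 /subst_word; elim: (F _ _) => //= b w ->.
have e : theta i d.+1 = fun b => subst_word (F (s i)) (theta i.+1 d b) by exact/funext.
rewrite -[LHS]/(subst_word (theta i d.+1) (F (s (d.+1 + i)) a)) e subst_word_comp.
by rewrite -[theta i.+1 d.+1 a]/(subst_word (theta i.+1 d) (F (s (d + i.+1)%N) a)) -addSnnS.
Qed.

Lemma subst_iter_theta i d a : subst_iter F s i d a = theta i d.+1 a.
Proof.
elim: d i a => [|d IH] i a; first by rewrite thetaS /= subst_word1.
by rewrite thetaS /= IH.
Qed.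

Lemma thetaD i d e a : theta i (e + d) a = subst_word (theta i d) (theta (d + i) e a).
Proof.
elim: e a => [|e IH] a; first by rewrite /= subst_word1.
rewrite addSn /= -subst_word_comp addnA; congr flatten; apply: eq_map => b; exact: IH.
Qed.

(** A positive matrix puts every letter into the image of every letter. These images have at least
    two letters, so that the minimal length at least doubles. *)
Lemma theta_growth i N : primitive F s -> (1 < #|A|)%N ->
  exists d, forall a, (N <= size (theta i d a))%N.
Proof.
move=> prim /card_gt1P[x [y [_ _ xy]]]; elim: N => [|N [d hd]]; first by exists 0%N.
have [e [_ he]] := prim (d + i)%N; exists (e.+1 + d)%N => a; rewrite thetaD.
set w := theta _ _ _.
have wE b : b \in w.
  have := he (enum_rank b) (enum_rank a).
  rewrite mxE !enum_rankK /subst_range addKn subst_iter_theta -has_pred1 has_count.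
  by [].
have w2 : (1 < size w)%N.
  case: w wE => [|u [|v w]] // wE; first by have := wE x.
  by have := wE x; have := wE y; rewrite !inE => /eqP yu /eqP xu; rewrite xu yu eqxx in xy.
(* The maximum with 1 starts the growth at [N = 0], where doubling gives nothing. *)
have hd' b : (maxn N 1 <= size (theta i d b))%N.
  by rewrite geq_max hd (covers_size (theta_covers i d)).
by have := size_subst_word_ge w hd'; nia.
Qed.

(* Away from the ends of a long superword, a windowed function only sees the
   letter it comes from. *)
Lemma windowed_superword i f : primitive F s -> windowed (level i) f ->
  exists d (m : A -> nat), (forall a, (m a < size (theta i d a))%N) /\
    (forall T U, level (d + i) T -> level (d + i) U -> T 0 = U 0 ->
       f (bishift (m (T 0))%:Z (Psi i d T)) = f (bishift (m (T 0))%:Z (Psi i d U))) /\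
    (forall T U j, level (d + i) T -> level (d + i) U -> T 0 = U 0 -> T 1 = U 1 ->
       (m (T 0%R) <= j < size (theta i d (T 0%R)) + m (T 1%R))%N ->
       f (bishift j%:Z (Psi i d T)) = f (bishift j%:Z (Psi i d U))).
Proof.
(* On a one-letter alphabet words need not grow, but all sequences are equal. *)
move=> prim [N wf]; have [A1|A1] := leqP #|A| 1.
  have eA (a b : A) : a = b by apply: (@card_le1_eqP _ (mem A) A1).
  have eT T U : T = U by apply/funext => m; exact: eA.
  exists 0%N, (fun=> 0%N); split=> //; split=> [T U|T U j] *; by rewrite (eT T U).
(* A word of length [2N + 1] contains the whole window around its position [N], which is the value
   taken for [m]. *)
have [d hd] := theta_growth i (N + N).+1 prim A1.
have cov := theta_covers i d.
have hl T U n j : level (d + i) T -> level (d + i) U -> bword T 0 n = bword U 0 n ->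
    (N <= j)%N -> (j + N < size (subst_word (theta i d) (bword T 0 n)))%N ->
    f (bishift j%:Z (Psi i d T)) = f (bishift j%:Z (Psi i d U)).
  move=> lT lU eb Nj jN; apply: wf; try exact/level_shift/Psi_level.
  set sz := size _ in jN; have e : bword (Psi i d T) 0 sz = bword (Psi i d U) 0 sz.
    by rewrite [LHS](covers_bword cov (n := n)) // [RHS](covers_bword cov (n := n)) /sz ?eb.
  move=> m mN; set p := absz (m + j%:Z)%R; have pE : m + j%:Z = p%:Z by rewrite /p; lia.
  have psz : (p < sz)%N by clearbody sz; lia.
  have := congr1 (fun w => nth (T 0 : A) w p) e.
  by rewrite !nth_mkseq // add0r /bishift pE.
have b1 T : bword T 0 1 = [:: T 0 : A] by rewrite /bword /mkseq /= addr0.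
have b2 T : bword T 0 2 = [:: T 0 : A; T 1 : A] by rewrite /bword /mkseq /= addr0 add0r.
exists d, (fun=> N); split=> [a|]; first by have := hd a; lia.
split=> [T U lT lU e0|T U j lT lU e0 e1 /andP[Nj jN]].
  apply: (hl T U 1%N) => //; first by rewrite !b1 e0.
  by rewrite b1 subst_word1; have := hd (T 0); lia.
apply: (hl T U 2%N) => //; first by rewrite !b2 e0 e1.
rewrite b2 subst_word_cons subst_word1 size_cat; have := hd (T 1).
by move: jN; set x := size _; set y := size _; lia.
Qed.

(** The sum is moved: it runs from position [m (T 0)] in the superword of [T 0] to position
    [m (T 1)] in that of [T 1]. All its terms are determined by the two letters, and the move is the
    coboundary of the omitted initial sum. *)
Lemma pushn_two_letters i f : primitive F s -> windowed (level i) f ->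
  exists d (om : A -> A -> int),
    cohomologous (level (d + i)) (pushn i d f) (fun T => om (T 0) (T 1)).
Proof.
move=> prim wf; have [d [m [hm [_ h2]]]] := windowed_superword prim wf.
pose g T := birkhoff f (size (theta i d (T 0)) + m (T 1) - m (T 0))%N
   (bishift (m (T 0))%:Z (Psi i d T)).
(* The value is read on any sequence with these two letters; pairs that do not occur get 0. *)
pose om a b := if pselect (exists T, [/\ level (d + i) T, T 0 = a & T 1 = b]) is left h
  then g (sval (cid h)) else 0.
have cov := theta_covers i d.
exists d, om, (fun T => birkhoff f (m (T 0)) (Psi i d T)).
  by apply: (windowed_birkhoff cov _ _ m wf); [exact: level_shift|exact: Psi_level].
move=> T lT; have -> : om (T 0) (T 1) = g T.
  rewrite /om; case: pselect => [h|[]]; last by exists T.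
  case: cid => U /= [lU e0 e1]; rewrite /g e0 e1; apply: eq_big_nat => j /andP[_ jl].
  rewrite !bishift_add -PoszD; apply: h2 => //.
  by rewrite e0 e1; have := hm (T 0); lia.
rewrite pushnE /push /g.
have := birkhoffD f (m (T 0)) (size (theta i d (T 0%R)) + m (T 1%R) - m (T 0%R))%N (Psi i d T).
rewrite subnKC; last by have := hm (T 0); lia.
rewrite birkhoffD -(covers_shift cov).
have -> : bishift 1 T 0 = T 1 by rewrite /bishift add0r.
lra.
Qed.

(** [h (Psi T)] is [h] at position [m (T 0)] plus the values of [f] on the way. For an [f] that
    reads two letters both are determined by [T 0], so [h] becomes a function of one letter. *)
Lemma pushn_coboundary i f (w : A -> A -> int) : primitive F s ->
  (forall T, level i T -> f T = w (T 0) (T 1)) -> cohomologous (level i) f (fun=> 0) ->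
  exists d (H : A -> int), forall T, level (d + i) T ->
    pushn i d f T = H (T 1) - H (T 0).
Proof.
move=> prim fw [h wh hf]; have [d [m [hm [h1 _]]]] := windowed_superword prim wh.
have cov := theta_covers i d.
have h0 T : level i T -> f T = h T - h (bishift 1 T) by move=> lT; rewrite -hf // subr0.
have eh T n : level i T -> birkhoff f n T = h T - h (bishift n%:Z T).
  move=> lT; rewrite -birkhoff_coboundary; apply: eq_birkhoff lT _ => //.
  exact: level_shift.
have key T U : level (d + i) T -> level (d + i) U -> T 0 = U 0 ->
    h (Psi i d T) = h (Psi i d U).
  move=> lT lU e0; have lT' := Psi_level lT; have lU' := Psi_level lU.
  have := h1 _ _ lT lU e0; have := eh _ (m (T 0)) lT'; have := eh _ (m (T 0)) lU'.
  suff -> : birkhoff f (m (T 0)) (Psi i d T) = birkhoff f (m (T 0)) (Psi i d U) by lra.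
  apply: eq_big_nat => j /andP[_ jm]; rewrite !fw; try exact: level_shift.
  (* The strict bound on [m] keeps both letters read by [f] inside the superword of [T 0]. *)
  have jl : (j.+1 < size (theta i d (T 0%R)))%N by apply: leq_ltn_trans (hm _).
  have nE V l : T 0 = V 0 -> (l < size (theta i d (T 0%R)))%N ->
      Psi i d V l%:Z = nth (T 0) (theta i d (T 0)) l.
    by move=> e; rewrite e; exact: (covers_nth cov).
  rewrite /bishift !add0r; have -> : 1 + j%:Z = j.+1%:Z by [].
  by rewrite !(nE T) ?(ltnW jl) // !(nE U) ?(ltnW jl).
pose H a := if pselect (exists T, level (d + i) T /\ T 0 = a) is left e
  then - h (Psi i d (sval (cid e))) else 0.
have HE T : level (d + i) T -> H (T 0) = - h (Psi i d T).
  move=> lT; rewrite /H; case: pselect => [e|[]]; last by exists T.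
  by case: cid => U /= [lU e0]; rewrite (key U T).
exists d, H => T lT; rewrite pushnE /push eh; last exact: Psi_level.
rewrite -(covers_shift cov) HE //.
have := HE (bishift 1 T) (level_shift _ lT); rewrite {1}/bishift add0r => ->.
by ring.
Qed.

End growth.

(** * Holonomy of cocycles on tiling spaces *)

Section topquot_lemmas.
Context (T : topologicalType) (r : T -> T -> Prop).

Lemma topquot_open (O : set (topquot r)) : open (topquot_pi r @^-1` O) -> open O.
Proof. by []. Qed.

Lemma topquot_pi_continuous : continuous (topquot_pi r).
Proof. exact: pi_continuous. Qed.

Lemma topquot_eq (B : Type) (g : T -> B) x y :
  (forall x y, r x y -> g x = g y) -> topquot_pi r x = topquot_pi r y -> g x = g y.
Proof.
move=> gr /topquot_piP; elim=> {x y} [x y /gr //|//|x y _ ->//|x y z _ -> _ ->//].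
Qed.

Lemma topquot_reprE (B : Type) (g : T -> B) x :
  (forall x y, r x y -> g x = g y) -> g (topquot_repr (topquot_pi r x)) = g x.
Proof. by move=> gr; apply: topquot_eq gr _; exact: topquot_reprK. Qed.

End topquot_lemmas.

Section tiling_space.
Context (R : realType) (A : finType) (k : nat) (F : 'I_k.+1 -> substitution A).
Context (s : nat -> 'I_k.+1).
Local Notation Sig := (set_type (Sigma F s)).
Local Notation pre := (tiling_pre R F s).
Local Notation Om := (Omega R F s).

Definition Sig_shift (n : int) (T : Sig) : Sig :=
  exist (fun T => T \in Sigma F s) (bishift n (val T))
    (mem_set (Sigma_shift n (set_mem (valP T)))).

Lemma Sig_nbhs (T : Sig) (V : set Sig) : nbhs T V ->
  exists N, forall U : Sig, agree N (val U) (val T) -> V U.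
Proof.
rewrite nbhsE /=; move=> [Q [[W oW WQ] QT] QV]; subst Q.
have [N hN] := nbhs_biseq (open_nbhs_nbhs (conj oW QT : open_nbhs (val T) W)).
by exists N => U UT; apply: QV; exact: hN.
Qed.

Lemma Sig_agree_nbhs N (T : Sig) : nbhs T [set U : Sig | agree N (val U) (val T)].
Proof. exact: (initial_continuous (agree_nbhs N (val T))). Qed.

Lemma Sig_time_nbhs (T : Sig) (t : R) (V : set (Sig * R)) : nbhs (T, t) V ->
  exists N, forall U : Sig, agree N (val U) (val T) -> V (U, t).
Proof.
move=> [[P W] /= [TP tW] PW]; have [N hN] := Sig_nbhs TP; exists N => U UT.
by apply: PW; split=> /=; [exact: hN|apply: nbhs_singleton].
Qed.

Lemma Sig_time_agree N (T : Sig) (t : R) :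
  nbhs (T, t) [set p : Sig * R | agree N (val p.1) (val T)].
Proof.
exists ([set U : Sig | agree N (val U) (val T)], setT) => [|p []//].
by split; [exact: Sig_agree_nbhs|exact: filterT].
Qed.

Lemma clamp_unit (t : R) : clamp 0 1 t \in @unit_interval R.
Proof. by apply/mem_set; rewrite /unit_interval /= in_itv /=; apply: clamp_itv. Qed.

Definition tile_pre (p : Sig * R) : pre :=
  (p.1, exist (fun t => t \in @unit_interval R) _ (clamp_unit p.2)).

Definition tile (p : Sig * R) : Om := topquot_pi (@tiling_glue R A k F s) (tile_pre p).

Lemma tile_continuous : continuous tile.
Proof.
move=> p; apply: (@continuous_comp _ _ _ tile_pre (topquot_pi (@tiling_glue R A k F s))).
  apply: continuous_pair => {}p; first exact: cvg_fst.
  apply: (continuous_comp_initial (w := set_val)) => {}p.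
  by apply: (@continuous_comp _ _ _ snd (clamp 0 1)); [exact: cvg_snd|exact: clamp_continuous].
exact: topquot_pi_continuous.
Qed.

Lemma tile_glue T : tile (T, 1) = tile (Sig_shift 1 T, 0).
Proof.
apply/topquot_piP; apply: rst_step.
by split; rewrite //= clamp_id ?lexx ?ler01.
Qed.

Lemma pre_itv (x : pre) : 0 <= val x.2 <= 1.
Proof. by have := set_mem (valP x.2); rewrite /unit_interval /= in_itv. Qed.

Lemma tile_preK (x : pre) : tile_pre (x.1, val x.2) = x.
Proof.
case: x => T t; congr (_, _); apply: val_inj => /=; apply: clamp_id.
exact: (pre_itv (T, t)).
Qed.

Lemma pre_coord_continuous : continuous (fun x : pre => (x.1, val x.2 : R)).
Proof.
apply: continuous_pair => x; first exact: cvg_fst.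
apply: (@continuous_comp _ _ _ snd (set_val : set_type (@unit_interval R) -> R)); first exact: cvg_snd.
exact: initial_continuous.
Qed.

Lemma glue_norm (x y : pre) : tiling_glue x y -> tiling_norm x = tiling_norm y.
Proof. by case=> x1 y0 xy; rewrite /tiling_norm x1 eqxx y0 xy eq_sym oner_eq0. Qed.

(* S is a potential of c pulled back to the suspension: f T is the value of c along
   the tile at the origin of T. *)
Definition holonomy (c : Om -> Om -> int) (f : biseq A -> int) :=
  windowed (Sigma F s) f /\ exists S : Sig * R -> int,
    (forall T t, 0 <= t <= 1 -> as_potential (fun p q => c (tile p) (tile q)) S (T, t)) /\
    (forall T, f (val T) = S (T, 1) - S (Sig_shift 1 T, 0)).

Lemma Sigma_closed T : (forall M, exists2 U, Sigma F s U & agree M U T) -> Sigma F s T.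
Proof. exact: (@level_closed A k F s 0). Qed.

Lemma local_holonomy c (S : Sig * R -> int) (T : Sig) :
  (forall T t, 0 <= t <= 1 -> as_potential (fun p q => c (tile p) (tile q)) S (T, t)) ->
  exists N, forall U : Sig, agree N (val U) (val T) ->
    S (U, 1) - S (Sig_shift 1 U, 0) = S (T, 1) - S (Sig_shift 1 T, 0).
Proof.
move=> hS.
have [V1 hV1 e1] := hS T 1 ltac:(by rewrite lexx ler01).
have [V0 hV0 e0] := hS (Sig_shift 1 T) 0 ltac:(by rewrite lexx ler01).
have [N1 hN1] := Sig_time_nbhs hV1; have [N0 hN0] := Sig_time_nbhs hV0.
exists (N1 + N0.+1)%N => U UT.
have UT1 : V1 (U, 1) by apply: hN1; apply: agreeW UT; lia.
have UT0 : V0 (Sig_shift 1 U, 0) by apply: hN0; apply: (agree_shift _ UT); lia.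
have := e1 _ _ (nbhs_singleton hV1) UT1; have := e0 _ _ (nbhs_singleton hV0) UT0.
by rewrite !tile_glue; lra.
Qed.

(** Every point has a cylinder over which a potential exists. With the least admissible window at
    each point, the chosen cylinders partition the space into open sets, so that the potentials
    patch without any compatibility. *)
Lemma Sig_potential (c : Om -> Om -> int) : as_cocycle c -> exists S : Sig * R -> int,
  forall T t, 0 <= t <= 1 -> as_potential (fun p q => c (tile p) (tile q)) S (T, t).
Proof.
move=> cc; pose w N (T : Sig) := bword (val T) (- N%:Z) (N + N).+1.
have wP N (T U : Sig) : w N T = w N U <-> agree N (val T) (val U).
  split=> [e m mN|e]; last by apply: agree_bword e => j jl; lia.
  have := congr1 (fun u => nth (val T 0 : A) u (absz (m + N%:Z)%R)) e.
  rewrite !nth_mkseq; [|lia|lia].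
  by have -> : - N%:Z + (absz (m + N%:Z)%R)%:Z = m by lia.
pose good N u (S : Sig * R -> int) := forall (T : Sig) t, w N T = u -> 0 <= t <= 1 ->
  as_potential (fun p q => c (tile p) (tile q)) S (T, t).
pose ok (T : Sig) : pred nat := fun N => `[< exists S, good N (w N T) S >].
have okT T : exists N, ok T N.
  have [P TP [S hS]] := as_potential_tube T (as_cocycle_comp tile_continuous cc).
  have [N hN] := Sig_nbhs TP; exists N; apply/asboolP; exists S => U t /wP UT t01.
  by apply: hS => //; exact: hN.
pose N T := ex_minn (okT T).
have NP T : ok T (N T) by rewrite /N; case: ex_minnP.
have Nmin T n : ok T n -> (N T <= n)%N by rewrite /N; case: ex_minnP => ? _; apply.
(* Admissibility of [n] depends only on the window of size [n], so all points of the cylinder have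
   the same least window. *)
have Nloc T U : w (N T) U = w (N T) T -> N U = N T.
  move=> e; apply/eqP; rewrite eqn_leq; apply/andP; split.
    by apply: Nmin; rewrite /ok e; exact: NP.
  have NU : (N U <= N T)%N by apply: Nmin; rewrite /ok e; exact: NP.
  apply: Nmin; have -> : ok T (N U) = ok U (N U); last exact: NP.
  rewrite /ok; suff -> : w (N U) T = w (N U) U by [].
  by apply/wP/agree_sym/(agreeW NU)/wP.
pose S0 n u := if pselect (exists S, good n u S) is left h then sval (cid h) else fun=> 0.
have S0P T : good (N T) (w (N T) T) (S0 (N T) (w (N T) T)).
  rewrite /S0; case: pselect => [h|[]]; first by case: cid.
  exact/asboolP/NP.
exists (fun p => S0 (N p.1) (w (N p.1) p.1) p) => T t t01.
have [V TV hV] := S0P T T t erefl t01.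
exists (V `&` [set p | w (N T) p.1 = w (N T) T]).
  apply: filterI => //.
  by apply: filterS (Sig_time_agree (N T) T t) => p /= /wP.
by move=> p q [Vp /= ep] [Vq /= eq]; rewrite hV // (Nloc _ _ ep) (Nloc _ _ eq) ep eq.
Qed.

Lemma holonomy_ex c : as_cocycle c -> exists f, holonomy c f.
Proof.
move=> cc; have [S hS] := Sig_potential cc.
pose f T := if pselect (T \in Sigma F s) is left h then
  S (exist (fun T => T \in Sigma F s) T h, 1) - S (Sig_shift 1 (exist (fun T => T \in Sigma F s) T h), 0) else 0.
have fE (T : Sig) : f (val T) = S (T, 1) - S (Sig_shift 1 T, 0).
  rewrite /f; case: pselect => [h|]; last by case; exact: valP.
  by have -> : exist (fun T => T \in Sigma F s) (val T) h = T by exact: val_inj.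
exists f; split; last by exists S.
apply: windowed_of_local; first exact: Sigma_closed.
move=> T sT; pose T' : Sig := exist (fun T => T \in Sigma F s) T (mem_set sT).
have [N hN] := local_holonomy T' hS; exists N => U sU UT.
pose U' : Sig := exist (fun T => T \in Sigma F s) U (mem_set sU).
by rewrite -[U]/(val U') -[T]/(val T') !fE hN.
Qed.

Lemma holonomyB c c' f f' : holonomy c f -> holonomy c' f' ->
  holonomy (fun p q => c p q - c' p q) (fun T => f T - f' T).
Proof.
move=> [wf [S [hS fS]]] [wf' [S' [hS' fS']]]; split; first exact: windowedB.
exists (S \- S'); split=> [T t t01|T]; last by rewrite /= fS fS'; ring.
by apply: (as_potentialB (hS T t t01) (hS' T t t01)).
Qed.

(** The potential on the suspension and the one pulled back from [Omega] differ by a function that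
    is constant along each tile; its value at time 0 is the transfer function. *)
Lemma holonomy_cohomologous c c' f f' : holonomy c f -> holonomy c' f' ->
  as_cohomologous c c' -> cohomologous (Sigma F s) f f'.
Proof.
move=> h h' [K hK]; have [wf [S [hS fS]]] := holonomyB h h'.
have hd T t : 0 <= t <= 1 -> as_potential (fun p q => c (tile p) (tile q) - c' (tile p) (tile q))
    (K \o tile) (T, t).
  move=> t01; exact: (as_potential_comp tile_continuous (hK (tile (T, t)))).
pose d p := S p - K (tile p).
have dloc (T : Sig) (t : R) : 0 <= t <= 1 -> nbhs (T, t) [set p | d p = d (T, t)].
  by move=> t01; exact: as_potential_near (hS T t t01) (hd T t t01).
have dT T t : 0 <= t <= 1 -> d (T, t) = d (T, 0).
  move=> t01; have ic : continuous (fun t : R => (T, t)).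
    by apply: continuous_pair => y; [exact: cvg_cst|exact: cvg_id].
  apply: (as_potential_constant (c := fun p q => c (tile (T, p)) (tile (T, q)) - c' (tile (T, p)) (tile (T, q)))
    (s := fun t => S (T, t)) (s' := fun t => K (tile (T, t)))) t01 _ => [y y01|y y01|].
  - exact: (as_potential_comp ic (hS T y y01)).
  - exact: (as_potential_comp ic (hd T y y01)).
  - by rewrite lexx ler01.
pose hh T := if pselect (T \in Sigma F s) is left e then
  d (exist (fun T => T \in Sigma F s) T e, 0) else 0.
have hE (T : Sig) : hh (val T) = d (T, 0).
  rewrite /hh; case: pselect => [e|]; last by case; exact: valP.
  by have -> : exist (fun T => T \in Sigma F s) (val T) e = T by exact: val_inj.
exists hh.
  apply: windowed_of_local; first exact: Sigma_closed.
  move=> T sT; pose T' : Sig := exist (fun T => T \in Sigma F s) T (mem_set sT).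
  have [N hN] := Sig_time_nbhs (dloc T' 0 ltac:(by rewrite lexx ler01)); exists N => U sU UT.
  pose U' : Sig := exist (fun T => T \in Sigma F s) U (mem_set sU).
  by rewrite -[U]/(val U') -[T]/(val T') !hE; exact: (hN U').
move=> T sT; pose T' : Sig := exist (fun T => T \in Sigma F s) T (mem_set sT).
rewrite -[T]/(val T') -[bishift 1 _]/(val (Sig_shift 1 T')) !hE fS.
by rewrite -(dT T' 1) ?lexx ?ler01 // /d tile_glue; ring.
Qed.

(** Subtracting [h] from [S] makes its values agree at each gluing, so that it descends to
    [Omega]. *)
Lemma holonomy_coboundary c f : as_cocycle c -> holonomy c f ->
  cohomologous (Sigma F s) f (fun=> 0) -> as_cohomologous c (fun _ _ => 0).
Proof.
move=> cc [wf [S [hS fS]]] [h [N wh] hf].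
pose S' (p : Sig * R) := S p - h (val p.1).
have hS' T t : 0 <= t <= 1 -> as_potential (fun p q => c (tile p) (tile q)) S' (T, t).
  move=> t01; have [V TV e] := hS T t t01.
  exists (V `&` [set p | agree N (val p.1) (val T)]).
    apply: filterI => //.
    exact: Sig_time_agree.
  have hh (U : Sig) : agree N (val U) (val T) -> h (val U) = h (val T).
    by move=> UT; apply: wh => //; exact: set_mem (valP _).
  by move=> p q [Vp pT] [Vq qT]; rewrite e // /S' !hh //; ring.
pose st (x : pre) := S' (x.1, val x.2).
have stg x y : tiling_glue x y -> st x = st y.
  move=> [x1 y0 xy]; rewrite /st x1 y0 /S' /=.
  have -> : y.1 = Sig_shift 1 x.1 by exact: val_inj.
  have := hf _ (set_mem (valP x.1)); rewrite fS /=; lra.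
pose sb (u : Om) := st (topquot_repr u).
have sbE p : 0 <= p.2 <= 1 -> sb (tile p) = S' p.
  move=> p01; rewrite /sb /tile topquot_reprE // /st /= clamp_id //.
  by case: p {p01}.
exists sb => u; have [U uU cU] := cc u.
(* The potential is only controlled near points upstairs. The set where the identity holds with base
   point [u] is saturated by construction, and its openness can be tested before passing to the
   quotient. *)
pose O := [set v | U° v /\ c u v = sb v - sb u].
have Uu : U u by exact: nbhs_singleton.
have oO : open O.
  apply: topquot_open; rewrite openE => x [Ux xO].
  have x01 := pre_itv x.
  have [V xV e] := hS' x.1 (val x.2) x01.
  have tE (y : pre) : tile (y.1, val y.2) = topquot_pi (@tiling_glue R A k F s) y.
    by rewrite /tile tile_preK.
  have n1 : nbhs x [set y : pre | V (y.1, val y.2)] by exact: pre_coord_continuous.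
  have n2 : nbhs x [set y : pre | U° (topquot_pi (@tiling_glue R A k F s) y)].
    apply: (@topquot_pi_continuous _ (@tiling_glue R A k F s) x (U°)).
    by apply: open_nbhs_nbhs; split=> //; exact: open_interior.
  apply: filterS (filterI n1 n2) => y [/= Vy Uy]; split=> //.
  have := e _ _ (nbhs_singleton xV) Vy; rewrite !tE.
  have := cU _ _ _ Uu (interior_subset Ux) (interior_subset Uy).
  rewrite -!tE !sbE ?pre_itv // in xO *.
  by rewrite xO => <-; lra.
have Ou : O u by split; [exact: nbhs_singleton (nbhs_interior uU)|rewrite as_cocycle_diag // subrr].
exists O; first exact: open_nbhs_nbhs.
move=> p q [/interior_subset Up ep] [/interior_subset Uq eq].
by have := cU _ _ _ Uu Up Uq; rewrite ep eq; lra.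
Qed.

End tiling_space.

(** * Realising locally constant functions as holonomy *)

Lemma clamp01_cases (R : realType) (t : R) :
  [\/ t <= 0 /\ clamp 0 1 t = 0, 0 <= t <= 1 /\ clamp 0 1 t = t | 1 <= t /\ clamp 0 1 t = 1].
Proof.
have [t0|t0] := leP t 0.
  constructor 1; split=> //; rewrite /clamp min_r ?max_l //.
  exact: le_trans t0 _.
have [t1|t1] := leP t 1.
  by constructor 2; rewrite clamp_id ?(ltW t0).
by constructor 3; rewrite ltW // /clamp min_l ?max_r ?ltW.
Qed.

Lemma clamp01_dist (R : realType) (a b d : R) : `|a - b| < d ->
  `|clamp 0 1 a - clamp 0 1 b| < d.
Proof.
rewrite !ltr_distlC => ab.
have [[? ->]|[? ->]|[? ->]] := clamp01_cases a;
  by have [[? ->]|[? ->]|[? ->]] := clamp01_cases b; lra.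
Qed.

Section tiling_space_surj.
Context (R : realType) (A : finType) (k : nat) (F : 'I_k.+1 -> substitution A).
Context (s : nat -> 'I_k.+1).
Local Notation Sig := (set_type (Sigma F s)).
Local Notation pre := (tiling_pre R F s).
Local Notation Om := (Omega R F s).
Local Notation tile := (@tile R A k F s).

Definition norm_rep (u : Om) : biseq A * R := tiling_norm (topquot_repr u).

Lemma norm_repE (x : pre) : norm_rep (topquot_pi (@tiling_glue R A k F s) x) = tiling_norm x.
Proof. exact: (topquot_reprE _ (@glue_norm R A k F s)). Qed.

Lemma pre_agree N (x : pre) : nbhs x [set y : pre | agree N (val y.1) (val x.1)].
Proof. exact: (pre_coord_continuous (Sig_time_agree N x.1 (val x.2))). Qed.

Lemma pre_time (x : pre) (V : set R) : nbhs (val x.2 : R) V -> nbhs x [set y : pre | V (val y.2)].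
Proof.
move=> xV; have h : nbhs (x.1, val x.2 : R) [set p : Sig * R | V p.2].
  by exists (setT, V) => [|p []//]; split=> //; exact: filterT.
exact: (pre_coord_continuous h).
Qed.

Context (f : biseq A -> int).

(* Jumping in the middle of the tiles avoids the points where they are glued. *)
Definition jump (u : Om) : int := if 2^-1 <= (norm_rep u).2 then f (norm_rep u).1 else 0.

(** Near a gluing, the normalised times of close points may differ by almost 1. No jump lies between
    such points, whence the value 0. *)
Definition jump_cocycle (u v : Om) : int :=
  if `|(norm_rep u).2 - (norm_rep v).2| < 2^-1 then jump v - jump u else 0.

Lemma norm_lt1 (x : pre) : 0 <= (tiling_norm x).2 < 1.
Proof.
rewrite /tiling_norm; case: eqP => [_|/eqP x1] /=; first by rewrite lexx ltr01.
by have := pre_itv x; rewrite lt_neqAle x1.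
Qed.

Lemma jump_cocycle_as_cocycle : windowed (Sigma F s) f -> as_cocycle jump_cocycle.
Proof.
move=> [N wf] u; set t0 := (norm_rep u).2.
have t01 : 0 <= t0 < 1 by exact: norm_lt1.
have loc (P : pre -> Prop) (Q : Om -> Prop) : (forall x, Q (topquot_pi (@tiling_glue R A k F s) x) <-> P x) ->
    (forall x, P x -> nbhs x P) -> Q u -> nbhs u Q.
  move=> QP Po Qu; apply: open_nbhs_nbhs; split=> //; apply: topquot_open.
  rewrite openE => x /= /QP /Po; apply: filterS => y /QP //.
(* Away from the gluing, the times of points near [u] differ by less than 1/2, and the cocycle is a
   difference of values of [jump]. At the gluing it will vanish. *)
have [t00|t0N] := eqVneq t0 0; last first.
  have t0p : 0 < t0 by rewrite lt_neqAle eq_sym t0N; case/andP: t01.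
  pose d := Num.min (1/4) (Num.min (t0 / 2) ((1 - t0) / 2)).
  have d0 : 0 < d by rewrite !lt_min; apply/andP; split; [lra|apply/andP; split; lra].
  have [d1 [d2 d3]] : d <= 1/4 /\ d <= t0 / 2 /\ d <= (1 - t0) / 2.
    by rewrite /d !ge_min !lexx ?orbT.
  exists [set v : Om | `|(norm_rep v).2 - t0| < d].
    apply: (loc (fun x => `|val x.2 - t0| < d)) => [x|x xt|].
    - rewrite /= norm_repE /tiling_norm; case: eqP => //= ->.
      by split; rewrite ltr_distlC; lra.
    - apply: (pre_time (V := [set t | `|t - t0| < d])).
      have : nbhs (val x.2 : R) (ball t0 d).
        apply: open_nbhs_nbhs; split; first exact: ball_open.
        by rewrite /ball /= distrC.
      by apply: filterS => t; rewrite /ball /= distrC.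
    - by rewrite /= -/t0 subrr normr0.
  move=> p q r /= pd qd rd.
  have h (a b : R) : `|a - t0| < d -> `|b - t0| < d -> (`|a - b| < 2^-1) = true.
    by move=> /[!ltr_distlC] ? ?; lra.
  by rewrite /jump_cocycle !h //; ring.
(* The value of [f] on the tile that ends at [u]: the neighbourhood consists of starts of tiles
   preceded by this value and of ends of tiles carrying it. *)
pose m := f (bishift (- 1) (norm_rep u).1).
exists [set v : Om | ((norm_rep v).2 < 4^-1 /\ f (bishift (- 1) (norm_rep v).1) = m) \/
               (3/4 < (norm_rep v).2 /\ f (norm_rep v).1 = m)].
  apply: (loc (fun x => (val x.2 < 4^-1 /\ f (bishift (- 1) (val x.1)) = m) \/
               (3/4 < val x.2 /\ f (val x.1) = m))) => [x|x xP|].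
  - rewrite /= norm_repE /tiling_norm; case: eqP => //= ->.
    rewrite bishift_add addNr bishift0; split=> [[[_ e]|[t _]]|[[t _]|[_ e]]].
    + by right; split=> //; lra.
    + by exfalso; lra.
    + by exfalso; lra.
    + by left; split=> //; lra.
  - have fl n (y z : pre) : agree (N + absz n) (val y.1) (val z.1) ->
        f (bishift n (val y.1)) = f (bishift n (val z.1)).
      move=> h; apply: wf; last exact: (agree_shift (leqnn _) h).
        by apply: Sigma_shift; exact: (set_mem (valP y.1)).
      by apply: Sigma_shift; exact: (set_mem (valP z.1)).
    case: xP => -[xt fx].
      apply: filterS (filterI (pre_agree (N + 1) x) (pre_time (lt_nbhsl xt))).
      by move=> y [/= yx yt]; left; split=> //; rewrite (fl (- 1) y x).
    apply: filterS (filterI (pre_agree N x) (pre_time (lt_nbhsr xt))).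
    move=> y [/= yx yt]; right; split=> //; rewrite -fx.
    by have := fl 0 y x; rewrite addn0 !bishift0; apply.
  - by left; rewrite -/t0 t00; split=> //; lra.
have z (p q : Om) : ((norm_rep p).2 < 4^-1 /\ f (bishift (- 1) (norm_rep p).1) = m) \/
               (3/4 < (norm_rep p).2 /\ f (norm_rep p).1 = m) ->
    ((norm_rep q).2 < 4^-1 /\ f (bishift (- 1) (norm_rep q).1) = m) \/
               (3/4 < (norm_rep q).2 /\ f (norm_rep q).1 = m) -> jump_cocycle p q = 0.
  rewrite /jump_cocycle /jump => hp hq; case: ifP => //; rewrite ltr_distlC => pq.
  case: hp => -[pt pf]; case: hq => -[qt qf]; [|by exfalso; lra|by exfalso; lra|].
    by rewrite !ifF ?subrr //; apply/negbTE; rewrite -ltNge; lra.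
  by rewrite !ifT ?pf ?qf ?subrr //; lra.
by move=> p q r /= hp hq hr; rewrite !z.
Qed.

Lemma holonomy_surj : windowed (Sigma F s) f -> holonomy jump_cocycle f.
Proof.
move=> wf; split=> //; have [N hN] := wf.
exists (fun p => if 2^-1 <= p.2 then f (val p.1) else 0); split=> [T t t01|T /=]; last first.
  have h1 : 2^-1 <= 1 :> R by lra.
  have h0 : (2^-1 <= 0 :> R) = false by apply/negbTE; rewrite -ltNge; lra.
  by rewrite h1 h0 subr0.
have norm p : norm_rep (tile p) = if clamp 0 1 p.2 == 1 then (bishift 1 (val p.1), 0)
    else (val p.1, clamp 0 1 p.2) by rewrite norm_repE.
have time d : 0 < d -> nbhs (T, t) [set p : Sig * R | `|p.2 - t| < d].
  move=> d0; exists (setT, [set t' | `|t' - t| < d]) => [|p []//]; split; first exact: filterT.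
  apply/nbhs_ballP; exists d => // t'; rewrite /ball /= distrC //.
have fT (U : Sig) : agree N (val U) (val T) -> f (val U) = f (val T).
  by move=> h; apply: hN h; exact: (set_mem (valP _)).
have [t1|t1] := ltP t 1.
  pose d := Num.min 8^-1 ((1 - t) / 2).
  have d0 : 0 < d by rewrite lt_min; apply/andP; split; lra.
  have [d1 d2] : d <= 8^-1 /\ d <= (1 - t) / 2 by rewrite /d !ge_min !lexx ?orbT.
  exists ([set p | agree N (val p.1) (val T)] `&` [set p : Sig * R | `|p.2 - t| < d]).
    by apply: filterI; [exact: Sig_time_agree|exact: time].
  have E (p : Sig * R) : `|p.2 - t| < d -> norm_rep (tile p) = (val p.1, clamp 0 1 p.2) /\
      (2^-1 <= clamp 0 1 p.2) = (2^-1 <= p.2).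
    rewrite ltr_distlC => pt; rewrite norm.
    have [[p0 ->]|[p0 ->]|[p0 ->]] := clamp01_cases p.2; last by lra.
    - rewrite eq_sym oner_eq0; split=> //.
      by apply/idP/idP; lra.
    - by rewrite ifF //; apply/negbTE; rewrite neq_lt; apply/orP; left; lra.
  move=> p q [/= pT /[dup] pd /E[ep hp]] [/= qT /[dup] qd /E[eq hq]].
  rewrite /jump_cocycle /jump ep eq /= hp hq ifT //; apply: clamp01_dist.
  by move: pd qd; rewrite !ltr_distlC; lra.
(* For [t = 1], later times are clamped to 1 and normalise to time 0 of the next tile. Near [(T, 1)]
   both the cocycle and the increments of the potential vanish. *)
exists ([set p | agree N (val p.1) (val T)] `&` [set p : Sig * R | `|p.2 - t| < 8^-1]).
  by apply: filterI; [exact: Sig_time_agree|apply: time; lra].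
have tE : t = 1 by lra.
have E (p : Sig * R) : agree N (val p.1) (val T) -> `|p.2 - t| < 8^-1 ->
    ((norm_rep (tile p)).2 = 0 \/ 7/8 < (norm_rep (tile p)).2 /\ f (norm_rep (tile p)).1 = f (val T)) /\
    (2^-1 <= p.2) = true /\ f (val p.1) = f (val T).
  rewrite tE ltr_distlC norm => pT pt; split; last by split; [lra|exact: fT].
  have [[p0 ->]|[p0 ->]|[p0 ->]] := clamp01_cases p.2; first by exfalso; lra.
    case: eqP => _ /=; first by left.
    by right; split; [lra|exact: fT].
  by left; rewrite eqxx.
move=> p q [/= pT pd] [/= qT qd].
have [hp [-> ->]] := E p pT pd; have [hq [-> ->]] := E q qT qd; rewrite subrr.
rewrite /jump_cocycle /jump; case: ifP => //; rewrite ltr_distlC => pq.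
case: hp => [p0|[p0 fp]]; case: hq => [q0|[q0 fq]]; [|by exfalso; lra|by exfalso; lra|].
  by rewrite p0 q0 !ifF ?subrr //; apply/negbTE; rewrite -ltNge; lra.
by rewrite !ifT ?fp ?fq ?subrr //; lra.
Qed.

End tiling_space_surj.

(** * Unique desubstitution from injectivity on tiling spaces *)

Section recognisable.
Context (R : realType) (A : finType) (k : nat) (F : 'I_k.+1 -> substitution A).
Context (s : nat -> 'I_k.+1).

(** The point of time [j / |phi (T 0)|] is sent to [shift^j (phi T)] at time 0, so equal images are
    given to injectivity. As [j] is less than the length, this time is less than 1 and is determined
    by the class of the point. *)
Lemma recognisable_unique i : injective (@tiling_map R A k F s i) ->
  unique_desubstitution F s i.
Proof.
move=> inj T U j l lT lU jT lUl e.
have pos (V : biseq A) : 0 < (size (F (s i) (V 0)))%:R :> R.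
  by rewrite ltr0n lt0n size_eq0 subst_neq0.
have xu (V : biseq A) n : (n < size (F (s i) (V 0)))%N ->
    (n%:R / (size (F (s i) (V 0)))%:R : R) \in @unit_interval R.
  move=> nV; apply/mem_set; rewrite /unit_interval /= in_itv /= divr_ge0 ?ler0n //=.
  by rewrite ler_pdivrMr // mul1r ler_nat ltnW.
pose x (V : biseq A) (lV : level F s i.+1 V) n (nV : (n < size (F (s i) (V 0)))%N) :
    tiling_pre R F (sshift i.+1 s) :=
  (exist (fun T => T \in Sigma F (sshift i.+1 s)) V (mem_set lV),
   exist (fun t => t \in @unit_interval R) _ (xu V n nV)).
have normx V lV n nV : tiling_norm (x V lV n nV) = (V, n%:R / (size (F (s i) (V 0)))%:R).
  rewrite /tiling_norm ifF //=; apply/negbTE; rewrite lt_eqF //.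
  by rewrite ltr_pdivrMr // mul1r ltr_nat.
have mapx V lV n nV : subst_point (F (s i)) (tiling_norm (x V lV n nV)) =
    (bishift n%:Z (phi F s i V), 0).
  rewrite normx /subst_point /= mulrC divfK ?gt_eqF //.
  by have -> : n%:R = (n%:Z)%:~R :> R by []; rewrite intrKfloor subrr.
have : topquot_pi (@tiling_glue R A k F _) (x T lT j jT) = topquot_pi (@tiling_glue R A k F _) (x U lU l lUl).
  apply: inj; rewrite !tiling_mapE; congr (topquot_pi _ _).
  rewrite /tiling_map_pre; congr (_, _); apply: val_inj.
    change ((subst_point (F (s i)) (tiling_norm (x T lT j jT))).1 =
            (subst_point (F (s i)) (tiling_norm (x U lU l lUl))).1).
    by rewrite !mapx /= e.
  change ((subst_point (F (s i)) (tiling_norm (x T lT j jT))).2 =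
          (subst_point (F (s i)) (tiling_norm (x U lU l lUl))).2).
  by rewrite !mapx.
move=> /(topquot_eq (@glue_norm R A k F _)); rewrite !normx => -[TU].
subst U; move/(divIf (lt0r_neq0 (pos T)))/eqP; rewrite eqr_nat => /eqP //.
Qed.

End recognisable.

(** * Barge-Diamond complexes *)

Section barge_diamond.
Context (R : realType) (A : finType) (k : nat) (F : 'I_k.+1 -> substitution A).
Local Notation eps := (bd_eps R F).

Lemma bd_eps_gt0 : 0 < eps.
Proof.
rewrite /bd_eps; elim/big_ind: _ => [|x y x0 y0|j _]; rewrite ?invr_gt0 ?lt_min ?x0 ?y0 //.
elim/big_ind: _ => [|x y x0 y0|a _]; rewrite ?invr_gt0 ?lt_min ?x0 ?y0 //.
by rewrite mulr_gt0 // ltr0n lt0n size_eq0 subst_neq0.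
Qed.

Lemma bd_eps_le_half : eps <= 2^-1.
Proof. by rewrite /bd_eps; apply: bigmin_le_id. Qed.

Lemma bd_eps_size j a : (size (F j a))%:R * (2 * eps) <= 1.
Proof.
have s0 : 0 < (2 * (size (F j a))%:R : R).
  by rewrite mulr_gt0 // ltr0n lt0n size_eq0 subst_neq0.
have h : eps <= (2 * (size (F j a))%:R)^-1.
  have h1 : eps <= \big[Num.min/2^-1]_(b : A) (2 * (size (F j b))%:R)^-1.
    by rewrite /bd_eps; apply: bigmin_le_cond.
  by apply: (le_trans h1); apply: bigmin_le_cond.
have := ler_wpM2l (ltW s0) h; rewrite divff ?gt_eqF // => h'.
by apply: le_trans h'; rewrite mulrA [_ * 2]mulrC.
Qed.

Context (s : nat -> 'I_k.+1).
Local Notation E := (set_type (@bd_edges R A k F s)).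
Local Notation K := (bd_complex R F s).
Local Notation label := (A + A * A)%type.
Local Notation pi := (topquot_pi (@bd_glue R A k F s)).

Definition valid (l : label) : Prop := if l is inr ab then L2 F s ab else True.
Definition lo (l : label) : R := if l is inr _ then - eps else eps.
Definition hi (l : label) : R := if l is inr _ then eps else 1 - eps.

Lemma lo_le_hi l : lo l <= hi l.
Proof. by have := bd_eps_gt0; have := bd_eps_le_half; case: l => /= [a|ab]; lra. Qed.

Definition param (p : E) : R := (val p).1.
Definition lab (p : E) : label := (val p).2.

Lemma param_itv p : lo (lab p) <= param p <= hi (lab p).
Proof.
have := set_mem (valP p); rewrite /bd_edges /param /lab /=.
by case: (val p) => t [a|ab] //= [].
Qed.

Lemma lab_valid p : valid (lab p).
Proof.
have := set_mem (valP p); rewrite /bd_edges /param /lab /=.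
by case: (val p) => t [a|ab] //= [].
Qed.

Lemma edge_point_subproof l t : valid l ->
  ((clamp (lo l) (hi l) t, l) : R * bd_label A) \in @bd_edges R A k F s.
Proof.
move=> vl; apply/mem_set; have := clamp_itv t (lo_le_hi l).
by case: l vl => [a|ab] //= vl h; split.
Qed.

Definition edge_point l (v : valid l) (t : R) : E :=
  exist (fun p => p \in @bd_edges R A k F s) _ (edge_point_subproof t v).

Lemma edge_point_continuous l (v : valid l) : continuous (edge_point v).
Proof.
apply: (continuous_comp_initial (w := set_val)).
apply: continuous_pair => t; [exact: clamp_continuous|exact: cvg_cst].
Qed.

Lemma edge_path_continuous l (v : valid l) : continuous (pi \o edge_point v).
Proof.
move=> t; apply: continuous_comp; first exact: edge_point_continuous.
exact: topquot_pi_continuous.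
Qed.

Definition edge_path l (v : valid l) : continuousType R K :=
  continuous_of (@edge_path_continuous l v).

Lemma edge_point_eq (p : E) l (v : valid l) : lab p = l -> edge_point v (param p) = p.
Proof.
move=> lp; apply: val_inj; rewrite /= clamp_id -?lp; last exact: param_itv.
by rewrite /param /lab -surjective_pairing.
Qed.

Lemma edge_path_eq (p : E) l (v : valid l) : lab p = l -> edge_path v (param p) = pi p.
Proof. by move=> lp; rewrite /= edge_point_eq. Qed.

Definition vl (a : A) : valid (inl a) := I.

Lemma edge_glue_left a b (v : valid (inr (a, b))) :
  edge_path (vl a) (1 - eps) = edge_path v (- eps).
Proof.
apply/topquot_piP; apply: rst_step; exists a, b; left; split => /=; congr (_, _).
  by apply: clamp_id; have := bd_eps_gt0; have := bd_eps_le_half; lra.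
by apply: clamp_id; have := bd_eps_gt0; lra.
Qed.

Lemma edge_glue_right a b (v : valid (inr (a, b))) :
  edge_path (vl b) eps = edge_path v eps.
Proof.
apply/topquot_piP; apply: rst_step; exists a, b; right; split => /=; congr (_, _).
  by apply: clamp_id; have := bd_eps_gt0; have := bd_eps_le_half; lra.
by apply: clamp_id; have := bd_eps_gt0; lra.
Qed.

Lemma glue_inv (B : Type) (f : E -> B) :
  (forall a b (x y : E), lab x = inl a -> param x = 1 - eps ->
     lab y = inr (a, b) -> param y = - eps -> f x = f y) ->
  (forall a b (x y : E), lab x = inl b -> param x = eps ->
     lab y = inr (a, b) -> param y = eps -> f x = f y) ->
  forall x y, bd_glue x y -> f x = f y.
Proof.
move=> h1 h2 x y [a [b [[xE yE]|[xE yE]]]].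
  by apply: (h1 a b); rewrite /lab /param ?xE ?yE.
by apply: (h2 a b); rewrite /lab /param ?xE ?yE.
Qed.

Lemma edges_nbhs (p : E) (d : R) : 0 < d ->
  nbhs p [set q | lab q = lab p /\ `|param q - param p| < d].
Proof.
move=> d0; have h : nbhs (val p) [set q : R * bd_label A | q.2 = (val p).2 /\ `|q.1 - (val p).1| < d].
  exists (ball (val p).1 d, [set (val p).2]) => /=.
    by split; [exact: nbhsx_ballx|exact: discrete_set1].
  by move=> [t l] /= [+ ->]; rewrite /ball /= distrC.
exact: (initial_continuous h).
Qed.

(** Openness is tested on saturated predicates before the quotient, edge by edge, with a radius
    depending on the point. *)
Lemma complex_nbhs (P : E -> Prop) (Q : K -> Prop) u : (forall x, Q (pi x) <-> P x) ->
  (forall x, P x -> exists2 d : R, 0 < d &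
     forall y, lab y = lab x -> `|param y - param x| < d -> P y) ->
  Q u -> nbhs u Q.
Proof.
move=> QP Po Qu; apply: open_nbhs_nbhs; split=> //; apply: topquot_open.
rewrite openE => x /= /QP /Po[d d0 h].
by apply: filterS (edges_nbhs x d0) => y [ly py]; apply/QP; exact: h.
Qed.

(* Only points of the open edges e_ab are seen, so that inner_pre is compatible
   with the gluing. *)
Definition inner_pre (p : E) : option ((A * A) * R) :=
  if lab p is inr ab then
    if `|param p| < eps then Some (ab, param p) else None
  else None.

Lemma inner_glue x y : bd_glue x y -> inner_pre x = inner_pre y.
Proof.
apply: glue_inv => {x y} [a b x y|a b x y]; rewrite /inner_pre => -> _ -> ->.
  by rewrite normrN gtr0_norm ?bd_eps_gt0 // ltxx.
by rewrite gtr0_norm ?bd_eps_gt0 // ltxx.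
Qed.

Definition inner (u : K) := inner_pre (topquot_repr u).
Lemma innerE x : inner (pi x) = inner_pre x.
Proof. exact: topquot_reprE inner_glue. Qed.

(* The closed edge e_a together with the halves of the edges e_ba and e_ac at
   distance less than d from it. *)
Definition near_pre (d : R) (a : A) (p : E) : bool :=
  match lab p with
  | inl a' => a' == a
  | inr (b, c) => (c == a) && (eps - d < param p) || (b == a) && (param p < d - eps)
  end.

Lemma near_glue d a x y : 0 < d -> d <= eps -> bd_glue x y -> near_pre d a x = near_pre d a y.
Proof.
move=> d0 de; apply: glue_inv => {x y} [b c x y|b c x y]; rewrite /near_pre => -> _ -> ->.
  have -> : (eps - d < - eps) = false by apply/negbTE; rewrite -leNgt; have := bd_eps_gt0; lra.
  have -> : - eps < d - eps by lra.
  by rewrite andbF andbT.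
have -> : (eps < d - eps) = false by apply/negbTE; rewrite -leNgt; have := bd_eps_gt0; lra.
have -> : eps - d < eps by lra.
by rewrite andbF andbT orbF.
Qed.

Definition near_tile d a (u : K) : bool := near_pre d a (topquot_repr u).
Lemma near_tileE d a x : 0 < d -> d <= eps -> near_tile d a (pi x) = near_pre d a x.
Proof. by move=> d0 de; apply: topquot_reprE => y z; exact: near_glue. Qed.

Lemma near_tile_nbhs d a u : 0 < d -> d <= eps -> near_tile d a u -> nbhs u (near_tile d a).
Proof.
move=> d0 de; apply: (complex_nbhs (P := near_pre d a)) => [x|x]; first by rewrite near_tileE.
have e0 := bd_eps_gt0.
rewrite /near_pre; case: (lab x) => [a'|[b c]] h; first by exists 1 => // y ->.
have [/andP[/eqP <- t]|/andP[/eqP <- t]] := orP h.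
  exists (param x - (eps - d)); first by lra.
  by move=> y -> ; rewrite ltr_distlC eqxx => ty; apply/orP; left; lra.
exists (d - eps - param x); first by lra.
by move=> y -> ; rewrite ltr_distlC eqxx => ty; apply/orP; right; lra.
Qed.

Lemma inner_nbhs ab t u d : 0 < d -> inner u = Some (ab, t) ->
  nbhs u [set w | exists2 t', inner w = Some (ab, t') & `|t' - t| < d].
Proof.
move=> d0 ut; apply: (complex_nbhs (P := fun x => exists2 t', inner_pre x = Some (ab, t') & `|t' - t| < d)).
- by move=> x; rewrite /= innerE.
- move=> x [t' xt' t'd]; move: xt'; rewrite /inner_pre.
  case lx : (lab x) => [//|cd]; case: ifP => // xe [ecd et]; subst cd t'.
  exists (Num.min (eps - `|param x|) (d - `|param x - t|)).
    by rewrite lt_min !subr_gt0 xe.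
  move=> y -> ; rewrite lt_min => /andP[y1 y2].
  have ye : `|param y| < eps.
    by have := ler_normD (param y - param x) (param x); rewrite subrK; lra.
  exists (param y); first by rewrite ye.
  by have := ler_distD (param x) (param y) t; lra.
- by exists t => //; rewrite subrr normr0.
Qed.

(** Two kinds of charts suffice: the open edges [e_ab], and stars around the closed edges [e_a],
    which contain all vertices. *)
Lemma complex_cases u : (exists ab t, inner u = Some (ab, t)) \/
  (exists a, forall d, 0 < d -> d <= eps -> near_tile d a u).
Proof.
rewrite -(topquot_reprK u); set p := topquot_repr u.
have := param_itv p; have := lab_valid p; rewrite innerE /inner_pre.
case lp : (lab p) => [a|[b c]] /= vp pp.
  right; exists a => d d0 de; rewrite near_tileE // /near_pre lp eqxx //.
case: ifP => [pe|/negbT]; first by left; exists (b, c), (param p).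
rewrite -leNgt => pe; right; have [p0|p0] := leP 0 (param p).
  rewrite ger0_norm // in pe; exists c => d d0 de; rewrite near_tileE // /near_pre lp eqxx.
  by apply/orP; left; rewrite /=; lra.
rewrite ltr0_norm // in pe; exists b => d d0 de; rewrite near_tileE // /near_pre lp eqxx.
by apply/orP; right; rewrite /=; lra.
Qed.

Section crossing.
Context (om : A * A -> int).

(* Crossing the middle of e_ab from left to right contributes om (a, b). *)
Definition crossing (u v : K) : int :=
  match inner u, inner v with
  | Some (ab, t), Some (cd, t') =>
      if (ab == cd) && (`|t - t'| < eps) then om ab * ((0 < t')%R%:R - (0 < t)%R%:R) else 0
  | _, _ => 0
  end.

Lemma crossing_cocycle : as_cocycle crossing.
Proof.
move=> u; have e0 := bd_eps_gt0; have [[ab [t ut]]|[a ua]] := complex_cases u.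
  exists [set w | exists2 t', inner w = Some (ab, t') & `|t' - t| < eps / 2].
    by apply: inner_nbhs => //; lra.
  move=> p q r [tp pE pd] [tq qE qd] [tr rE rd]; rewrite /crossing pE qE rE eqxx /=.
  have h x y : `|x - t| < eps / 2 -> `|y - t| < eps / 2 -> `|x - y| < eps.
    by rewrite !ltr_distlC; lra.
  by rewrite !h //; ring.
(* At radius [eps / 2] the star avoids the middles of the edges. Both ends of a loop [e_aa] lie in
   it, but at distance more than [eps], and the cocycle is 0 on such pairs. *)
exists (near_tile (eps / 2) a).
  by apply: near_tile_nbhs; [lra|lra|apply: ua; lra].
suff z p q : near_tile (eps / 2) a p -> near_tile (eps / 2) a q -> crossing p q = 0.
  by move=> p q r pa qa ra; rewrite !z.
rewrite -(topquot_reprK p) -(topquot_reprK q); set x := topquot_repr p; set y := topquot_repr q.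
rewrite !near_tileE; try by lra.
rewrite /crossing !innerE /inner_pre /near_pre.
case: (lab x) => [//|[b c]]; case: (lab y) => [a'|[b' c']]; first by case: ifP => // ?; case: ifP.
case: ifP => // xe; case: ifP => // ye; case: ifP => // /andP[/eqP[<- <-] xy].
rewrite ltr_distlC in xy.
case/orP=> /andP[_ xt]; case/orP=> /andP[_ yt]; try by exfalso; lra.
  have -> : 0 < param x by lra.
  have -> : 0 < param y by lra.
  by rewrite subrr mulr0.
have -> : (0 < param x) = false by apply/negbTE; rewrite -leNgt; lra.
have -> : (0 < param y) = false by apply/negbTE; rewrite -leNgt; lra.
by rewrite subrr mulr0.
Qed.

Lemma crossing_edge a t t' : crossing (edge_path (vl a) t) (edge_path (vl a) t') = 0.
Proof. by rewrite /crossing !innerE /inner_pre /lab /=. Qed.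

Lemma crossing_potential ab (v : valid (inr ab)) t :
  as_potential (fun p q => crossing (edge_path v p) (edge_path v q))
    (fun t => om ab * (0 < t)%R%:R) t.
Proof.
have e0 := bd_eps_gt0.
exists (ball t (eps / 2)); first by apply: nbhsx_ballx; lra.
move=> p q; rewrite /ball /= !ltr_distlC => tp tq.
have pq : `|p - q| < eps by rewrite ltr_distlC; lra.
have pqr : p - eps < q < p + eps by lra.
have {tp tq} qpr : q - eps < p < q + eps by lra.
rewrite /crossing !innerE /inner_pre /lab /param /=.
(* Beyond the ends of the edge the path rests at a vertex, where [inner] is [None], and the
   potential is constant there too. *)
have out x : ~~ (`|clamp (- eps) eps x| < eps) -> x <= - eps \/ eps <= x.
  apply: contraNP => /not_orP[/negP x1 /negP x2]; rewrite -ltNge in x1; rewrite -ltNge in x2.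
  by rewrite clamp_id ?ltr_norml ?x1 ?x2 // !ltW.
have ins x : `|clamp (- eps) eps x| < eps -> clamp (- eps) eps x = x.
  have [x1|x1] := leP x (- eps).
    have -> : clamp (- eps) eps x = - eps.
      by rewrite /clamp min_r ?max_l //; lra.
    by rewrite normrN gtr0_norm // ltxx.
  have [x2|x2] := leP eps x.
    have -> : clamp (- eps) eps x = eps.
      by rewrite /clamp min_l ?max_r //; lra.
    by rewrite gtr0_norm // ltxx.
  by rewrite clamp_id // !ltW.
have pos (x : R) : 0 < x -> (0 < x)%R%:R = 1 :> int by move=> ->.
have neg (x : R) : x <= 0 -> (0 < x)%R%:R = 0 :> int by rewrite leNgt => /negbTE ->.
case: ifP => [pe|/negbT /out pe]; last first.
  by case: pe => pe; clear out ins; [rewrite !neg|rewrite !pos]; rewrite ?subrr //; lra.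
case: ifP => [qe|/negbT /out qe]; last first.
  by case: qe => qe; clear out ins; [rewrite !neg|rewrite !pos]; rewrite ?subrr //; lra.
rewrite eqxx (ins _ pe) (ins _ qe).
rewrite pq.
by rewrite mulrBr.
Qed.

End crossing.

End barge_diamond.

(** * Singular classes and the weights of edges *)

Section barge_diamond_cohomology.
Context (R : realType) (A : finType) (k : nat) (F : 'I_k.+1 -> substitution A).
Local Notation eps := (bd_eps R F).
Context (s : nat -> 'I_k.+1).
Local Notation E := (set_type (@bd_edges R A k F s)).
Local Notation K := (bd_complex R F s).
Local Notation label := (A + A * A)%type.
Local Notation pi := (topquot_pi (@bd_glue R A k F s)).
Local Notation valid := (valid F s).
Local Notation lo := (@lo R A k F).
Local Notation hi := (@hi R A k F).
Local Notation edge_path := (@edge_path R A k F s _).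
Local Notation vl := (@vl A k F s).
Local Notation inner := (@inner R A k F s).
Local Notation near_tile := (@near_tile R A k F s).
Implicit Types (z : Z1 (sing R K)).

Definition edge_int z (l : label) (t0 t1 : R) : int :=
  if pselect (valid l) is left v then val z (path_seg (edge_path v) t0 t1) else 0.

Definition weight z l := edge_int z l (lo l) (hi l).

Lemma edge_intE z l (v : valid l) t0 t1 :
  edge_int z l t0 t1 = val z (path_seg (edge_path v) t0 t1).
Proof. by rewrite /edge_int; case: pselect => // v'; rewrite (Prop_irrelevance v' v). Qed.

Lemma edge_int_add z l t0 t1 t2 :
  edge_int z l t0 t1 + edge_int z l t1 t2 = edge_int z l t0 t2.
Proof. by rewrite /edge_int; case: pselect => [v|_]; rewrite ?sing_path_add ?addr0. Qed.

Lemma edge_int_cst z l t : edge_int z l t t = 0.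
Proof. by have := edge_int_add z l t t t; lra. Qed.

(** Obtained by integrating [crossing], whose potential along [e_ab] jumps by [om ab] in the middle
    of the edge and whose values along the [e_a] vanish. *)
Lemma weight_realise (om : A * A -> int) : exists z,
  (forall a, weight z (inl a) = 0) /\
  (forall ab, valid (inr ab) -> weight z (inr ab) = om ab).
Proof.
exists (as_sing R (@crossing_cocycle R A k F s om)); split=> [a|ab v].
  rewrite /weight (edge_intE _ (vl a))
    (@as_sing_path R K _ (@crossing_cocycle R A k F s om) (edge_path (vl a)) _ _ (fun=> 0)) ?subrr //.
    exact: (lo_le_hi R F (inl a)).
  move=> t _; exists setT; first exact: filterT.
  by move=> p q _ _; rewrite crossing_edge.
have e0 := bd_eps_gt0 R F.
rewrite /weight (edge_intE _ v) (@as_sing_path R K _ (@crossing_cocycle R A k F s om)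
  (edge_path v) _ _ (fun t => om ab * (0 < t)%R%:R)).
- have -> : (0 < hi (inr ab)) = true by [].
  have -> : (0 < lo (inr ab)) = false by apply/negbTE; rewrite -leNgt /=; lra.
  by rewrite mulr1 mulr0 subr0.
- exact: (lo_le_hi R F (inr ab)).
- by move=> t _; exact: crossing_potential.
Qed.

(** It falls from 1 to 0 in the middle of each [e_ab], a point which no [near_tile eps a]
    contains. *)
Definition coord_pre (p : E) : R :=
  if lab p is inr _ then if 0 < param p then param p else 1 + param p else param p.

Lemma coord_glue x y : bd_glue x y -> coord_pre x = coord_pre y.
Proof.
have e0 := bd_eps_gt0 R F.
apply: glue_inv => {x y} [a b x y|a b x y]; rewrite /coord_pre => -> -> -> ->.
  by have -> : (0 < - eps) = false by apply/negbTE; rewrite -leNgt; lra.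
by rewrite e0.
Qed.

(* The coordinate on the neighbourhood of e_a, extending that of e_a. *)
Definition tile_coord (u : K) : R := coord_pre (topquot_repr u).
Lemma tile_coordE x : tile_coord (pi x) = coord_pre x.
Proof. exact: topquot_reprE coord_glue. Qed.

Lemma tile_coord_continuous a u : near_tile eps a u -> {for u, continuous tile_coord}.
Proof.
move=> ua V /nbhs_ballP[d d0 dV]; have e0 := bd_eps_gt0 R F.
apply: (@filterS _ _ _ [set w | near_tile eps a w /\ `|tile_coord w - tile_coord u| < d]).
  by move=> w [_ h]; apply: dV; rewrite /ball /= distrC.
apply: (complex_nbhs (P := fun x => near_pre eps a x /\ `|coord_pre x - tile_coord u| < d)).
- by move=> x; rewrite /= tile_coordE near_tileE.
- move=> x []; rewrite /near_pre /coord_pre; case: (lab x) => [a'|[b c]] h xd.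
    exists (d - `|param x - tile_coord u|); first by rewrite subr_gt0.
    move=> y -> yx; split=> //.
    by have := ler_distD (param x) (param y) (tile_coord u); lra.
  have [/andP[/eqP ca tx]|/andP[/eqP ba tx]] := orP h.
    rewrite ifT in xd; last by lra.
    exists (Num.min (param x) (d - `|param x - tile_coord u|)).
      by rewrite lt_min subr_gt0 xd andbT; lra.
    move=> y ->; rewrite lt_min => /andP[y1 y2]; rewrite ltr_distlC in y1.
    have y0 : 0 < param y by lra.
    rewrite y0 ca eqxx; split; first by apply/orP; left; rewrite /=; lra.
    by have := ler_distD (param x) (param y) (tile_coord u); lra.
  rewrite ifF in xd; last by apply/negbTE; rewrite -leNgt; lra.
  exists (Num.min (- param x) (d - `|1 + param x - tile_coord u|)).
    by rewrite lt_min subr_gt0 xd andbT; lra.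
  move=> y ->; rewrite lt_min => /andP[y1 y2].
  have y0 : param y < 0 by rewrite ltr_distlC in y1; lra.
  have -> : (0 < param y) = false by apply/negbTE; rewrite -leNgt; lra.
  rewrite ba eqxx; split; first by apply/orP; right; rewrite /=; lra.
  have := ler_distD (1 + param x) (1 + param y) (tile_coord u).
  by rewrite (_ : 1 + param y - (1 + param x) = param y - param x); [lra|ring].
- by split=> //; rewrite subrr normr0.
Qed.

Lemma near_tile_cases a u : near_tile eps a u ->
  [\/ eps <= tile_coord u <= 1 - eps /\ u = edge_path (vl a) (tile_coord u),
      exists b (v : valid (inr (b, a))), [/\ 0 < tile_coord u < eps,
        u = edge_path v (tile_coord u) & inner u = Some ((b, a), tile_coord u)] |
      exists c (v : valid (inr (a, c))), [/\ 1 - eps < tile_coord u < 1,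
        u = edge_path v (tile_coord u - 1) &
        inner u = Some ((a, c), tile_coord u - 1)]].
Proof.
have e0 := bd_eps_gt0 R F; have e1 := bd_eps_le_half R F.
rewrite -(topquot_reprK u); set p := topquot_repr u.
have := param_itv p; have := lab_valid p.
rewrite near_tileE // tile_coordE innerE /near_pre /coord_pre /inner_pre.
case lp : (lab p) => [a'|[b c]] vp pp.
  move/eqP=> ?; subst a'; constructor 1; split; first exact: pp.
  by rewrite (edge_path_eq (vl a) lp).
rewrite /= in pp; case/orP=> /andP[/eqP ? tp].
  subst c; have p0 : 0 < param p by lra.
  rewrite p0 gtr0_norm //; have [pe|pe] := ltP (param p) eps.
    by constructor 2; exists b, vp; split=> //; [rewrite p0|rewrite (edge_path_eq vp lp)].
  have pE : param p = eps by lra.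
  constructor 1; rewrite pE; split; first by lra.
  by rewrite (edge_glue_right R vp) -pE (edge_path_eq vp lp).
subst b; have p0 : param p < 0 by lra.
have -> : (0 < param p) = false by apply/negbTE; rewrite -leNgt ltW.
rewrite ltr0_norm // [1 + _]addrC addrK.
have [pe|pe] := ltP (- param p) eps.
  constructor 3; exists c, vp; split=> //; first by lra.
  by rewrite (edge_path_eq vp lp).
have pE : param p = - eps by lra.
constructor 1; rewrite pE addrC; split; first by lra.
by rewrite (edge_glue_left R vp) -pE (edge_path_eq vp lp).
Qed.

Section coboundary.
Context (z : Z1 (sing R K)) (Hm Hp : A -> int).

(** [Hm a] and [Hp a] are the heights prescribed at the left and right ends of [e_a]; the edge
    [e_ab] runs from the right end of [e_a] to the left end of [e_b]. *)
Definition base (l : label) : int := match l with inl a => Hm a | inr ab => Hp ab.1 end.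
Definition tip (l : label) : int := match l with inl a => Hp a | inr ab => Hm ab.2 end.

Hypothesis weight_z : forall l, valid l -> weight z l = tip l - base l.

Definition height_pre (p : E) : int := base (lab p) + edge_int z (lab p) (lo (lab p)) (param p).

Lemma height_glue x y : bd_glue x y -> height_pre x = height_pre y.
Proof.
apply: glue_inv => {x y} [a b x y|a b x y] lx px ly py.
  rewrite /height_pre lx px ly py edge_int_cst addr0.
  by have := weight_z (vl a); rewrite /weight /= => ->; ring.
have v : valid (inr (a, b)) by have := lab_valid y; rewrite ly.
rewrite /height_pre lx px ly py edge_int_cst addr0.
by have := weight_z v; rewrite /weight /= => ->; ring.
Qed.

Definition height (u : K) : int := height_pre (topquot_repr u).
Lemma heightE x : height (pi x) = height_pre x.
Proof. exact: topquot_reprE height_glue. Qed.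

Lemma height_edge l (v : valid l) t0 t1 : lo l <= t0 <= hi l -> lo l <= t1 <= hi l ->
  val z (path_seg (edge_path v) t0 t1) = height (edge_path v t1) - height (edge_path v t0).
Proof.
move=> h0 h1; rewrite -(edge_intE _ v) !heightE /height_pre /lab /param /=.
by rewrite !clamp_id // -(edge_int_add z l (lo l) t0 t1); ring.
Qed.

(* Total version of edge_path: on invalid labels, the value on e_a is junk. *)
Definition walk a (l : label) t : K :=
  if pselect (valid l) is left v then edge_path v t else edge_path (vl a) t.

Lemma walkE a l (v : valid l) t : walk a l t = edge_path v t.
Proof. by rewrite /walk; case: pselect => // v'; rewrite (Prop_irrelevance v' v). Qed.

Definition radial (p : K * R) : R := 2^-1 + clamp 0 1 p.2 * (tile_coord p.1 - 2^-1).

(* Contraction of near_tile eps a to the midpoint of e_a. The whisker containing u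
   is recovered from inner u. *)
Definition contract a (u : K) (t : R) : K :=
  let r := radial (u, t) in
  if r < eps then
    if inner u is Some (ab, _) then walk a (inr ab) r else edge_path (vl a) r
  else if 1 - eps < r then
    if inner u is Some (ab, _) then walk a (inr ab) (r - 1) else edge_path (vl a) r
  else edge_path (vl a) r.

Lemma radial_continuous a u t : near_tile eps a u -> {for (u, t), continuous radial}.
Proof.
move=> ua; have cc : {for (u, t), continuous (fun p : K * R => clamp 0 1 p.2)}.
  by apply: (@continuous_comp _ _ _ snd (clamp 0 1)); [exact: cvg_snd|exact: clamp_continuous].
have tc : {for (u, t), continuous (fun p : K * R => tile_coord p.1)}.
  apply: (@continuous_comp _ _ _ fst tile_coord); first exact: cvg_fst.
  exact: tile_coord_continuous ua.
have : {for (u, t), continuous (fun p : K * R => 2^-1 + clamp 0 1 p.2 * (tile_coord p.1 - 2^-1))}.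
  apply: cvgD; first exact: cvg_cst.
  by apply: cvgM; [exact: cc|apply: cvgB; [exact: tc|exact: cvg_cst]].
by [].
Qed.

Lemma radial_between u t : 2^-1 <= radial (u, t) <= tile_coord u \/
  tile_coord u <= radial (u, t) <= 2^-1.
Proof.
rewrite /radial /=; have /andP[c0 c1] := @clamp_itv R 0 1 t ler01.
move: (clamp 0 1 t) c0 c1 => x x0 x1; set c := tile_coord u.
have [c2|c2] := leP 2^-1 c; [left|right].
  have : 0 <= x * (c - 2^-1) by rewrite mulr_ge0 // subr_ge0.
  have : x * (c - 2^-1) <= c - 2^-1 by rewrite ler_piMl // subr_ge0.
  by move=> *; apply/andP; split; lra.
have : 0 <= x * (2^-1 - c) by rewrite mulr_ge0 // subr_ge0 ltW.
have : x * (2^-1 - c) <= 2^-1 - c by rewrite ler_piMl // subr_ge0 ltW.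
have -> : x * (c - 2^-1) = - (x * (2^-1 - c)) by ring.
by move=> *; apply/andP; split; lra.
Qed.

Lemma contract_continuous a u t : near_tile eps a u ->
  {for (u, t), continuous (fun p : K * R => contract a p.1 p.2)}.
Proof.
move=> ua W; have e0 := bd_eps_gt0 R F; have e1 := bd_eps_le_half R F.
have rc := radial_continuous (t := t) ua.
have fstn (V : set K) : nbhs u V -> nbhs (u, t) [set p : K * R | V p.1].
  by move=> uV; exists (V, setT) => [|p []//]; split=> //; exact: filterT.
rewrite {1}/contract; set r0 := radial (u, t) => hW.
change (nbhs (u, t) [set p : K * R | W (contract a p.1 p.2)]).
(* Three regimes: in a whisker [e_ba], in a whisker [e_ac], and on the closed [e_a]. In the first
   two, [inner] names the same whisker at all nearby points. *)
have [r0e|r0e] := ltP r0 eps.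
  rewrite r0e in hW.
  have ce : tile_coord u < eps by have := radial_between u t; rewrite -/r0; case; lra.
  have [[h _]|[b [v [_ _ iu]]]|[c [v [h _ _]]]] := near_tile_cases ua;
    [by exfalso; lra| |by exfalso; lra].
  rewrite iu (walkE _ v) in hW.
  have n1 : nbhs r0 (edge_path v @^-1` W) := @cts_fun _ _ (edge_path v) r0 W hW.
  have n2 : nbhs (u, t) [set p | W (edge_path v (radial p)) /\ radial p < eps].
    apply: (rc [set r | W (edge_path v r) /\ r < eps]).
    exact: filterI n1 (lt_nbhsl r0e).
  have n3 := fstn _ (inner_nbhs (ltr01 : 0 < 1 :> R) iu).
  apply: filterS (filterI n2 n3) => -[w t'] [[Ww re] [t2 iw _]].
  change (inner w = Some ((b, a), t2)) in iw.
  change (W (contract a w t')).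
  by rewrite /contract re iw (walkE _ v).
rewrite ltNge r0e /= in hW.
have [r1e|r1e] := ltP (1 - eps) r0.
  rewrite r1e in hW.
  have ce : 1 - eps < tile_coord u by have := radial_between u t; rewrite -/r0; case; lra.
  have [[h _]|[b [v [h _ _]]]|[c [v [_ _ iu]]]] := near_tile_cases ua;
    [by exfalso; lra|by exfalso; lra|].
  rewrite iu (walkE _ v) in hW.
  have n1 : nbhs r0 [set r | W (edge_path v (r - 1))].
    apply: (@continuous_comp _ _ _ (fun r : R => r - 1) (edge_path v)); last exact: hW.
      by apply: cvgB; [exact: cvg_id|exact: cvg_cst].
    exact: cts_fun.
  have n2 : nbhs (u, t) [set p | W (edge_path v (radial p - 1)) /\ 1 - eps < radial p].
    apply: (rc [set r | W (edge_path v (r - 1)) /\ 1 - eps < r]).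
    exact: filterI n1 (lt_nbhsr r1e).
  have n3 := fstn _ (inner_nbhs (ltr01 : 0 < 1 :> R) iu).
  apply: filterS (filterI n2 n3) => -[w t'] [[Ww re] [t2 iw _]].
  have re' : (radial (w, t') < eps) = false.
    by apply/negbTE; rewrite -leNgt; apply: le_trans (ltW re); lra.
  change (inner w = Some ((a, c), t2)) in iw.
  change (W (contract a w t')).
  by rewrite /contract re' re iw (walkE _ v).
rewrite ltNge r1e /= in hW.
have n0 : nbhs r0 (edge_path (vl a) @^-1` W) := @cts_fun _ _ (edge_path (vl a)) r0 W hW.
(* At the branch point [r0 = eps] nearby tracks may enter any edge [e_ba]; there are finitely many,
   so one neighbourhood of [eps] serves all. *)
have n1 : nbhs r0 [set r | r < eps -> forall b (v : valid (inr (b, a))), W (edge_path v r)].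
  have [r0E|r0N] := eqVneq r0 eps; last first.
    have er0 : eps < r0 by rewrite lt_neqAle eq_sym r0N.
    by apply: filterS (lt_nbhsr er0) => r /= er re; exfalso; lra.
  suff h : nbhs r0 [set r | forall b, forall v : valid (inr (b, a)), W (edge_path v r)].
    by apply: filterS h => r h _.
  apply: (@nbhs_forall R A r0 (fun b => [set r | forall v : valid (inr (b, a)), W (edge_path v r)])).
  move=> b; have [v|nv] := pselect (valid (inr (b, a))); last first.
    by apply: filterE => r v; case: nv.
  have : nbhs r0 (edge_path v @^-1` W).
    apply: (@cts_fun _ _ (edge_path v) r0); rewrite r0E -edge_glue_right -r0E; exact: hW.
  by apply: filterS => r Wr v'; rewrite (Prop_irrelevance v' v).
have n2 : nbhs r0 [set r | 1 - eps < r -> forall c (v : valid (inr (a, c))), W (edge_path v (r - 1))].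
  have [r0E|r0N] := eqVneq r0 (1 - eps); last first.
    have er0 : r0 < 1 - eps by rewrite lt_neqAle r0N.
    by apply: filterS (lt_nbhsl er0) => r /= er re; exfalso; lra.
  suff h : nbhs r0 [set r | forall c, forall v : valid (inr (a, c)), W (edge_path v (r - 1))].
    by apply: filterS h => r h _.
  apply: (@nbhs_forall R A r0 (fun c => [set r | forall v : valid (inr (a, c)), W (edge_path v (r - 1))])).
  move=> c; have [v|nv] := pselect (valid (inr (a, c))); last first.
    by apply: filterE => r v; case: nv.
  have : nbhs r0 [set r | W (edge_path v (r - 1))].
    apply: (@continuous_comp _ _ _ (fun r : R => r - 1) (edge_path v)).
    - by apply: cvgB; [exact: cvg_id|exact: cvg_cst].
    - exact: cts_fun.
    - change (nbhs (edge_path v (r0 - 1)) W).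
      have -> : r0 - 1 = - eps by rewrite r0E; ring.
      by rewrite -edge_glue_left -r0E; exact: hW.
  by apply: filterS => r Wr v'; rewrite (Prop_irrelevance v' v).
have n3 : nbhs (u, t) [set p | W (edge_path (vl a) (radial p)) /\
    ((radial p < eps -> forall b (v : valid (inr (b, a))), W (edge_path v (radial p))) /\
     (1 - eps < radial p -> forall c (v : valid (inr (a, c))), W (edge_path v (radial p - 1))))].
  apply: (rc [set r | W (edge_path (vl a) r) /\
    ((r < eps -> forall b (v : valid (inr (b, a))), W (edge_path v r)) /\
     (1 - eps < r -> forall c (v : valid (inr (a, c))), W (edge_path v (r - 1))))]).
  exact: filterI n0 (filterI n1 n2).
have n4 := fstn _ (near_tile_nbhs e0 (lexx eps) ua).
apply: filterS (filterI n3 n4) => -[w t'] [[w0 [w1 w2]] wa].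
change (is_true (near_tile eps a w)) in wa.
change (W (contract a w t')).
rewrite /contract.
case: ifP => [re|_].
  have ce : tile_coord w < eps by have := radial_between w t'; case; lra.
  have [[h _]|[b [v [_ _ iw]]]|[c [v [h _ _]]]] := near_tile_cases wa;
    [by exfalso; lra| |by exfalso; lra].
  by rewrite iw (walkE _ v); exact: w1.
case: ifP => [re|_]; last exact: w0.
have ce : 1 - eps < tile_coord w by have := radial_between w t'; case; lra.
have [[h _]|[b [v [h _ _]]]|[c [v [_ _ iw]]]] := near_tile_cases wa;
    [by exfalso; lra|by exfalso; lra|].
by rewrite iw (walkE _ v); exact: w2.
Qed.

Lemma contract_mid a u t : eps <= radial (u, t) <= 1 - eps ->
  contract a u t = edge_path (vl a) (radial (u, t)).
Proof. by move=> /andP[h1 h2]; rewrite /contract ltNge h1 /= ltNge h2. Qed.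

Lemma contract_low a b (v : valid (inr (b, a))) u t t' : inner u = Some ((b, a), t') ->
  radial (u, t) <= eps -> contract a u t = edge_path v (radial (u, t)).
Proof.
move=> iu; rewrite le_eqVlt => /orP[/eqP re|re]; last by rewrite /contract re iu (walkE _ v).
have e1 := bd_eps_le_half R F; rewrite contract_mid; first by rewrite re; exact: edge_glue_right.
by rewrite re; apply/andP; split; lra.
Qed.

Lemma contract_high a c (v : valid (inr (a, c))) u t t' : inner u = Some ((a, c), t') ->
  1 - eps <= radial (u, t) -> contract a u t = edge_path v (radial (u, t) - 1).
Proof.
have e1 := bd_eps_le_half R F; move=> iu; rewrite le_eqVlt => /orP[/eqP re|re]; last first.
  rewrite /contract ifF; first by rewrite re iu (walkE _ v).
  by apply/negbTE; rewrite -leNgt; apply: le_trans (ltW re); lra.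
rewrite contract_mid; last by rewrite -re; apply/andP; split; lra.
rewrite -re (_ : 1 - eps - 1 = - eps); last by ring.
exact: edge_glue_left.
Qed.

Lemma track_edge l (v : valid l) (d : continuousType R K) s0 s1 p q :
  lo l <= p <= hi l -> lo l <= q <= hi l ->
  (forall t, 0 <= t <= 1 -> d (s0 * (1 - t) + s1 * t) = edge_path v (p * (1 - t) + q * t)) ->
  val z (path_seg d s0 s1) = height (edge_path v q) - height (edge_path v p).
Proof. by move=> hp hq h; rewrite (path_seg_eq h) height_edge. Qed.

Lemma contract_track a u (d : continuousType R K) : near_tile eps a u ->
  (forall t, 0 <= t <= 1 -> d t = contract a u t) ->
  val z (path_seg d 0 1) = height u - height (edge_path (vl a) 2^-1).
Proof.
move=> ua hd; have e0 := bd_eps_gt0 R F; have e1 := bd_eps_le_half R F.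
have rE t : 0 <= t <= 1 -> radial (u, t) = 2^-1 + t * (tile_coord u - 2^-1).
  by move=> t01; rewrite /radial /= clamp_id.
have h2 : eps <= 2^-1 <= 1 - eps by apply/andP; split; lra.
have mid t : 0 <= t <= 1 -> eps <= 2^-1 + t * (tile_coord u - 2^-1) <= 1 - eps ->
    d t = edge_path (vl a) (2^-1 + t * (tile_coord u - 2^-1)).
  by move=> t01 h; rewrite hd // contract_mid rE.
have [[cE uE]|[b [v [cE uE iu]]]|[c [v [cE uE iu]]]] := near_tile_cases ua.
- move: rE mid uE cE; set c := tile_coord u => rE mid uE cE.
  rewrite [in height u]uE; apply: track_edge => // t t01.
  have -> : 0 * (1 - t) + 1 * t = t by ring.
  have := radial_between u t; rewrite rE // -/c => rb.
  rewrite mid //; last by case/andP: cE => *; apply/andP; split; lra.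
  by congr (edge_path _ _); ring.
- move: rE mid uE cE; set c := tile_coord u => rE mid uE /andP[c0 ce].
  have c2 : 2^-1 - c != 0 by rewrite gt_eqF // subr_gt0; lra.
  (* The time at which the track passes the branch point; before and after it, the track runs
     affinely in a single edge. *)
  pose m := (2^-1 - eps) / (2^-1 - c).
  have mE : m * (c - 2^-1) = eps - 2^-1 by rewrite -[c - _]opprB mulrN /m divfK // opprB.
  have m0 : 0 <= m by rewrite /m divr_ge0 //; lra.
  have m1 : m <= 1 by rewrite /m ler_pdivrMr ?mul1r; lra.
  rewrite -(sing_path_add z d 0 m 1).
  rewrite (@track_edge (inl a) (vl a) d 0 m 2^-1 eps) //; last 2 first.
  + by apply/andP; split; rewrite /=; lra.
  + move=> t /andP[t0 t1].
    have mt : m * (1 - t) = m - m * t by ring.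
    have mt0 : 0 <= m * t by rewrite mulr_ge0.
    have mt1 : 0 <= m * (1 - t) by rewrite mulr_ge0 // subr_ge0.
    have E : 2^-1 + (0 * (1 - t) + m * t) * (c - 2^-1) = 2^-1 * (1 - t) + eps * t.
      by have := congr1 (fun x => t * x) mE; rewrite /= => mE'; lra.
    have et : eps <= 2^-1 * (1 - t) + eps * t <= 1 - eps.
      have : 0 <= (2^-1 - eps) * (1 - t) by rewrite mulr_ge0 // subr_ge0.
      have : 0 <= (2^-1 - eps) * t by rewrite mulr_ge0 // subr_ge0.
      by move=> *; apply/andP; split; lra.
    rewrite -E; apply: mid; first by apply/andP; split; lra.
    by rewrite E.
  rewrite (@track_edge _ v d m 1 eps c) //; last 3 first.
  + by apply/andP; split; rewrite /=; lra.
  + by apply/andP; split; rewrite /=; lra.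
  + move=> t /andP[t0 t1].
    have mt : m * (1 - t) = m - m * t by ring.
    have mt0 : 0 <= m * (1 - t) by rewrite mulr_ge0 // subr_ge0.
    have mt1 : 0 <= (1 - m) * (1 - t) by rewrite mulr_ge0 // subr_ge0.
    have E : 2^-1 + (m * (1 - t) + 1 * t) * (c - 2^-1) = eps * (1 - t) + c * t.
      by have := congr1 (fun x => (1 - t) * x) mE; rewrite /= => mE'; lra.
    have t01' : 0 <= m * (1 - t) + 1 * t <= 1 by apply/andP; split; lra.
    rewrite hd // (contract_low v iu) rE // E //.
    have : 0 <= (eps - c) * t by rewrite mulr_ge0 // subr_ge0 ltW.
    by move=> *; lra.
  by rewrite -uE (edge_glue_right R v); ring.
- move: rE mid uE cE; set c' := tile_coord u => rE mid uE /andP[c0 ce].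
  have c2 : c' - 2^-1 != 0 by rewrite gt_eqF // subr_gt0; lra.
  pose m := (2^-1 - eps) / (c' - 2^-1).
  have mE : m * (c' - 2^-1) = 2^-1 - eps by rewrite /m divfK.
  have m0 : 0 <= m by rewrite /m divr_ge0 //; lra.
  have m1 : m <= 1 by rewrite /m ler_pdivrMr ?mul1r; lra.
  rewrite -(sing_path_add z d 0 m 1).
  rewrite (@track_edge (inl a) (vl a) d 0 m 2^-1 (1 - eps)) //; last 2 first.
  + by apply/andP; split; rewrite /=; lra.
  + move=> t /andP[t0 t1].
    have mt : m * (1 - t) = m - m * t by ring.
    have mt0 : 0 <= m * t by rewrite mulr_ge0.
    have mt1 : 0 <= m * (1 - t) by rewrite mulr_ge0 // subr_ge0.
    have E : 2^-1 + (0 * (1 - t) + m * t) * (c' - 2^-1) = 2^-1 * (1 - t) + (1 - eps) * t.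
      by have := congr1 (fun x => t * x) mE; rewrite /= => mE'; lra.
    have et : eps <= 2^-1 * (1 - t) + (1 - eps) * t <= 1 - eps.
      have : 0 <= (2^-1 - eps) * (1 - t) by rewrite mulr_ge0 // subr_ge0.
      have : 0 <= (2^-1 - eps) * t by rewrite mulr_ge0 // subr_ge0.
      by move=> *; apply/andP; split; lra.
    rewrite -E; apply: mid; first by apply/andP; split; lra.
    by rewrite E.
  rewrite (@track_edge _ v d m 1 (- eps) (c' - 1)) //; last 3 first.
  + by apply/andP; split; rewrite /=; lra.
  + by apply/andP; split; rewrite /=; lra.
  + move=> t /andP[t0 t1].
    have mt : m * (1 - t) = m - m * t by ring.
    have mt0 : 0 <= m * (1 - t) by rewrite mulr_ge0 // subr_ge0.
    have mt1 : 0 <= (1 - m) * (1 - t) by rewrite mulr_ge0 // subr_ge0.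
    have E : 2^-1 + (m * (1 - t) + 1 * t) * (c' - 2^-1) = 1 + (- eps * (1 - t) + (c' - 1) * t).
      by have := congr1 (fun x => (1 - t) * x) mE; rewrite /= => mE'; lra.
    have t01' : 0 <= m * (1 - t) + 1 * t <= 1 by apply/andP; split; lra.
    have ct : 0 <= (c' - 1 + eps) * t by rewrite mulr_ge0 //; lra.
    rewrite hd // (contract_high v iu) rE // E //; last by lra.
    by congr (edge_path _ _); ring.
  by rewrite -uE (edge_glue_left R v); ring.
Qed.

Lemma contract_at0 a u : contract a u 0 = edge_path (vl a) 2^-1.
Proof.
have e1 := bd_eps_le_half R F.
have r0 : radial (u, 0) = 2^-1 by rewrite /radial /= clamp_id ?lexx ?ler01 // mul0r addr0.
by rewrite contract_mid r0 //; apply/andP; split; lra.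
Qed.

Lemma contract_at1 a u : near_tile eps a u -> contract a u 1 = u.
Proof.
move=> ua; have r1 : radial (u, 1) = tile_coord u.
  by rewrite /radial /= clamp_id ?lexx ?ler01 // mul1r addrC subrK.
have [[cE uE]|[b [v [cE uE iu]]]|[c [v [cE uE iu]]]] := near_tile_cases ua.
- by rewrite contract_mid r1.
- by rewrite (contract_low v iu) r1 //; case/andP: cE => _ /ltW.
- by rewrite (contract_high v iu) r1 //; case/andP: cE => /ltW.
Qed.

Definition shrink ab (u : K) (t : R) : K :=
  walk ab.1 (inr ab) (clamp 0 1 t * (if inner u is Some (_, t') then t' else 0)).

Lemma inner_coord_continuous u ab t : inner u = Some (ab, t) ->
  {for u, continuous (fun w => if inner w is Some (_, t') then t' else 0 : R)}.
Proof.
move=> iu V; rewrite iu => /nbhs_ballP[d d0 dV].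
apply: filterS (inner_nbhs d0 iu) => w [t' iw td] /=; rewrite iw; apply: dV.
by rewrite /ball /= distrC.
Qed.

Lemma inner_cases u ab t : inner u = Some (ab, t) ->
  exists v : valid (inr ab), u = edge_path v t /\ `|t| < eps.
Proof.
rewrite -(topquot_reprK u); set p := topquot_repr u; rewrite innerE /inner_pre.
have := lab_valid p; case lp : (lab p) => [//|cd] v; case: ifP => // pe [? ?]; subst cd t.
by exists v; rewrite (edge_path_eq v lp).
Qed.

(** The hypothesis on the weights is what makes [height] well defined. It is locally a primitive of
    [z], since stars and open edges contract to a point along tracks made of pieces of edges. *)
Lemma graph_coboundary : \pi_(H1 (sing R K)) z = 0.
Proof.
apply: (@sing_path_local R K z height) => u.
have e0 := bd_eps_gt0 R F; have e1 := bd_eps_le_half R F.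
have [[ab [t iu]]|[a ua]] := complex_cases u; last first.
  exists (near_tile eps a); first exact: near_tile_nbhs (ua eps e0 (lexx eps)).
  apply: (@sing_path_contract R K z height (near_tile eps a) (contract a) (edge_path (vl a) 2^-1)).
  - by move=> x t xa _; exact: contract_continuous.
  - by move=> x xa; exact: contract_at1.
  - by move=> x _; exact: contract_at0.
  - by move=> x d xa hd; exact: contract_track.
have [v _] := inner_cases iu.
(* All coordinates are below [eps <= 1/2] in absolute value, so the radius 1 gives the whole open
   edge. *)
exists [set w | exists2 t', inner w = Some (ab, t') & `|t' - t| < 1].
  exact: inner_nbhs iu.
apply: (@sing_path_contract R K z height _ (shrink ab) (edge_path v 0)).
- move=> x r [t' ix _] _.
  have -> : (fun p : K * R => shrink ab p.1 p.2) =
      edge_path v \o (fun p : K * R => clamp 0 1 p.2 * (if inner p.1 is Some (_, t') then t' else 0)).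
    by apply/funext => p; rewrite /shrink (walkE _ v).
  apply: continuous_comp; last exact: cts_fun.
  apply: cvgM.
    by apply: (@continuous_comp _ _ _ snd (clamp 0 1)); [exact: cvg_snd|exact: clamp_continuous].
  apply: (@continuous_comp _ _ _ fst (fun w => if inner w is Some (_, t') then t' else 0)).
    exact: cvg_fst.
  exact: inner_coord_continuous ix.
- move=> x [t' ix _]; have [v' [xE _]] := inner_cases ix.
  by rewrite /shrink ix (walkE _ v') clamp_id ?lexx ?ler01 // mul1r -xE.
- by move=> x [t' ix _]; rewrite /shrink (walkE _ v) clamp_id ?lexx ?ler01 // mul0r.
- move=> x d [t' ix _] hd; have [v' [xE te]] := inner_cases ix.
  rewrite (Prop_irrelevance v' v) in xE; rewrite ltr_norml in te.
  rewrite [in height x]xE; apply: track_edge => [||r r01].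
  + by apply/andP; split; rewrite /=; lra.
  + by case/andP: te => *; apply/andP; split; rewrite /=; lra.
  + have -> : 0 * (1 - r) + 1 * r = r by ring.
    rewrite hd // /shrink ix (walkE _ v) clamp_id //.
    by congr (edge_path _ _); ring.
Qed.

End coboundary.

End barge_diamond_cohomology.

(** * The cellular maps *)

Section cellular_map.
Context (R : realType) (A : finType) (k : nat) (F : 'I_k.+1 -> substitution A).
Local Notation eps := (bd_eps R F).
Context (s : nat -> 'I_k.+1) (i : nat).
Local Notation KB := (bd_complex R F (sshift i.+1 s)).
Local Notation KA := (bd_complex R F (sshift i s)).
Local Notation validA := (valid F (sshift i s)).
Local Notation validB := (valid F (sshift i.+1 s)).
Local Notation pathA := (@edge_path R A k F (sshift i s) _).
Local Notation pathB := (@edge_path R A k F (sshift i.+1 s) _).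
Local Notation vlA := (@vl A k F (sshift i s)).
Local Notation vlB := (@vl A k F (sshift i.+1 s)).
Local Notation sub := (F (s i)).

Context (g : continuousType KB KA) (hg : is_bd_map g).

Lemma bd_map_cross a b (v : validB (inr (a, b))) :
  exists v' : validA (inr (last a (sub a), head b (sub b))),
    forall t, g (pathB v t) = pathA v' t.
Proof.
have key t := hg (edge_point v t).
(* That the pair occurs is read off from an image point, which lies on an existing edge. *)
have v' : validA (inr (last a (sub a), head b (sub b))).
  by have [q qE _] := key 0; have := lab_valid q; rewrite /lab qE.
exists v' => t; have [q qE ->] := key t.
by congr (topquot_pi _ _); apply: val_inj; rewrite /= qE.
Qed.

Section tile_image.
Context (a : A).
Local Notation w := (sub a).
Local Notation n := (size (sub a)).

(** Inverse of the stretching factor in [bd_image]. It degenerates for [eps = 1/2], where the [e_a]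
    are points; hence [eps_half] below. *)
Definition rate : R := (1 - 2 * eps) / (n%:R - 2 * eps).

Lemma tile_image_continuous : continuous (fun u => g (pathB (vlB a) (eps + (u - eps) * rate))).
Proof.
move=> u; apply: (@continuous_comp _ _ _ (fun u => eps + (u - eps) * rate) (g \o pathB (vlB a))).
  apply: cvgD; first exact: cvg_cst.
  by apply: cvgM; [apply: cvgB; [exact: cvg_id|exact: cvg_cst]|exact: cvg_cst].
by apply: continuous_comp; exact: cts_fun.
Qed.

(* The image of e_a, parametrised by [eps, n - eps] where n = |phi(a)|. *)
Definition tile_image : continuousType R KA := continuous_of tile_image_continuous.

Hypothesis eps_half : eps < 2^-1.

Lemma size_ge1 : 1 <= n%:R :> R.
Proof. by rewrite ler1n lt0n size_eq0 subst_neq0. Qed.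

Lemma tile_image_cases u : eps <= u <= n%:R - eps ->
  (exists j, [/\ (j < n)%N, eps <= u - j%:R <= 1 - eps &
     tile_image u = pathA (vlA (nth a w j)) (u - j%:R)]) \/
  (exists j (v : validA (inr (nth a w j, nth a w j.+1))),
     [/\ (j.+1 < n)%N, - eps <= u - j.+1%:R <= eps &
       tile_image u = pathA v (u - j.+1%:R)]).
Proof.
move=> /andP[u0 u1]; have n1 := size_ge1; have eh := eps_half.
have d0 : 0 < n%:R - 2 * eps by lra.
have e0 : 0 < 1 - 2 * eps by lra.
have r0 : 0 <= rate by rewrite /rate divr_ge0 // ltW.
have rn : (n%:R - 2 * eps) * rate = 1 - 2 * eps by rewrite /rate mulrC divfK // gt_eqF.
have p0 : 0 <= (u - eps) * rate by rewrite mulr_ge0 // subr_ge0.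
have p1 : (u - eps) * rate <= 1 - 2 * eps by rewrite -rn ler_wpM2r //; lra.
have pE : clamp eps (1 - eps) (eps + (u - eps) * rate) = eps + (u - eps) * rate.
  by apply: clamp_id; apply/andP; split; lra.
have uE : eps + (clamp eps (1 - eps) (eps + (u - eps) * rate) - eps) *
    ((n%:R - 2 * eps) / (1 - 2 * eps)) = u.
  have -> : clamp eps (1 - eps) (eps + (u - eps) * rate) - eps = (u - eps) * rate.
    by rewrite pE; ring.
  have h : rate * ((n%:R - 2 * eps) / (1 - 2 * eps)) = 1.
    by rewrite mulrA [rate * _]mulrC rn divff // gt_eqF.
  by rewrite -mulrA h; ring.
have [q qE gE] := hg (edge_point (vlB a) (eps + (u - eps) * rate)).
have tE : tile_image u = topquot_pi (@bd_glue R A k F (sshift i s)) q by exact: gE.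
rewrite /bd_image /= uE in qE; case: qE => -[j jn qE].
  left; exists j; have lq : lab q = inl (nth a w j) := congr1 snd qE.
  have pq : param q = u - j%:R := congr1 fst qE.
  have := param_itv q; rewrite lq pq => hq; split=> //.
  by rewrite tE -pq (edge_path_eq (vlA (nth a w j)) lq).
right; exists j; have lq : lab q = inr (nth a w j, nth a w j.+1) := congr1 snd qE.
have pq : param q = u - j.+1%:R := congr1 fst qE.
have v := lab_valid q; rewrite lq in v; exists v.
have := param_itv q; rewrite lq pq => hq; split=> //.
by rewrite tE -pq (edge_path_eq v lq).
Qed.

Lemma nat_close (m m' : nat) : m%:R < m'%:R + 1 :> R -> (m <= m')%N.
Proof. by rewrite natr1 ltr_nat ltnS. Qed.

(** At a breakpoint [is_bd_map] may answer with the neighbouring cell, whose point is identified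
    with the desired one by the gluing. *)
Lemma tile_image_letter j u : (j < n)%N -> eps <= u - j%:R <= 1 - eps ->
  tile_image u = pathA (vlA (nth a w j)) (u - j%:R).
Proof.
move=> jn /andP[uj0 uj1]; have e0 := bd_eps_gt0 R F; have eh := eps_half.
have jn' : j%:R + 1 <= n%:R :> R by rewrite natr1 ler_nat.
have j0 : 0 <= j%:R :> R by rewrite ler0n.
have [|[j' [_ /andP[h0 h1] ->]]|[j' [v [_ /andP[h0 h1] ->]]]] := @tile_image_cases u.
- by apply/andP; split; lra.
- have /eqP -> : j' == j by rewrite eqn_leq !nat_close //; lra.
  by [].
- rewrite -natr1 in h0 h1 *.
  have : (j' <= j)%N by apply: nat_close; lra.
  rewrite leq_eqVlt => /orP[/eqP jj|jj].
    subst j'; rewrite (_ : u - (j%:R + 1) = - eps); last by lra.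
    rewrite -edge_glue_left; congr (pathA _ _); lra.
  have {}jj : j = j'.+1.
    by apply/eqP; rewrite eqn_leq jj andbT; apply: nat_close; rewrite -natr1; lra.
  subst j; rewrite -natr1 in uj0 uj1 *.
  have uE : u - (j'%:R + 1) = eps by lra.
  rewrite uE -(edge_glue_right R v); congr (pathA _ _); lra.
Qed.

Lemma tile_image_pair j : (j.+1 < n)%N -> exists v : validA (inr (nth a w j, nth a w j.+1)),
  forall u, - eps <= u - j.+1%:R <= eps -> tile_image u = pathA v (u - j.+1%:R).
Proof.
move=> jn; have e0 := bd_eps_gt0 R F; have eh := eps_half.
have jn' : j%:R + 1 + 1 <= n%:R :> R by rewrite !natr1 ler_nat.
have j0 : 0 <= j%:R :> R by rewrite ler0n.
(* No letter cell covers the centre [j + 1], so the image of this point shows that the pair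
   occurs. *)
have [v _] : exists v : validA (inr (nth a w j, nth a w j.+1)), True.
  have [|[j' [_ /andP[h0 h1] _]]|[j' [v [_ /andP[h0 h1] _]]]] := @tile_image_cases (j%:R + 1).
  - by apply/andP; split; lra.
  - have h : (j' <= j)%N by apply: nat_close; lra.
    have h' : (j.+1 <= j')%N by apply: nat_close; rewrite -natr1; lra.
    by have := leq_trans h' h; rewrite ltnn.
  - rewrite -natr1 in h0 h1; have /eqP jj : j' == j by rewrite eqn_leq !nat_close //; lra.
    by subst j'; exists v.
exists v => u; rewrite -natr1 => /andP[u0 u1].
have [|[j' [_ /andP[h0 h1] ->]]|[j' [v' [_ /andP[h0 h1] ->]]]] := @tile_image_cases u.
- by apply/andP; split; lra.
- have : (j' <= j.+1)%N by apply: nat_close; rewrite -natr1; lra.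
  rewrite leq_eqVlt => /orP[/eqP jj|jj].
    subst j'; rewrite -natr1 in h0 h1 *.
    have uE : u - (j%:R + 1) = eps by lra.
    rewrite uE -(edge_glue_right R v); congr (pathA _ _); lra.
  have {}jj : j' = j.
    by apply/eqP; rewrite eqn_leq -ltnS jj; apply: nat_close; lra.
  subst j'; rewrite (_ : u - j%:R = 1 - eps); last by lra.
  by rewrite (edge_glue_left R v); congr (pathA _ _); lra.
- rewrite -natr1 in h0 h1 *; have /eqP jj : j' == j by rewrite eqn_leq !nat_close //; lra.
  by subst j'; rewrite (Prop_irrelevance v' v).
Qed.

End tile_image.

Context (z : Z1 (sing R KA)).
Local Notation z' := (Z1_pullback (sing_map R g) z).

Lemma pullback_path (p : continuousType R KB) (G : continuousType R KA) a b a' b' :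
  (forall t, 0 <= t <= 1 -> g (p (a * (1 - t) + b * t)) = G (a' * (1 - t) + b' * t)) ->
  val z' (path_seg p a b) = val z (path_seg G a' b').
Proof.
move=> h; rewrite -[LHS]/(val z (sing_comp g (path_seg p a b))); congr (val z _).
apply/continuousEP => x; rewrite /= coord_sum1; apply: h.
by rewrite coord_ge0 -subr_ge0 -coord_sum1 coord_ge0.
Qed.

Lemma weight_pullback_pair a b : validB (inr (a, b)) ->
  weight z' (inr (a, b)) = weight z (inr (last a (sub a), head b (sub b))).
Proof.
move=> v; have [v' h] := bd_map_cross v.
rewrite /weight (edge_intE _ v) (edge_intE _ v'); apply: pullback_path => t _; exact: h.
Qed.

(** Each step of the induction appends to the path the edge of one pair and then the edge of one
    letter. *)
Lemma tile_image_weight a m : eps < 2^-1 -> (m < size (sub a))%N ->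
  val z (path_seg (tile_image a) eps (m%:R + 1 - eps)) =
  \sum_(0 <= j < m.+1) weight z (inl (nth a (sub a) j)) +
  \sum_(0 <= j < m) weight z (inr (nth a (sub a) j, nth a (sub a) j.+1)).
Proof.
move=> eps_half; have e0 := bd_eps_gt0 R F.
have letter j : (j < size (sub a))%N ->
    val z (path_seg (tile_image a) (j%:R + eps) (j%:R + 1 - eps)) = weight z (inl (nth a (sub a) j)).
  move=> jn; rewrite /weight (edge_intE _ (vlA _)); congr (val z _); apply: path_seg_eq => t /andP[t0 t1].
  have : 0 <= (1 - 2 * eps) * t by rewrite mulr_ge0 //; lra.
  have : 0 <= (1 - 2 * eps) * (1 - t) by rewrite mulr_ge0 //; lra.
  move=> h1 h2; rewrite (tile_image_letter eps_half jn); last by apply/andP; split; lra.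
  by congr (pathA _ _); rewrite /=; ring.
elim: m => [|m IH] mn.
  rewrite big_nat1 [X in _ = _ + X]big_geq // addr0 -letter //.
  by congr (val z _); congr path_seg; ring.
rewrite big_nat_recr //= [X in _ = _ + X]big_nat_recr //= -letter //.
have -> (x y x' y' : int) : x + y + (x' + y') = x + x' + (y' + y) by ring.
rewrite -IH; last exact: ltnW.
rewrite -[m.+1%:R]natr1 -[LHS](sing_path_add z (tile_image a) eps (m%:R + 1 - eps)).
congr (_ + _).
rewrite -[LHS](sing_path_add z (tile_image a) (m%:R + 1 - eps) (m%:R + 1 + eps)); congr (_ + _).
have [v hv] := tile_image_pair eps_half mn.
rewrite /weight (edge_intE _ v); congr (val z _); apply: path_seg_eq => t /andP[t0 t1].
have : 0 <= eps * t by rewrite mulr_ge0 //; lra.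
have : 0 <= eps * (1 - t) by rewrite mulr_ge0 //; lra.
move=> h1 h2; rewrite hv -natr1; last by apply/andP; split; lra.
by congr (pathA _ _); rewrite /=; ring.
Qed.

Lemma weight_pullback_letter a : weight z' (inl a) =
  \sum_(0 <= j < size (sub a)) weight z (inl (nth a (sub a) j)) +
  \sum_(0 <= j < (size (sub a)).-1) weight z (inr (nth a (sub a) j, nth a (sub a) j.+1)).
Proof.
have e0 := bd_eps_gt0 R F; have e1 := bd_eps_le_half R F.
have s0 : (0 < size (sub a))%N by rewrite lt0n size_eq0 subst_neq0.
(* If eps = 1/2, the edges e_a are points and phi(a) has length one. *)
have := e1; rewrite le_eqVlt => /orP[/eqP eh|eh].
  have wl s' (x : Z1 (sing R (bd_complex R F s'))) b : weight x (inl b) = 0.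
    rewrite /weight /= (_ : 1 - eps = eps); first exact: edge_int_cst.
    by rewrite eh; lra.
  have n1 : (size (sub a) <= 1)%N.
    have := bd_eps_size R F (s i) a; rewrite eh mulfV ?pnatr_eq0 // mulr1.
    by rewrite -[X in _ <= X]/(1%:R) ler_nat.
  have -> : size (sub a) = 1%N by apply/eqP; rewrite eqn_leq n1.
  by rewrite big_nat1 [X in _ = _ + X]big_geq // !wl.
have [m mE] : exists m, size (sub a) = m.+1 by exists (size (sub a)).-1; rewrite prednK.
rewrite [in RHS]mE -tile_image_weight //; last by rewrite mE.
rewrite /weight (edge_intE _ (vlB a)); apply: pullback_path => t _.
rewrite /tile_image /=; congr (g (pathB _ _)).
rewrite /rate mE -[m.+1%:R]natr1.
have d0 : m%:R + 1 - 2 * eps != 0.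
  by have m0 : 0 <= m%:R :> R := ler0n _ _; rewrite gt_eqF //; lra.
have -> : eps * (1 - t) + (m%:R + 1 - eps) * t - eps = t * (m%:R + 1 - 2 * eps) by ring.
have -> : t * (m%:R + 1 - 2 * eps) * ((1 - 2 * eps) / (m%:R + 1 - 2 * eps)) = t * (1 - 2 * eps).
  by rewrite mulrA mulrAC mulfK.
by rewrite /=; ring.
Qed.

Definition weight_fun s' (x : Z1 (sing R (bd_complex R F s'))) (T : biseq A) : int :=
  weight x (inl (T 0)) + weight x (inr (T 0, T 1)).

(** The word of [T 0] contains one pair less than letters: the last pair of the sum straddles the
    words of [T 0] and [T 1], and it is the image of the edge labelled by [(T 0, T 1)]. *)
Lemma push_weight_fun T : level F s i.+1 T ->
  push sub (phi F s i) (weight_fun z) T = weight_fun z' T.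
Proof.
move=> lT; have cov := phi_covers F s i.
have s0 a : (0 < size (sub a))%N by rewrite lt0n size_eq0 subst_neq0.
have vT : validB (inr (T 0, T 1)) by exists T, 0.
rewrite /push /birkhoff /weight_fun weight_pullback_letter weight_pullback_pair // big_split /=.
have E j : (j < size (sub (T 0)))%N -> phi F s i T j%:Z = nth (T 0) (sub (T 0)) j.
  by move=> jn; apply: (covers_nth cov).
have bE j : bishift j%:Z (phi F s i T) 0 = phi F s i T j%:Z by rewrite /bishift add0r.
have bE1 j : bishift j%:Z (phi F s i T) 1 = phi F s i T j.+1%:Z.
  by rewrite /bishift; congr (phi F s i T _); rewrite -addn1 PoszD addrC.
rewrite -addrA; congr (_ + _).
  by apply: eq_big_nat => j /= jn; rewrite bE E.
have [m mE] : exists m, size (sub (T 0)) = m.+1 by exists (size (sub (T 0))).-1; rewrite prednK.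
rewrite mE big_nat_recr //=; congr (_ + _).
  by apply: eq_big_nat => j /= jm; rewrite bE bE1 !E // mE ltnS // ltnW.
rewrite bE bE1 E ?mE // -[in last _ _]/(last _ _).
congr (weight z (inr (_, _))); first by rewrite (last_nth (T 0)) /= mE.
have -> : phi F s i T m.+1%:Z = phi F s i (bishift 1 T) 0.
  by rewrite (covers_shift cov) mE /bishift add0r.
have -> : phi F s i (bishift 1 T) 0 = nth (T 1) (sub (bishift 1 T 0)) 0.
  by apply: (covers_nth cov); rewrite s0.
rewrite /bishift add0r.
by case: (sub (T 1)).
Qed.

End cellular_map.

(** * Comparison of the two limits *)

Section weights.
Context (R : realType) (A : finType) (k : nat) (F : 'I_k.+1 -> substitution A).
Context (s : nat -> 'I_k.+1).
Implicit Types z : Z1 (sing R (bd_complex R F s)).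

Lemma weightB z z' l : weight (z - z') l = weight z l - weight z' l.
Proof.
by rewrite /weight /edge_int; case: pselect => v; rewrite ?subrr // raddfB.
Qed.

Lemma weight_funB z z' T : weight_fun (z - z') T = weight_fun z T - weight_fun z' T.
Proof. by rewrite /weight_fun !weightB; ring. Qed.

Lemma weight_fun_windowed P z : windowed P (weight_fun z).
Proof. by exists 1%N => T U _ _ TU; rewrite /weight_fun !TU. Qed.

(** [weight_fun z T] is the variation of [h] from the left end of the edge of [T 0] to that of
    [T 1]. *)
Lemma weight_fun_coboundary z : \pi_(H1 (sing R (bd_complex R F s))) z = 0 ->
  cohomologous (Sigma F s) (weight_fun z) (fun=> 0).
Proof.
move=> /sing_path_boundary[h zh].
pose e a : bd_complex R F s := edge_path R (vl F s a) (bd_eps R F).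
exists (fun T => - h (e (T 0))).
  by exists 0%N => T U _ _ TU; rewrite TU.
move=> T sT; have v : valid F s (inr (T 0, T 1)) by exists T, 0.
rewrite /weight_fun /weight (edge_intE _ (vl F s (T 0))) (edge_intE _ v) !zh /bishift add0r.
rewrite /lo /hi -(edge_glue_right R v) -(edge_glue_left R v) /e; ring.
Qed.

End weights.

Section main.
Context (R : realType) (A : finType) (k : nat) (F : 'I_k.+1 -> substitution A).
Context (s : nat -> 'I_k.+1) (prim : primitive F s) (recog : recognisable R F s).
Local Notation K := (fun i => bd_complex R F (sshift i s)).
Context (g : forall i, continuousType (K i.+1) (K i)) (hg : forall i, is_bd_map (g i)).
Local Notation level := (level F s).
Local Notation phi := (phi F s).
Local Notation pushn := (pushn F s).
Local Notation G := (fun i => sing_H1 R (bd_complex R F (sshift i s))).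
Local Notation D := (@seqsys G (fun i => sing_pullback R (g i))).
Implicit Types (f : biseq A -> int).

Lemma eq_push i f f' : (forall T, level i T -> f T = f' T) ->
  forall T, level i.+1 T -> push (F (s i)) (phi i) f T = push (F (s i)) (phi i) f' T.
Proof.
move=> ff' T lT; apply: eq_birkhoff _ _ ff'; last exact: level_phi.
by move=> m U; exact: level_shift.
Qed.

(** This is [pushn 0 i], restated so that the levels are [j] and not [j + 0]. *)
Fixpoint descend i f : biseq A -> int :=
  if i is j.+1 then push (F (s j)) (phi j) (descend j f) else f.

Lemma descend_add d i f : pushn i d (descend i f) = descend (d + i) f.
Proof. by elim: d => //= d ->. Qed.

Lemma push_windowed_level i f :
  windowed (level i) f -> windowed (level i.+1) (push (F (s i)) (phi i) f).
Proof. exact: (@pushn_windowed A k F s i 1). Qed.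

Lemma descend_windowed i f : windowed (level 0) f -> windowed (level i) (descend i f).
Proof. by move=> wf; elim: i => //= i; exact: push_windowed_level. Qed.

Lemma descend_cohomologous i f f' : cohomologous (level 0) f f' ->
  cohomologous (level i) (descend i f) (descend i f').
Proof. by move=> ff'; elim: i => //= i; exact: (@pushn_cohomologous A k F s i 1). Qed.

Lemma descendB i f f' :
  descend i (fun T => f T - f' T) = fun T => descend i f T - descend i f' T.
Proof.
elim: i => //= i ->; apply/funext => T; exact: birkhoffB.
Qed.

Lemma descend0 i : descend i (fun=> 0) = fun=> 0.
Proof. by elim: i => //= i ->; apply/funext => T; rewrite /push /birkhoff big1. Qed.

Lemma descend_inj i f : windowed (level 0) f ->
  cohomologous (level i) (descend i f) (fun=> 0) -> cohomologous (level 0) f (fun=> 0).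
Proof.
move=> wf; elim: i => //= i IH h; apply: IH.
apply: push_inj h; first exact: recognisable_unique (recog (i := i)).
exact: descend_windowed.
Qed.

Lemma descend_surj i f : windowed (level i) f ->
  exists2 f', windowed (level 0) f' & forall T, level i T -> descend i f' T = f T.
Proof.
elim: i f => [|i IH] f wf; first by exists f.
have [f1 wf1 e1] := push_surj (recognisable_unique (recog (i := i))) wf.
have [f' wf' e'] := IH _ wf1; exists f' => // T lT /=.
by rewrite -e1 //; exact: eq_push.
Qed.

Definition cocycles i : Type := Z1 (sing R (K i)).

Definition pull i (z : cocycles i) : cocycles i.+1 := Z1_pullback (sing_map R (g i)) z.

(** Lifts the transition maps of the direct system to cocycles; with the level written [d + i], each
    step is well typed by computation. *)
Fixpoint pullz i d (z : cocycles i) : cocycles (d + i) :=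
  match d return cocycles (d + i) with d'.+1 => pull (pullz d' z) | 0 => z end.

Lemma pullz_map i d (h : (i <= d + i)%N) (z : Z1 (sing R (K i))) :
  @ds_map D i (d + i)%N h (\pi_(H1 (sing R (K i))) z) =
  \pi_(H1 (sing R (K (d + i)))) (pullz d z).
Proof.
rewrite -[LHS]/(seqsys_map (fun i => sing_pullback R (g i)) h _) seqsys_map_addE.
by elim: d {h} => //= d ->; rewrite /sing_pullback H1_pullbackE.
Qed.

Lemma pullz_class i d (z : Z1 (sing R (K i))) :
  @dirlim_in D (d + i)%N (\pi_(H1 (sing R (K (d + i)))) (pullz d z)) =
  @dirlim_in D i (\pi_(H1 (sing R (K i))) z).
Proof.
by rewrite -(pullz_map (leq_addl d i)); exact: dirlim_in_map.
Qed.

Lemma pullz_weight i d (z : Z1 (sing R (K i))) T : level (d + i) T ->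
  pushn i d (weight_fun z) T = weight_fun (pullz d z) T.
Proof.
elim: d T => //= d IH T lT; rewrite -(@push_weight_fun R A k F s (d + i) (g (d + i)) (@hg (d + i)%N)) //.
exact: eq_push.
Qed.

Definition represents i f (z : Z1 (sing R (K i))) :=
  cohomologous (level i) (descend i f) (weight_fun z).

Lemma represents_pull i d f (z : Z1 (sing R (K i))) :
  represents f z -> represents f (pullz d z).
Proof.
move=> h; rewrite /represents -descend_add.
apply: cohomologous_trans (pushn_cohomologous d h) _.
by apply: eq_cohomologous => T lT; exact: pullz_weight.
Qed.

Lemma represents_later i j f (z : Z1 (sing R (K i))) : (i <= j)%N -> represents f z ->
  exists2 z' : Z1 (sing R (K j)), represents f z' &
    @dirlim_in D i (\pi_(H1 (sing R (K i))) z) = @dirlim_in D j (\pi_(H1 (sing R (K j))) z').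
Proof.
move=> ij h; have [d e] : exists d, (d + i)%N = j by exists (j - i)%N; rewrite subnK.
by subst j; exists (pullz d z); [exact: represents_pull|rewrite pullz_class].
Qed.

Lemma representsB i f f' (z z' : Z1 (sing R (K i))) : represents f z -> represents f' z' ->
  represents (fun T => f T - f' T) (z - z').
Proof.
move=> h h'; rewrite /represents descendB.
apply: cohomologous_trans (cohomologousB h h') _.
by apply: eq_cohomologous => T _; rewrite weight_funB.
Qed.

Lemma represents_ex f : windowed (level 0) f ->
  exists i (z : Z1 (sing R (K i))), represents f z.
Proof.
move=> wf; have [d [om h]] := pushn_two_letters prim wf.
have [z [z0 z1]] := @weight_realise R A k F (sshift (d + 0) s) (fun ab => om ab.1 ab.2).
exists (d + 0)%N, z; rewrite /represents -(descend_add d 0).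
apply: cohomologous_trans h _; apply: eq_cohomologous => T lT.
by rewrite /weight_fun z0 z1 ?add0r //; exists T, 0.
Qed.

(** After enough pushes the weights of [e_a] and [e_ab] add up to [H b - H a]. Heights [H] at the
    left ends, and [H] plus the weight of [e_a] at the right ends, then account for all edges. *)
Lemma weight_fun_eq0 i (z : Z1 (sing R (K i))) :
  cohomologous (level i) (weight_fun z) (fun=> 0) ->
  @dirlim_in D i (\pi_(H1 (sing R (K i))) z) = 0.
Proof.
move=> h; have [d [H hH]] := @pushn_coboundary A k F s i (weight_fun z)
  (fun a b => weight z (inl a) + weight z (inr (a, b))) prim (fun _ _ => erefl) h.
rewrite -(pullz_class d z).
rewrite (@graph_coboundary R A k F (sshift (d + i) s) (pullz d z) H
  (fun a => H a + weight (pullz d z) (inl a))) ?raddf0 //.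
move=> [a _|[a b] [T [m [lT /= Ta Tb]]]] /=; first by rewrite addrC addKr.
have := hH _ (@level_shift A k F s (d + i) m T lT).
rewrite (pullz_weight _ (level_shift m lT)) /weight_fun /bishift add0r [1 + m]addrC Ta Tb.
by move=> e; rewrite opprD addrA -e; ring.
Qed.

Definition corresponds (x : cech_H1 (Omega R F s)) (y : dirlim D) :=
  exists c f i (z : Z1 (sing R (K i))), [/\ cech_class x c, holonomy c f, represents f z &
    y = @dirlim_in D i (\pi_(H1 (sing R (K i))) z)].

Lemma corresponds_bijection :
  exists f : {additive cech_H1 (Omega R F s) -> dirlim D}, bijective f.
Proof.
apply: (additive_bijection_of_rel (r := corresponds)).
- move=> x x' y y' [c [f [i [z [xc cf fz ->]]]]] [c' [f' [i' [z' [xc' cf' fz' ->]]]]].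
  have [w fw ->] := represents_later (leq_maxl i i') fz.
  have [w' fw' ->] := represents_later (leq_maxr i i') fz'.
  exists (fun p q => c p q - c' p q), (fun T => f T - f' T), (maxn i i'), (w - w').
  split; [exact: cech_classB|exact: holonomyB|exact: representsB|].
  by rewrite !raddfB.
(* Totality rests on primitivity, through the reduction to two letters in [represents_ex]. *)
- move=> x; have [c xc] := cech_class_ex x; have [f cf] := holonomy_ex xc.1.
  have [i [z fz]] := represents_ex cf.1.
  by exists (@dirlim_in D i (\pi_(H1 (sing R (K i))) z)), c, f, i, z.
(* Surjectivity rests on recognisability, which brings a function at level [i] back to level 0. *)
- move=> y; have [i [u ->]] := dirlim_in_surj y.
  pose z : Z1 (sing R (K i)) := repr (u : H1 (sing R (K i))).
  have [f wf hf] := descend_surj (weight_fun_windowed (level i) z).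
  have [x xc] := cech_class_surj (@jump_cocycle_as_cocycle R A k F s f wf).
  exists x, (jump_cocycle f), f, i, z; split=> //.
  + exact: holonomy_surj.
  + exact: eq_cohomologous.
  + by rewrite /z reprK.
- move=> y [c [f [i [z [xc cf fz ->]]]]]; apply: weight_fun_eq0.
  have c0 := (cech_class_eq0 xc).1 erefl.
  have h0 : @holonomy R A k F s (fun _ _ => 0) (fun=> 0).
    split; first by exists 0%N.
    exists (fun=> 0); split=> // T t _.
    by exists setT; first exact: filterT.
  have f0 := holonomy_cohomologous cf h0 c0.
  apply: cohomologous_trans (cohomologous_sym fz) _.
  by have := descend_cohomologous i f0; rewrite descend0.
(* A class that vanishes in the limit vanishes at a finite level, and [descend_inj] carries this
   back to level 0. *)
- move=> x [c [f [i [z [xc cf fz y0]]]]].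
  have wf := cf.1; apply/(cech_class_eq0 xc); apply: holonomy_coboundary (xc.1) cf _.
  rewrite -(raddf0 (@dirlim_in D i)) in y0; have [j [ij [ij' e]]] := (dirlim_inP _ _).1 y0.
  have [d dj] : exists d, (d + i)%N = j by exists (j - i)%N; rewrite subnK.
  subst j.
  have z0 : \pi_(H1 (sing R (K (d + i)))) (pullz d z) = 0.
    by rewrite -(pullz_map ij') -e raddf0.
  apply: (@descend_inj (d + i)) wf _.
  by apply: cohomologous_trans (represents_pull d fz) _; exact: weight_fun_coboundary.
Qed.

End main.

Theorem theorem3p8 (R : realType) (A : finType) (k : nat)
    (F : 'I_k.+1 -> substitution A) (s : nat -> 'I_k.+1)
    (prim : primitive F s) (recog : recognisable R F s)
    (g : forall i : nat, continuousType (bd_complex R F (sshift i.+1 s))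
                                        (bd_complex R F (sshift i s)))
    (hg : forall i : nat, is_bd_map (g i)) :
  exists f : {additive cech_H1 (Omega R F s) ->
                dirlim (@seqsys (fun i => sing_H1 R (bd_complex R F (sshift i s)))
                                (fun i => sing_pullback R (g i)))},
    bijective f.
Proof. exact: corresponds_bijection. Qed.
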